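(* Let $\Omega\subset\mathbb{R}^2$ be open and bounded with $\partial\Omega\in C^{0,1}$, let $0<\gamma<1$, let $\rho$ be as described in the context, and let $u\in\mathcal{A}_{u_0}$ be a stationary point of the functional $$I(u)=\int_\Omega\tfrac12|\nabla u|^2+\rho(\det\nabla u)\,dx.$$ Then $u\in W^{2,2}_{loc}(\Omega,\mathbb{R}^2)$.
   Context: The function $\rho\in C^\infty(\mathbb{R})$ is given by $\rho(s)=0$ for $s\le 0$, $\rho(s)=\rho_1(s)$ for $0\le s\le s_0$, and $\rho(s)=\gamma s+\kappa$ for $s\ge s_0$, where $\gamma>0$, $s_0\ge0$, $\kappa\ge-\gamma s_0$ are constants and $\rho_1:[0,s_0]\to\mathbb{R}$ is smooth and convex with $\rho_1(0)=0$, $\rho_1(s_0)=\gamma s_0+\kappa$, the pieces being connected so that $\rho$ is smooth on $\mathbb{R}$; $\rho$ is convex on $\mathbb{R}$. $\mathcal{A}_{u_0}=\{u\in W^{1,2}(\Omega,\mathbb{R}^2): u=u_0\text{ on }\partial\Omega\text{ in the trace sense}\}$ for a given boundary datum $u_0$. A stationary point of $I$ is a map $u$ with $\int_\Omega(\nabla u+\rho'(\det\nabla u)\,\mathrm{cof}\,\nabla u)\cdot\nabla\varphi\,dx=0$ for all $\varphi\in C_c^\infty(\Omega,\mathbb{R}^2)$ (equivalently for all $\varphi\in W^{1,2}_0(\Omega,\mathbb{R}^2)$), where $\mathrm{cof}\,A=\begin{pmatrix}a_{22}&-a_{21}\\-a_{12}&a_{11}\end{pmatrix}$ and $\cdot$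 is the Frobenius inner product. *)

(* Defs.v *)
From HB Require Import structures.
From mathcomp Require Export all_boot all_order all_algebra.
From mathcomp Require Export all_classical all_reals all_analysis.

Set Implicit Arguments.
Unset Strict Implicit.
Unset Printing Implicit Defensive.

Import Order.TTheory GRing.Theory Num.Theory.
Import numFieldNormedType.Exports.

Local Open Scope classical_set_scope.
Local Open Scope ring_scope.

(* Points of the plane have type [R * R], so that Lebesgue measure on it is
   the library's product measure.  The library norm on [R * R] is the sup
   norm; topology, compactness and boundedness are unaffected, but metric
   notions (balls, diameters) below use [edist]. *)

Section Plane.
Context {R : realType}.
Implicit Types (x y : R * R) (U Om : set (R * R)).

Local Notation plane := (measurableTypeR R * measurableTypeR R)%type.

Definition leb2 : {measure set plane -> \bar R} :=
  (@lebesgue_measure R \x @lebesgue_measure R)%E.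

Definition edist x y : R :=
  Num.sqrt ((x.1 - y.1) ^+ 2 + (x.2 - y.2) ^+ 2).

Definition boundary U : set (R * R) := closure U `\` interior U.

(* Near every boundary point, in coordinates rotated by the angle with cosine
   [c] and sine [s], [Om] is the strict epigraph of a Lipschitz function. *)
Definition lipschitz_boundary Om : Prop :=
  forall x0, boundary Om x0 -> exists (r c s L : R) (g : R -> R),
    [/\ 0 < r, c ^+ 2 + s ^+ 2 = 1, L.-lipschitz g &
      forall x, edist x x0 < r ->
        (Om x <-> g (c * x.1 + s * x.2) < - s * x.1 + c * x.2)].

Definition e_ (i : 'I_2) : R * R := if i == 0 then (1, 0) else (0, 1).

Definition partials (s : seq 'I_2) (f : R * R -> R) : R * R -> R :=
  foldr (fun i g => 'D_(e_ i) g) f s.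

Definition smooth2 (f : R * R -> R) : Prop :=
  forall s, continuous (partials s f) /\
    forall i x, derivable (partials s f) x (e_ i).

(* C_c^oo(Om) *)
Definition test_function Om (phi : R * R -> R) : Prop :=
  [/\ smooth2 phi, compact (closure [set x | phi x != 0]) &
      closure [set x | phi x != 0] `<=` Om].

Definition locally_integrable2 U (f : R * R -> R) : Prop :=
  forall K, compact K -> K `<=` U -> leb2.-integrable K (EFin \o f).

(* Functions are Borel representatives of their a.e. classes. *)
Definition L2 U (f : R * R -> R) : Prop :=
  measurable_fun (U : set plane) f /\ leb2.-integrable U (fun x => (f x ^+ 2)%:E).

(* [g] is the weak derivative of [f] on [U], once in each direction listed
   in [s]. *)
Definition weak_deriv U (s : seq 'I_2) (f g : R * R -> R) : Prop :=
  [/\ locally_integrable2 U f, locally_integrable2 U g &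
      forall phi, test_function U phi ->
        \int[leb2]_(x in U) (f x * partials s phi x) =
        (-1) ^+ size s * \int[leb2]_(x in U) (g x * phi x)].

(* W^{k,2}(U); the multi-index [::] gives f \in L^2(U). *)
Definition sobolev (k : nat) U (f : R * R -> R) : Prop :=
  forall s : seq 'I_2, (size s <= k)%N ->
    exists g, weak_deriv U s f g /\ L2 U g.

(* One-dimensional Hausdorff measure.  Covers by Borel sets suffice, as
   passing to closures does not change diameters. *)
Definition diam U : \bar R :=
  ereal_sup ([set (edist z.1 z.2)%:E | z in U `*` U] `|` [set 0%E]).

Definition diam_upto (delta : R) U : \bar R :=
  (if diam U <= delta%:E then diam U else +oo)%E.

Definition hausdorff1_upto (delta : R) : set (R * R) -> \bar R :=
  mu_ext (diam_upto delta : set plane -> \bar R).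

Definition hausdorff1 U : \bar R :=
  ereal_sup [set hausdorff1_upto delta U | delta in [set d | 0 < d]].

Lemma diam_ge0 U : (0 <= diam U)%E.
Proof. by apply: ereal_sup_ubound; right. Qed.

Lemma diam_upto_ge0 delta U : (0 <= diam_upto delta U)%E.
Proof. by rewrite /diam_upto; case: ifP => // _; exact: diam_ge0. Qed.

Lemma diam_upto0 delta : 0 < delta -> diam_upto delta set0 = 0%E.
Proof.
move=> d0; suff d00 : diam set0 = 0%E by rewrite /diam_upto d00 lee_fin ltW.
rewrite /diam set0X image_set0 set0U; exact: ereal_sup1.
Qed.

Lemma hausdorff1_set0 : hausdorff1 set0 = 0%E.
Proof.
apply/eqP; rewrite eq_le; apply/andP; split.
  apply: ge_ereal_sup => _ [d /= d0 <-].
  by rewrite /hausdorff1_upto mu_ext0 //; [exact: diam_upto0|exact: diam_upto_ge0].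
apply: ereal_sup_ubound; exists 1 => //=.
by rewrite /hausdorff1_upto mu_ext0 //; [exact: diam_upto0|exact: diam_upto_ge0].
Qed.

Lemma hausdorff1_upto_le delta U :
  0 < delta -> (hausdorff1_upto delta U <= hausdorff1 U)%E.
Proof. by move=> d0; apply: ereal_sup_ubound; exists delta. Qed.

Lemma hausdorff1_ge0 U : (0 <= hausdorff1 U)%E.
Proof.
apply: le_trans (hausdorff1_upto_le U ltr01).
by apply: mu_ext_ge0; exact: diam_upto_ge0.
Qed.

Lemma le_hausdorff1 : {homo hausdorff1 : A B / A `<=` B >-> (A <= B)%E}.
Proof.
move=> A B AB; apply: ge_ereal_sup => _ [d /= d0 <-].
by apply: le_trans (hausdorff1_upto_le B d0); exact: le_mu_ext.
Qed.

Lemma hausdorff1_sigma_subadditive : sigma_subadditive hausdorff1.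
Proof.
move=> F; apply: ge_ereal_sup => _ [d /= d0 <-].
apply: le_trans (mu_ext_sigma_subadditive (diam_upto_ge0 d) F) _.
apply: lee_nneseries => [n _ _|n _].
  by apply: mu_ext_ge0; exact: diam_upto_ge0.
exact: hausdorff1_upto_le.
Qed.

HB.instance Definition _ := isOuterMeasure.Build R (R * R)%type hausdorff1
  hausdorff1_set0 hausdorff1_ge0 le_hausdorff1 hausdorff1_sigma_subadditive.

Definition H1_outer : {outer_measure set (R * R) -> \bar R} := hausdorff1.

Definition H1 : {measure set (caratheodory_type H1_outer) -> \bar R} :=
  (H1_outer : set (caratheodory_type H1_outer) -> \bar R).

(* [h] is the image of [f] under the trace operator
   W^{1,2}(Om) -> L^2(bd Om; H^1), the continuous extension of restriction to
   [boundary Om] of functions smooth up to the boundary. *)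
Definition has_trace Om (f h : R * R -> R) : Prop :=
  measurable_fun (boundary Om : set (caratheodory_type H1_outer)) h /\
  exists (g : 'I_2 -> R * R -> R) (v : nat -> R * R -> R),
  [/\ forall j, weak_deriv Om [:: j] f (g j),
      forall n, smooth2 (v n),
      (\int[leb2]_(x in Om) ((v n x - f x) ^+ 2)%:E)%E @[n --> \oo] --> 0%E,
      forall j, (\int[leb2]_(x in Om) (('D_(e_ j) (v n) x - g j x) ^+ 2)%:E)%E
                  @[n --> \oo] --> 0%E &
      (\int[H1]_(x in boundary Om) ((v n x - h x) ^+ 2)%:E)%E
        @[n --> \oo] --> 0%E].

End Plane.

Section Problem.
Context {R : realType}.
Implicit Types (Om U : set (R * R)) (u phi : R * R -> 'cV[R]_2).
Implicit Types (A B : 'M[R]_2) (rho : R -> R).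

Definition component u (i : 'I_2) : R * R -> R := fun x => u x i 0.

Definition weak_gradient Om u (Du : R * R -> 'M[R]_2) : Prop :=
  forall i j, weak_deriv Om [:: j] (component u i) (fun x => Du x i j).

Definition gradient phi (x : R * R) : 'M[R]_2 :=
  \matrix_(i, j) 'D_(e_ j) (component phi i) x.

Definition frob A B : R := \sum_i \sum_j A i j * B i j.

Definition cof A : 'M[R]_2 := (\adj A)^T.

Definition admissible Om u0 u : Prop :=
  forall i, sobolev 1 Om (component u i) /\ has_trace Om (component u i) (component u0 i).

(* Weak Euler-Lagrange equation of
   I(u) = \int_Om 1/2 |grad u|^2 + rho (det grad u). *)
Definition stationary Om rho u : Prop :=
  exists2 Du, weak_gradient Om u Du &
    forall phi, (forall i, test_function Om (component phi i)) ->
      \int[leb2]_(x in Om)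
         frob (Du x + derive1 rho (\det (Du x)) *: cof (Du x)) (gradient phi x) = 0.

Definition W22_loc Om u : Prop :=
  forall U, open U -> compact (closure U) -> closure U `<=` Om ->
    forall i, sobolev 2 U (component u i).

Definition smooth1 (f : R -> R) : Prop :=
  forall n x, derivable (derive1n n f) x 1.

Record rho_spec (gamma s0 kappa : R) rho1 rho : Prop := RhoSpec {
  rho_gamma : 0 < gamma;
  rho_s0 : 0 <= s0;
  rho_kappa : - (gamma * s0) <= kappa;
  rho1_smooth : exists2 f, smooth1 f & {in `[0, s0], f =1 rho1};
  rho1_convex : @convex_function R R^o `[0, s0] rho1;
  rho1_0 : rho1 0 = 0;
  rho1_s0 : rho1 s0 = gamma * s0 + kappa;
  rho_smooth : smooth1 rho;
  rho_convex : @convex_function R R^o setT rho;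
  rho_neg : forall s : R, s <= 0 -> rho s = 0;
  rho_mid : forall s : R, 0 <= s <= s0 -> rho s = rho1 s;
  rho_pos : forall s : R, s0 <= s -> rho s = gamma * s + kappa }.

End Problem.

(* Main.v *)
Require Import Defs.
From HB Require Import structures.
From mathcomp Require finmap.
From mathcomp Require Import measurable_realfun ring lra.

Import Order.TTheory GRing.Theory Num.Theory.
Import numFieldNormedType.Exports.
Local Open Scope classical_set_scope.
Local Open Scope ring_scope.

Set Implicit Arguments.
Unset Strict Implicit.
Unset Printing Implicit Defensive.

(** Write [F] for the gradient of [u], [a] for the derivative of [rho] and
    [T = F + a (det F) cof F] for the field whose weak divergence vanishes. It
    suffices to bound the differences of [F] at distance [h] by a multiple of [h]
    in mean square on compact subsets of [Om].

    As [rho] is convex and has slope [0] on the left and [gamma] on the right, [a]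
    is nondecreasing with values in [[0, gamma]]. Since [cof] is linear in
    dimension two and [|det B| <= |B|^2 / 2], the field [T] is strongly monotone
    in [F] with constant [1 - gamma > 0], and monotonicity even leaves over the
    term [p = (a' - a) (det F' - det F)], where primes denote values at
    [x + h e_k] ([stress_monotone]). The equation is tested with the difference of
    step [- h] of [eta^2 w], where [eta] is a cut-off function and [w] the
    difference of [u] ([tested_equation]).

    The obstacle is that [T] is not Lipschitz continuous in [F]: its increment is
    [F' - F + a' cof (F' - F) + (a' - a) cof F], and the last term, paired with
    the product of [2 eta w] and the gradient of [eta], is a product of two
    gradients without any smallness in [L^2]. Replace [w] by [h] times the [k]-th
    column of [F]. Cramer's rule ([cof_gradient]) then turns the product into
    [2 h eta (a' - a) det F] times the [k]-th derivative of [eta], in which the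
    gradient occurs only through its determinant. Now [a] varies only on [[0, s0]], so that
    [|a' - a| |det F| <= s0 |a' - a| + p] ([drho_arg_le]), and [a] is Lipschitz
    continuous, so that [|a' - a|^2] is at most a multiple of [p]; both terms are
    absorbed by the [eta^2 p] left over, up to [h^2] times an integrable function
    ([energy_pointwise]).

    What was discarded from [w] is, weighted with [eta], at most [h B] in norm,
    where [B] is the supremum of the norms of [eta (F(x + t e_k) - F(x))] over
    [0 <= t <= h] ([remainder_sobolev]). The energy inequality therefore reads
    [(1 - gamma) B^2 <= C (h B + h^2)], and [B] is at most a multiple of [h]
    ([difference_bound]).

    Consequently the pairing of [F] with a derivative of a test function [phi] is
    bounded by the norm of [phi] ([gradient_pairing_bound]), and the Riesz
    representation theorem ([riesz_subspace]) yields the second weak derivatives.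
    The admissibility condition supplies smooth approximations of [u], through
    which the test functions and the remainder estimate pass to the limit, and
    cut-off functions are built from [a / gamma], which is a smooth step. *)

(** * Borel sets of the plane *)

Section PlaneMeasure.
Context {R : realType}.
Implicit Types (U : set (R * R)) (v : R * R).

Local Notation plane := (measurableTypeR R * measurableTypeR R)%type.
Local Notation mu := (@leb2 R).

Definition cbox (p : R * R) (r : R) : set (R * R) :=
  `[p.1 - r, p.1 + r] `*` `[p.2 - r, p.2 + r].
Definition obox (p : R * R) (r : R) : set (R * R) :=
  `]p.1 - r, p.1 + r[ `*` `]p.2 - r, p.2 + r[.

Lemma cbox_compact p r : compact (cbox p r).
Proof. by apply: compact_setX; exact: segment_compact. Qed.

Lemma obox_open p r : open (obox p r).
Proof.
have -> : obox p r =
    (fst @^-1` `]p.1 - r, p.1 + r[) `&` (snd @^-1` `]p.2 - r, p.2 + r[) by [].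
apply: openI; apply: open_comp => //; try exact: interval_open.
  by move=> x _; exact: cvg_fst.
by move=> x _; exact: cvg_snd.
Qed.

Lemma obox_sub_cbox p r : obox p r `<=` cbox p r.
Proof.
by move=> x [/= x1 x2]; split; apply: subset_itv_oo_cc.
Qed.

Lemma measurable_obox p r : measurable (obox p r : set plane).
Proof. by apply: measurableX; exact: measurable_itv. Qed.

Lemma measurable_cbox p r : measurable (cbox p r : set plane).
Proof. by apply: measurableX; exact: measurable_itv. Qed.

Lemma open_cbox U x : open U -> U x -> exists2 r, 0 < r & cbox x r `<=` U.
Proof.
move=> oU Ux; have /nbhs_ballP[e /= e0 eU] : nbhs x U by exact: open_nbhs_nbhs.
exists (e / 2); first by rewrite divr_gt0.
move=> y [/= ]; rewrite !in_itv/= => /andP[y1 y2] /andP[y3 y4].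
apply: eU; split; rewrite /ball /= ltr_distlC; apply/andP; split; lra.
Qed.

(** The open boxes cover [U] while their closures stay inside it, so that the
    same family proves [U] measurable and exhausts it by compact sets. *)
Lemma open_bigcup_boxes U : open U -> exists B : nat -> (R * R) * R,
  (forall n, cbox (B n).1 (B n).2 `<=` U) /\
  U = \bigcup_n obox (B n).1 (B n).2.
Proof.
move=> oU.
pose q (z : (rat * rat) * rat) : (R * R) * R :=
  ((ratr z.1.1, ratr z.1.2), ratr z.2).
(* indices that do not code a box inside [U] get a box of negative radius,
   which is empty *)
pose B n : (R * R) * R := if @unpickle ((rat * rat) * rat)%type n is Some z then
  if `[< cbox (q z).1 (q z).2 `<=` U >] then q z else ((0, 0), -1)
  else ((0, 0), -1).
have empty0 : cbox (0, 0) (-1) `<=` U.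
  by move=> y [/=]; rewrite in_itv/= => /andP[? ?]; lra.
have BU n : cbox (B n).1 (B n).2 `<=` U.
  rewrite /B; case: unpickle => [z|//].
  by case: ifPn => // /asboolP.
exists B; split=> //; apply/seteqP; split=> [x Ux|x [n _ /obox_sub_cbox /BU//]].
have [r r0 rU] := open_cbox oU Ux.
(* centre within [r / 4] of [x], radius between [r / 4] and [r / 2] *)
have [s /andP[s0 sr]] : exists s : rat, (r / 4 < ratr s :> R) && (ratr s < r / 2).
  have [|s] := @rat_in_itvoo R (r / 4) (r / 2); first lra.
  by rewrite in_itv/=; exists s.
have ab (t : R) : exists a : rat, (t - r / 4 < ratr a) && (ratr a < t + r / 4).
  have [|a] := @rat_in_itvoo R (t - r / 4) (t + r / 4); first lra.
  by rewrite in_itv/=; exists a.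
have [a /andP[a1 a2]] := ab x.1.
have [b /andP[b1 b2]] := ab x.2.
have zU : cbox (ratr a, ratr b) (ratr s) `<=` U.
  move=> y [/=]; rewrite !in_itv/= => /andP[y1 y2] /andP[y3 y4].
  by apply: rU; split; rewrite /= in_itv/=; apply/andP; split; lra.
exists (pickle ((a, b), s)) => //.
rewrite /B pickleK; case: ifPn => [_|/asboolP//].
by split; rewrite /= in_itv/=; apply/andP; split; lra.
Qed.

Lemma open_measurable2 U : open U -> measurable (U : set plane).
Proof.
move=> /open_bigcup_boxes[B [_ ->]]; apply: bigcupT_measurable => n.
exact: measurable_obox.
Qed.

Lemma compact_measurable2 U : compact U -> measurable (U : set plane).
Proof.
move=> cU; rewrite -[U]setCK; apply: measurableC.
apply: open_measurable2; apply: closed_openC.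
by apply: compact_closed => //; exact: norm_hausdorff.
Qed.

Lemma continuous_measurable2 (f : R * R -> R) :
  continuous f -> measurable_fun setT (f : plane -> R).
Proof.
move=> cf; apply: (measurability _ (measurable_realfun.RGenOpens.measurableE R)).
move=> _ [_ [a [b ->] <-]]; rewrite setTI.
apply: open_measurable2; apply: open_comp; last exact: interval_open.
by move=> x _; exact: cf.
Qed.

(** Open sets form a pi-system, so this reduces statements about all measurable
    sets of the product to open ones. *)
Lemma plane_measurable_open :
  @measurable _ plane = <<s [set U | open (U : set (R * R))] >>.
Proof.
apply/seteqP; split; last first.
  apply: smallest_sub; first exact: sigma_algebra_measurable.
  by move=> U /= oU; exact: open_measurable2.
rewrite measurable_prod_measurableType.
set S := <<s [set U | open (U : set (R * R))] >>.
have SS : sigma_algebra setT S by exact: smallest_sigma_algebra.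
have S1 (f : R * R -> measurableTypeR R) : continuous (f : R * R -> R) ->
    forall A, measurable A -> S (f @^-1` A).
  move=> cf A mA.
  pose s : measurableType _ := g_sigma_algebraType [set U | open (U : set (R * R))].
  have : measurable_fun setT (f : s -> measurableTypeR R).
    apply: (measurability _ (measurable_realfun.RGenOpens.measurableE R)).
    move=> _ [_ [a [b ->] <-]]; rewrite setTI.
    apply: sub_sigma_algebra => /=; apply: open_comp; last exact: interval_open.
    by move=> x _; exact: cf.
  by move=> /(_ measurableT _ mA); rewrite setTI.
apply: smallest_sub => //; move=> _ [A mA [B mB <-]].
have -> : A `*` B = (fst @^-1` A) `&` (snd @^-1` B) by [].
pose s : measurableType _ := g_sigma_algebraType [set U | open (U : set (R * R))].
apply: (@measurableI _ s); apply: S1 => //.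
  by move=> x; exact: cvg_fst.
by move=> x; exact: cvg_snd.
Qed.

End PlaneMeasure.

(** * Translation invariance *)

Section Translation.
Context {R : realType}.
Implicit Types (v : R * R).

Local Notation plane := (measurableTypeR R * measurableTypeR R)%type.
Local Notation mu := (@leb2 R).

Let shift1 (t : R) (x : R) := x + t.

Lemma measurable_shift1 t :
  measurable_fun setT (shift1 t : measurableTypeR R -> measurableTypeR R).
Proof. exact: measurable_funD. Qed.

Lemma lebesgue_measure_shift (t : R) (A : set (measurableTypeR R)) :
  measurable A ->
  @lebesgue_measure R (shift1 t @^-1` A) = lebesgue_measure A.
Proof.
move=> mA.
pose f : {mfun measurableTypeR R >-> measurableTypeR R} :=
  HB.pack (shift1 t : measurableTypeR R -> measurableTypeR R)
   (isMeasurableFun.Build _ _ _ _ _ (measurable_shift1 t)).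
rewrite [RHS](@lebesgue_measure_unique R (pushforward lebesgue_measure f))//.
move=> _ [[a b] _ <-] /=; rewrite /pushforward/=.
have -> : shift1 t @^-1` `]a, b] = `]a - t, b - t]%classic.
  by apply/seteqP; split=> x /=; rewrite /shift1 !in_itv/= ltrBlDr lerBrDr.
rewrite !lebesgue_measure_itv/= !lte_fin ltrD2r.
by case: ifP => // _; rewrite -!EFinD; congr (_%:E); lra.
Qed.

(** Translation as a map of measurable spaces, the form in which the change of
    variables for push-forward measures applies to it. *)
Definition shift2 v : plane -> plane := fun x : R * R => x + v.

Lemma measurable_shift2 v : measurable_fun setT (shift2 v).
Proof.
apply/measurable_fun_pairP; split.
  by apply: (measurableT_comp (measurable_shift1 v.1)); exact: measurable_fst.
by apply: (measurableT_comp (measurable_shift1 v.2)); exact: measurable_snd.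
Qed.

HB.instance Definition _ v := isMeasurableFun.Build _ _ _ _ (shift2 v)
  (measurable_shift2 v).

Lemma leb2_shift v (A : set plane) :
  measurable A -> pushforward mu (shift2 v) A = mu A.
Proof.
move=> mA; apply/esym; apply: product_measure_unique => // {mA}A B mA mB.
rewrite /= /pushforward.
have -> : shift2 v @^-1` (A `*` B) = (shift1 v.1 @^-1` A) `*` (shift1 v.2 @^-1` B).
  by [].
rewrite product_measure1E//; last 2 first.
- by rewrite -[X in measurable X]setTI; exact: measurable_shift1.
- by rewrite -[X in measurable X]setTI; exact: measurable_shift1.
by rewrite -(lebesgue_measure_shift v.1 mA) -(lebesgue_measure_shift v.2 mB).
Qed.

Lemma ge0_integral_shift v (f : R * R -> \bar R) :
  measurable_fun setT (f : plane -> \bar R) -> (forall x, 0 <= f x)%E ->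
  (\int[mu]_x f ((x : R * R) + v)%R = \int[mu]_x f x)%E.
Proof.
move=> mf f0.
transitivity (\int[pushforward mu (shift2 v)]_x f x)%E.
  by rewrite ge0_integral_pushforward// preimage_setT.
by apply: eq_measure_integral => A mA _; exact: leb2_shift.
Qed.

Lemma integrable_shift v (f : R * R -> \bar R) :
  mu.-integrable setT f -> mu.-integrable setT (fun x => f (x + v)).
Proof.
move=> /integrableP[mf fi]; apply/integrableP; split.
  exact: (measurableT_comp mf (measurable_shift2 v)).
rewrite (@ge0_integral_shift v (fun x => `|f x|)%E)//.
exact: measurableT_comp.
Qed.

Lemma integral_shift v (f : R * R -> \bar R) :
  mu.-integrable setT f -> (\int[mu]_x f ((x : R * R) + v)%R = \int[mu]_x f x)%E.
Proof.
move=> fi; have mf := measurable_int _ fi.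
rewrite [LHS]integralE [RHS]integralE; congr (_ - _)%E.
  rewrite -[RHS](ge0_integral_shift v)//; last exact: measurable_funepos.
  by apply: eq_integral => x _; rewrite !funeposE.
rewrite -[RHS](ge0_integral_shift v)//; last exact: measurable_funeneg.
by apply: eq_integral => x _; rewrite !funenegE.
Qed.

Lemma Rintegral_shift v (f : R * R -> R) :
  mu.-integrable setT (EFin \o f) -> \int[mu]_x f ((x : R * R) + v) = \int[mu]_x f x.
Proof. by move=> fi; rewrite /Rintegral (integral_shift v fi). Qed.

End Translation.

(** * Square integrable functions *)

Section SquareIntegrable.
Context d (T : measurableType d) (R : realType).
Context (mu : {measure set T -> \bar R}).
Implicit Types (f g h : T -> R) (c : R).

(** Functions, not classes modulo equality almost everywhere: [ip] and [nrm] are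
    then only a positive semidefinite form and its seminorm. *)
Definition sqint f :=
  measurable_fun setT f /\ mu.-integrable setT (fun x => (f x ^+ 2)%:E).

Definition ip f g : R := \int[mu]_x (f x * g x).

Definition nrm f : R := Num.sqrt (ip f f).

Lemma sqint_integrable_mul f g : sqint f -> sqint g ->
  mu.-integrable setT (EFin \o (fun x => f x * g x)).
Proof.
move=> [mf sf] [mg sg].
apply: (@le_integrable _ _ _ mu setT measurableT _
   (fun x => (f x ^+ 2)%:E + (g x ^+ 2)%:E)%E).
- by apply/measurable_EFinP; exact: measurable_funM.
- move=> x _ /=; rewrite lee_fin normrM [leRHS]ger0_norm ?addr_ge0 ?sqr_ge0//.
  have := sqr_ge0 (`|f x| - `|g x|).
  rewrite -(real_normK (num_real (f x))) -(real_normK (num_real (g x))).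
  have := mulr_ge0 (normr_ge0 (f x)) (normr_ge0 (g x)).
  nra.
- exact: integrableD.
Qed.

Lemma sqint_le f g : measurable_fun setT f ->
  (forall x, `|f x| <= `|g x|) -> sqint g -> sqint f.
Proof.
move=> mf fg [mg ig]; split=> //; apply: le_integrable ig => //.
  by apply/measurable_EFinP; exact: measurable_funX.
move=> x _ /=; rewrite lee_fin !normrX.
by rewrite lerXn2r// nnegrE.
Qed.

Lemma sqintZ c f : sqint f -> sqint (fun x => c * f x).
Proof.
move=> [mf sf]; split; first exact: measurable_funM.
under [X in _.-integrable _ X]eq_fun do rewrite exprMn EFinM.
exact: integrableZl.
Qed.

Lemma sqintD f g : sqint f -> sqint g -> sqint (fun x => f x + g x).
Proof.
move=> sf sg; have fg := sqint_integrable_mul sf sg.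
move: sf sg => [mf sf] [mg sg]; split; first exact: measurable_funD.
rewrite (_ : (fun x => _) = (fun x => (f x ^+ 2)%:E + (2%:E * (f x * g x)%:E +
  (g x ^+ 2)%:E))%E); last first.
  by apply/funext => x; rewrite -EFinM -!EFinD; congr (_%:E); ring.
apply: integrableD => //; apply: integrableD => //.
exact: integrableZl.
Qed.

Lemma sqint0 : sqint (fun=> 0).
Proof.
split; first exact: measurable_cst.
by under [X in _.-integrable _ X]eq_fun do rewrite expr0n; exact: integrable0.
Qed.

Lemma sqintN f : sqint f -> sqint (fun x => - f x).
Proof. by move=> /(sqintZ (-1)); under eq_fun do rewrite mulN1r. Qed.

Lemma sqintB f g : sqint f -> sqint g -> sqint (fun x => f x - g x).
Proof. by move=> sf /sqintN; exact: sqintD. Qed.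

Lemma sqint_bounded_mul c f g : measurable_fun setT f ->
  (forall x, `|f x| <= c) -> sqint g -> sqint (fun x => f x * g x).
Proof.
move=> mf fc sg; apply: (sqint_le _ _ (sqintZ c sg)).
  by apply: measurable_funM => //; case: sg.
move=> x; rewrite !normrM ler_wpM2r//.
by rewrite (le_trans (fc x))// ler_norm.
Qed.

Lemma ipC f g : ip f g = ip g f.
Proof. by apply: eq_Rintegral => x _; rewrite mulrC. Qed.

Lemma ipDl f g h : sqint f -> sqint g -> sqint h ->
  ip (fun x => f x + g x) h = ip f h + ip g h.
Proof.
move=> sf sg sh; rewrite -RintegralD//; try exact: sqint_integrable_mul.
by apply: eq_Rintegral => x _; rewrite mulrDl.
Qed.

Lemma ipZl c f h : sqint f -> sqint h -> ip (fun x => c * f x) h = c * ip f h.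
Proof.
move=> sf sh; rewrite -RintegralZl//; last exact: sqint_integrable_mul.
by apply: eq_Rintegral => x _; rewrite mulrA.
Qed.

Lemma ipNl f h : sqint f -> sqint h -> ip (fun x => - f x) h = - ip f h.
Proof.
move=> sf sh; rewrite -mulN1r -ipZl//.
by apply: eq_Rintegral => x _; rewrite mulN1r.
Qed.

Lemma ipBl f g h : sqint f -> sqint g -> sqint h ->
  ip (fun x => f x - g x) h = ip f h - ip g h.
Proof. by move=> sf sg sh; rewrite ipDl ?ipNl//; exact: sqintN. Qed.

Lemma ip_ge0 f : 0 <= ip f f.
Proof. by apply: Rintegral_ge0 => x _; rewrite -expr2 sqr_ge0. Qed.

Lemma nrm_ge0 f : 0 <= nrm f. Proof. exact: sqrtr_ge0. Qed.

Lemma nrm_sqr f : nrm f ^+ 2 = ip f f.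
Proof. by rewrite sqr_sqrtr// ip_ge0. Qed.

(** The discriminant of [t |-> ip (f + t g) (f + t g)]. When [ip g g] vanishes
    this polynomial is affine and nonnegative, hence constant. *)
Lemma cauchy_schwarz f g : sqint f -> sqint g -> `|ip f g| <= nrm f * nrm g.
Proof.
move=> sf sg; rewrite -ler_sqr ?nnegrE ?mulr_ge0 ?nrm_ge0//.
rewrite exprMn !nrm_sqr real_normK ?num_real//.
have H (t : R) : 0 <= ip f f + 2 * t * ip f g + t ^+ 2 * ip g g.
  have := ip_ge0 (fun x => f x + t * g x).
  have stg := sqintZ t sg.
  rewrite ipDl//; last exact: sqintD.
  rewrite ipC ipDl// (ipC _ (fun x => f x + _)) ipDl// (ipC f (fun x => t * g x)).
  by rewrite ipZl// (ipZl t sg stg) (ipC g (fun x => t * g x)) ipZl// (ipC g f); lra.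
have [g0|g0] := eqVneq (ip g g) 0.
  have Hf := ip_ge0 f.
  have [->|fg0] := eqVneq (ip f g) 0; first by rewrite expr0n /= mulr_ge0// ip_ge0.
  have := H (- (ip f f + 1) / (2 * ip f g)).
  rewrite g0 mulr0 addr0.
  have -> : 2 * (- (ip f f + 1) / (2 * ip f g)) * ip f g = - (ip f f + 1) by field.
  lra.
have gp : 0 < ip g g by rewrite lt0r g0 ip_ge0.
have := H (- ip f g / ip g g).
have -> : ip f f + 2 * (- ip f g / ip g g) * ip f g + (- ip f g / ip g g) ^+ 2 * ip g g
  = (ip f f * ip g g - ip f g ^+ 2) / ip g g by field.
by rewrite pmulr_lge0 ?invr_gt0// subr_ge0.
Qed.

Lemma nrmD f g : sqint f -> sqint g -> nrm (fun x => f x + g x) <= nrm f + nrm g.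
Proof.
move=> sf sg; rewrite -ler_sqr ?nnegrE ?addr_ge0 ?nrm_ge0//.
rewrite sqrrD !nrm_sqr ipDl//; last exact: sqintD.
rewrite ipC ipDl// (ipC g (fun x => f x + g x)) ipDl//.
have := cauchy_schwarz sf sg; rewrite (ipC g f) -mulr_natr.
have := ler_norm (ip f g); lra.
Qed.

Lemma nrmZ c f : sqint f -> nrm (fun x => c * f x) = `|c| * nrm f.
Proof.
move=> sf; rewrite /nrm ipZl//; last exact: sqintZ.
by rewrite ipC ipZl// mulrA -expr2 sqrtrM ?sqr_ge0// sqrtr_sqr.
Qed.

Lemma nrmN f : sqint f -> nrm (fun x => - f x) = nrm f.
Proof.
move=> sf; rewrite -[RHS]mul1r -(@normrN1 R) -nrmZ//.
by congr nrm; apply/funext => x; rewrite mulN1r.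
Qed.

Lemma nrmB f g : sqint f -> sqint g -> nrm (fun x => f x - g x) <= nrm f + nrm g.
Proof. by move=> sf sg; rewrite -(nrmN sg); apply: nrmD => //; exact: sqintN. Qed.

Lemma nrm0 : nrm (fun=> 0) = 0.
Proof.
rewrite /nrm /ip; under eq_Rintegral do rewrite mul0r.
by rewrite /Rintegral integral0 sqrtr0.
Qed.

Lemma ler_nrm f g : sqint f -> sqint g ->
  (forall x, `|f x| <= `|g x|) -> nrm f <= nrm g.
Proof.
move=> sf sg fg; apply: ler_wsqrtr; apply: le_Rintegral => //;
  try exact: sqint_integrable_mul.
move=> x _; rewrite -!expr2 -(real_normK (num_real (f x))).
by rewrite -(real_normK (num_real (g x))) lerXn2r// nnegrE.
Qed.

Lemma nrm_sum (I : Type) (s : seq I) (F : I -> T -> R) :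
  (forall i, sqint (F i)) ->
  sqint (fun x => \sum_(i <- s) F i x) /\
  nrm (fun x => \sum_(i <- s) F i x) <= \sum_(i <- s) nrm (F i).
Proof.
move=> sF; elim: s => [|i s [IHs IHn]].
  under eq_fun do rewrite big_nil.
  by rewrite big_nil nrm0; split=> //; exact: sqint0.
under eq_fun do rewrite big_cons.
rewrite big_cons; split; first exact: sqintD.
by apply: (le_trans (nrmD (sF i) IHs)); rewrite lerD2l.
Qed.

End SquareIntegrable.

(** * Completeness and the Riesz representation theorem *)

Section Completeness.
Context d (T : measurableType d) (R : realType).
Context (mu : {measure set T -> \bar R}).
Implicit Types (f g h : T -> R) (c : R).
Local Notation sqint := (sqint mu).
Local Notation nrm := (nrm mu).
Local Notation ip := (ip mu).

Lemma sum_geo_half N : \sum_(n < N) (2^-1 : R) ^+ n = 2 - 2 * 2^-1 ^+ N.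
Proof.
elim: N => [|N IH]; first by rewrite big_ord0 expr0; lra.
by rewrite big_ord_recr/= IH exprS; lra.
Qed.

Lemma fine_ip f g : sqint f -> sqint g ->
  (\int[mu]_x (f x * g x)%:E)%E = (ip f g)%:E.
Proof.
move=> sf sg; rewrite /ip /Rintegral fineK//; apply: integrable_fin_num => //.
exact: sqint_integrable_mul.
Qed.

Lemma cvg_nrm0 (f : nat -> T -> R) :
  (\int[mu]_x ((f n x) ^+ 2)%:E)%E @[n --> \oo] --> 0%E ->
  nrm (f n) @[n --> \oo] --> (0 : R).
Proof.
move=> /fine_cvg /= h.
rewrite -[X in _ --> X](@sqrtr0 R).
apply: (cvg_comp _ (@Num.sqrt R)); last exact: sqrt_continuous.
by rewrite /ip /Rintegral; under eq_fun do under eq_integral do rewrite -expr2.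
Qed.

(** Riesz-Fischer for sequences with geometrically small increments. The sum of
    the absolute increments is square integrable by monotone convergence; where
    it is finite the sequence converges, and it dominates the distance to the
    limit. *)
Lemma sqint_complete (f : nat -> T -> R) :
  (forall n, sqint (f n)) ->
  (forall n, nrm (fun x => f n.+1 x - f n x) <= 2^-1 ^+ n) ->
  exists2 g, sqint g & nrm (fun x => f n x - g x) @[n --> \oo] --> (0 : R).
Proof.
move=> sf df.
pose D n x := `|f n.+1 x - f n x|.
have sD n : sqint (D n).
  have sB := sqintB (sf n.+1) (sf n).
  apply: (sqint_le _ _ sB); last by move=> x; rewrite normr_id.
  by case: sB => mB _; exact: measurableT_comp.
pose G N x := \sum_(n < N) D n x.
have G0 N x : 0 <= G N x by apply: sumr_ge0 => n _; exact: normr_ge0.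
have sG N : sqint (G N) /\ nrm (G N) <= 2.
  have [? nG] := nrm_sum (index_enum 'I_N) (fun n : 'I_N => sD n).
  split=> //; apply: (le_trans nG).
  have Dn (n : 'I_N) : nrm (D n) <= 2^-1 ^+ n.
    apply: le_trans (df n); apply: ler_nrm => //; first exact: sqintB.
    by move=> x; rewrite normr_id.
  apply: (le_trans (ler_sum _ (fun n _ => Dn n))).
  have -> : \sum_(n < N) (2^-1 : R) ^+ n = 2 - 2 * 2^-1 ^+ N.
    exact: sum_geo_half.
  by rewrite lerBlDr lerDl mulr_ge0// exprn_ge0// invr_ge0.
have ndG x : nondecreasing_seq (G ^~ x).
  apply/nondecreasing_seqP => n; rewrite /G big_ord_recr/= lerDl.
  exact: normr_ge0.
pose E N x : \bar R := (G N x ^+ 2)%:E.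
have mE N : measurable_fun setT (E N).
  by apply/measurable_EFinP; apply: measurable_funX; case: (sG N).1.
have E0 N x : (0 <= E N x)%E by rewrite lee_fin sqr_ge0.
have ndE x : {homo E ^~ x : n m / (n <= m)%N >-> (n <= m)%E}.
  by move=> n m nm; rewrite lee_fin lerXn2r ?nnegrE ?G0//; exact: ndG.
pose H x := limn (E ^~ x).
have cE x : E ^~ x @ \oo --> H x by apply: ereal_nondecreasing_is_cvgn; exact: ndE.
have mH : measurable_fun setT H.
  by apply: (emeasurable_fun_cvg E H) => // x _; exact: cE.
have H0 x : (0 <= H x)%E.
  by apply: lime_ge; [exact: cE|exact: nearW].
have HE n x : (E n x <= H x)%E.
  apply: lime_ge; first exact: cE.
  by near=> m; apply: ndE; near: m; exact: nbhs_infty_ge.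
have iH : mu.-integrable setT H.
  apply/integrableP; split=> //.
  under eq_integral do rewrite gee0_abs//.
  rewrite /H monotone_convergence//.
  apply: (@le_lt_trans _ _ 4%:E); last exact: ltry.
  apply: lime_le.
    apply: ereal_nondecreasing_is_cvgn => n m nm.
    by apply: ge0_le_integral => // x _; exact: ndE.
  apply: nearW => n; have [sGn nGn] := sG n.
  rewrite /E; under eq_integral do rewrite expr2.
  rewrite fine_ip// lee_fin -nrm_sqr.
  have := nrm_ge0 mu (G n); nra.
(* [fine] sends the infinite values of [H] to [0], so that [Gr] is real valued;
   it bounds the partial sums where [H] is finite *)
pose Gr x := Num.sqrt (fine (H x)).
have GGr n x : H x \is a fin_num -> G n x <= Gr x.
  move=> Hx; rewrite -(ger0_norm (G0 n x)) -sqrtr_sqr; apply: ler_wsqrtr.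
  by rewrite -lee_fin fineK// HE.
have sGr : sqint Gr.
  split.
    apply: (@measurableT_comp _ _ _ _ _ _ (@Num.sqrt R)).
      by apply: continuous_measurable_fun; exact: sqrt_continuous.
    by apply: measurableT_comp mH.
  apply: (@le_integrable _ _ _ mu setT measurableT _ H) => //.
    apply/measurable_EFinP; apply: measurable_funX.
    apply: (@measurableT_comp _ _ _ _ _ _ (@Num.sqrt R)).
      by apply: continuous_measurable_fun; exact: sqrt_continuous.
    by apply: measurableT_comp mH.
  move=> x _ /=; rewrite sqr_sqrtr ?fine_ge0// gee0_abs//.
  move: (H0 x); case: (H x) => //= [r|_]; last by rewrite normr0 leey.
  by rewrite lee_fin => r0; rewrite ger0_norm.
pose A := [set x | H x \is a fin_num].
have mA : measurable A.
  by rewrite -[A]setTI; exact: emeasurable_fin_num.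
pose f' n x := f n x * \1_A x.
have dist n m x : A x -> (n <= m)%N -> `|f m x - f n x| <= Gr x.
  move=> Ax nm; apply: le_trans (GGr m x Ax).
  rewrite -(subnKC nm); elim: (m - n)%N => [|k IH].
    by rewrite addn0 subrr normr0.
  rewrite addnS /G big_ord_recr/=.
  rewrite (_ : f _ x - f n x = (f (n + k) x - f n x) + (f (n + k).+1 x - f (n + k)%N x)); last lra.
  exact: (le_trans (ler_normD _ _)) (lerD IH _).
have cf' x : cvgn (f' ^~ x).
  have [Ax|nAx] := pselect (A x); last first.
    rewrite (_ : f' ^~ x = cst 0); first exact: is_cvg_cst.
    by apply/funext => n; rewrite /f' indicE memNset// mulr0.
  rewrite (_ : f' ^~ x = f ^~ x); last first.
    by apply/funext => n; rewrite /f' indicE mem_set// mulr1.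
  have : cvgn (series (fun n => f n.+1 x - f n x)).
    apply: normed_cvg; apply: nondecreasing_is_cvgn.
      by apply/nondecreasing_seqP => n; rewrite /= /series/= big_nat_recr//= lerDl.
    exists (Gr x) => _ [n _ <-]; apply: le_trans (GGr n x Ax).
    by rewrite /= /series/= /G big_mkord.
  have -> : series (fun n => f n.+1 x - f n x) = (fun n => f n x - f 0%N x).
    by apply/funext => n; rewrite /series/= telescope_sumr.
  move=> /(is_cvgD (is_cvg_cst (f 0%N x))).
  by under [X in cvg (X @ _) -> _]eq_fun do rewrite /= addrC subrK.
pose g x := limn (f' ^~ x).
have mf' n : measurable_fun setT (f' n).
  by apply: measurable_funM; [case: (sf n)|exact: measurable_indic].
have mg : measurable_fun setT g.
  by apply: (measurable_fun_cvg mf') => x _; exact: cf'.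
have fgGr n x : A x -> `|f n x - g x| <= Gr x.
  move=> Ax.
  have h : `|f' m x - f n x| @[m --> \oo] --> `|g x - f n x|.
    by apply: cvg_norm; apply: cvgB; [exact: cf'|exact: cvg_cst].
  rewrite distrC -(cvg_lim _ h)//; apply: limr_le; first by apply/cvg_ex; eexists; exact: h.
  near=> m; rewrite /f' indicE mem_set// mulr1; apply: dist => //.
  by near: m; exact: nbhs_infty_ge.
have aeA : {ae mu, forall x, A x}.
  by have := integrable_ae measurableT iH; apply: filterS => x; exact.
have sg : sqint g.
  apply: (@sqint_le _ _ _ mu _ (fun x => `|f 0%N x| + Gr x)) => //; last first.
    apply: sqintD => //; apply: sqint_le (sf 0%N); last by move=> x; rewrite normr_id.
    by apply: measurableT_comp => //; case: (sf 0%N).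
  move=> x; rewrite [leRHS]ger0_norm ?addr_ge0 ?sqrtr_ge0//.
  have [Ax|nAx] := pselect (A x); last first.
    rewrite /g (_ : f' ^~ x = cst 0); last first.
      by apply/funext => n; rewrite /f' indicE memNset// mulr0.
    by rewrite lim_cst// normr0 addr_ge0// sqrtr_ge0.
  have := fgGr 0%N x Ax; have := ler_normB (f 0%N x) (f 0%N x - g x).
  by rewrite subKr; lra.
exists g => //.
have mfg n : measurable_fun setT (fun x => (f n x - g x) ^+ 2).
  by apply: measurable_funX; apply: measurable_funB => //; case: (sf n).
have [|||||_ _ +] := @dominated_convergence _ _ _ mu setT measurableT
  (fun n x => ((f n x - g x) ^+ 2)%:E) (cst 0%E) (fun x => (Gr x ^+ 2)%:E).
- by move=> n; apply/measurable_EFinP.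
- exact: measurable_cst.
- apply: filterS aeA => x Ax _.
  suff : (f n x - g x) ^+ 2 @[n --> \oo] --> (0 : R) by apply: cvg_EFin; exact: nearW.
  have h1 : f n x - g x @[n --> \oo] --> (0 : R).
    rewrite -(subrr (g x)); apply: cvgB; last exact: cvg_cst.
    rewrite (_ : f ^~ x = f' ^~ x); first exact: cf'.
    by apply/funext => n; rewrite /f' indicE mem_set// mulr1.
  by under eq_fun do rewrite expr2; rewrite -(mulr0 0); exact: cvgM.
- by case: sGr.
- apply: filterS aeA => x Ax n _; rewrite lee_fin normrX lerXn2r ?nnegrE ?sqrtr_ge0//.
  exact: fgGr.
by rewrite integral0; exact: cvg_nrm0.
Unshelve. all: by end_near. Qed.


(** A sequence of [P] minimising [ip f f / 2 - l f] is Cauchy by the parallelogram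
    law, and stationarity of the infimum identifies its limit, which may lie
    outside [P]. It is applied to the space of test functions, which is far from
    closed. *)
Lemma riesz_subspace (P : (T -> R) -> Prop) (l : (T -> R) -> R) (C : R) :
  (forall f, P f -> sqint f) ->
  P (fun=> 0) ->
  (forall f g c, P f -> P g -> P (fun x => f x + c * g x)) ->
  (forall f g c, P f -> P g -> l (fun x => f x + c * g x) = l f + c * l g) ->
  (forall f, P f -> `|l f| <= C * nrm f) ->
  exists2 g, sqint g & forall f, P f -> l f = ip g f.
Proof.
move=> sP P0 PD lD lC.
pose J f := ip f f / 2 - l f.
have Jexp f g c : P f -> P g -> J (fun x => f x + c * g x) =
    J f + c * (ip f g - l g) + c ^+ 2 * ip g g / 2.
  move=> Pf Pg; have [sf sg] := (sP _ Pf, sP _ Pg); have sc := sqintZ c sg.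
  rewrite /J lD// ipDl//; last exact: sqintD.
  rewrite (ipC mu) ipDl// (ipC mu (fun x => c * g x) (fun x => f x + _)) ipDl//.
  rewrite (ipC mu f (fun x => c * g x)) !ipZl//.
  by rewrite (ipC mu g (fun x => c * g x)) ipZl// (ipC mu g f); field.
have Jlb f : P f -> - (C ^+ 2 / 2) <= J f.
  move=> Pf; have := lC f Pf; rewrite /J -nrm_sqr ler_norml => /andP[_].
  by have := sqr_ge0 (nrm f - C); nra.
pose S := [set J f | f in P].
have S0 : S !=set0 by exists (J (fun=> 0)), (fun=> 0).
have hS : has_inf S by split=> //; exists (- (C ^+ 2 / 2)) => _ [f Pf <-]; exact: Jlb.
(* the precision [4^-n / 8] makes consecutive terms [2^-n]-close *)
have min n : exists f, P f /\ J f < inf S + (2^-1 ^+ n) ^+ 2 / 8.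
  have e0 : 0 < (2^-1 ^+ n) ^+ 2 / 8 :> R by rewrite divr_gt0// !exprn_gt0// invr_gt0.
  by have [_ [f Pf <-] Jf] := inf_adherent e0 hS; exists f.
have [f fP] := choice min.
have Pf n := (fP n).1; have Jf n := (fP n).2.
have sf n := sP _ (Pf n).
have Jm g : P g -> inf S <= J g.
  by move=> Pg; apply: ge_inf; [case: hS|exists g].
have p0 n : 0 < 2^-1 ^+ n :> R by rewrite exprn_gt0// invr_gt0.
have var n g : P g -> `|ip (f n) g - l g| <= 2^-1 ^+ n * (1 + ip g g).
  move=> Pg; set t := 2^-1 ^+ n; have t0 : 0 < t by exact: p0.
  have h1 := Jm _ (PD _ _ t (Pf n) Pg); have h2 := Jm _ (PD _ _ (- t) (Pf n) Pg).
  move: h1 h2 (Jf n); rewrite !Jexp// -/t; have := ip_ge0 mu g.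
  move: (ip g g) (ip (f n) g - l g) (J (f n)) (inf S) => a b j m a0 h1 h2 h3.
  by rewrite ler_norml; apply/andP; split; nra.
have df n : nrm (fun x => f n.+1 x - f n x) <= 2^-1 ^+ n.
  rewrite -ler_sqr ?nnegrE ?nrm_ge0 ?(ltW (p0 _))// nrm_sqr.
  have PB : P (fun x => f n.+1 x - f n x).
    have := PD _ _ (-1) (Pf n.+1) (Pf n).
    by under eq_fun do rewrite mulN1r.
  have := Jexp _ _ 2^-1 (Pf n) PB; have := Jexp _ _ 1 (Pf n) PB.
  have -> : (fun x => f n x + 1 * (f n.+1 x - f n x)) = f n.+1.
    by apply/funext => x; lra.
  have := Jm _ (PD _ _ 2^-1 (Pf n) PB).
  have := Jf n; have := Jf n.+1; rewrite (exprS 2^-1) exprMn.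
  have : 0 <= (2^-1 ^+ n) ^+ 2 :> R by exact: sqr_ge0.
  move: ((2^-1 ^+ n) ^+ 2) (J _) (J _) (J _) (inf S) => e j1 j2 j3 m.
move: (ip _ _ - l _) => b; move: (ip _ _) => q; lra.
have [g sg cg] := sqint_complete sf df.
exists g => // h Ph; have sh := sP _ Ph.
have c1 : ip (f n) h - l h @[n --> \oo] --> (0 : R).
  apply/norm_cvg0P; apply: (@squeeze_cvgr _ _ _ _ (cst 0) (fun n => 2^-1 ^+ n * (1 + ip h h))).
  - by apply: nearW => n; rewrite normr_ge0/= var.
  - exact: cvg_cst.
  - rewrite -(mul0r (1 + ip h h)); apply: cvgMr_tmp; apply: cvg_expr.
    by rewrite ger0_norm// invf_lt1// ltr1n.
have c2 : ip (f n) h - ip g h @[n --> \oo] --> (0 : R).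
  apply/norm_cvg0P; apply: (@squeeze_cvgr _ _ _ _ (cst 0) (fun n => nrm (fun x => f n x - g x) * nrm h)).
  - apply: nearW => n; rewrite normr_ge0/= -ipBl//; apply: cauchy_schwarz => //.
    exact: sqintB.
  - exact: cvg_cst.
  - by rewrite -(mul0r (nrm h)); apply: cvgMr_tmp.
have c3 := cvgB c2 c1; rewrite subr0 in c3.
have c4 : (fun=> l h - ip g h) @ \oo --> (0 : R).
  rewrite (_ : (fun=> _) =
    (fun n => (ip (f n) h - ip g h) - (ip (f n) h - l h))); first exact: c3.
  by apply/funext => n; lra.
apply/eqP; rewrite -subr_eq0; apply/eqP.
by have /cvg_lim := c4; rewrite lim_cst//; apply; exact: norm_hausdorff.
Qed.

End Completeness.

(** * Calculus of smooth functions *)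

Section SmoothCalculus.
Context {R : realType}.
Implicit Types (f g : R * R -> R) (i : 'I_2) (x v : R * R).

Lemma partials_rcons s i f : partials (rcons s i) f = partials s ('D_(e_ i) f).
Proof. by rewrite /partials foldr_rcons. Qed.

Lemma smooth2_continuous f : smooth2 f -> continuous f.
Proof. by move=> /(_ [::])[]. Qed.

Lemma smooth2_derivable f i x : smooth2 f -> derivable f x (e_ i).
Proof. by move=> /(_ [::])[_ /(_ i x)]. Qed.

Lemma smooth2_D f i : smooth2 f -> smooth2 ('D_(e_ i) f).
Proof. by move=> sf s; have := sf (rcons s i); rewrite partials_rcons. Qed.

(** Leibniz' rule turns one derivative of a product into a sum of products of
    lower order, which suits an induction on the number of derivatives that
    peels off the innermost one; [partials] peels off the outermost. *)
Fixpoint Cn (n : nat) f : Prop := continuous f /\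
  if n is n'.+1 then (forall i x, derivable f x (e_ i)) /\ (forall i, Cn n' ('D_(e_ i) f))
  else True.

Lemma CnS n f : Cn n.+1 f -> Cn n f.
Proof.
elim: n f => [|n IH] f [cf [df Df]]; first by split.
by split=> //; split=> // i; apply: IH; exact: Df.
Qed.

Lemma smooth2P f : smooth2 f <-> forall n, Cn n f.
Proof.
split=> [sf n|H s].
  elim: n f sf => [|n IH] f sf; first by split=> //; exact: smooth2_continuous.
  split; first exact: smooth2_continuous.
  by split=> [i x|i]; [exact: smooth2_derivable|exact/IH/smooth2_D].
elim/last_ind: s f H => [|s i IH] f H.
  by split; [case: (H 0%N)|case: (H 1%N) => _ []].
rewrite partials_rcons; apply: IH => n.
by have [_ [_]] := H n.+1; apply.
Qed.

Lemma Cn_cst n (c : R) : Cn n (fun=> c).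
Proof.
elim: n c => [|n IH] c; split; try exact: cst_continuous; first by [].
split=> [i x|i]; first exact: derivable_cst.
by rewrite (_ : 'D_(e_ i) _ = fun=> 0)//; apply/funext => x; rewrite derive_cst.
Qed.

Lemma Cn_add n f g : Cn n f -> Cn n g -> Cn n (fun x => f x + g x).
Proof.
elim: n f g => [|n IH] f g [cf Hf] [cg Hg].
  by split=> // x; apply: cvgD; [exact: cf|exact: cg].
case: Hf Hg => df Df [dg Dg]; split; first by move=> x; apply: cvgD; [exact: cf|exact: cg].
split=> [i x|i]; first exact: derivableD.
rewrite (_ : 'D_(e_ i) _ = fun x => 'D_(e_ i) f x + 'D_(e_ i) g x).
  by apply: IH; [exact: Df|exact: Dg].
by apply/funext => x; rewrite deriveD.
Qed.

Lemma Cn_mul n f g : Cn n f -> Cn n g -> Cn n (fun x => f x * g x).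
Proof.
elim: n f g => [|n IH] f g /[dup] Cf [cf Hf] /[dup] Cg [cg Hg].
  by split=> // x; apply: cvgM; [exact: cf|exact: cg].
case: Hf Hg => df Df [dg Dg]; split; first by move=> x; apply: cvgM; [exact: cf|exact: cg].
split=> [i x|i]; first exact: derivableM.
rewrite (_ : 'D_(e_ i) _ =
    fun x => f x * 'D_(e_ i) g x + g x * 'D_(e_ i) f x).
  by apply: Cn_add; apply: IH; try exact: CnS; [exact: Dg|exact: Df].
by apply/funext => x; rewrite deriveM.
Qed.

Lemma shift_quotient f v x w (h : R) :
  h^-1 *: (f (h *: w + x + v) - f (x + v)) =
  h^-1 *: (f (h *: w + (x + v)) - f (x + v)).
Proof. by rewrite addrA. Qed.

Lemma derivable_translate f v x w :
  derivable f (x + v) w -> derivable (fun y => f (y + v)) x w.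
Proof.
rewrite /derivable.
under [X in _ -> cvg (X @ _)]eq_fun do rewrite /= shift_quotient.
exact.
Qed.

Lemma derive_translate f v x w : 'D_w (fun y => f (y + v)) x = 'D_w f (x + v).
Proof.
rewrite /derive.
by under [X in lim (X @ _) = _]eq_fun do rewrite /= shift_quotient.
Qed.

Lemma Cn_translate n f v : Cn n f -> Cn n (fun x => f (x + v)).
Proof.
elim: n f => [|n IH] f [cf Hf].
  split=> // x; apply: (cvg_comp _ f); last exact: cf.
  by apply: cvgD; [exact: cvg_id|exact: cvg_cst].
split.
  move=> x; apply: (cvg_comp _ f); last exact: cf.
  by apply: cvgD; [exact: cvg_id|exact: cvg_cst].
case: Hf => df Df; split=> [i x|i]; first exact: derivable_translate.
rewrite (_ : 'D_(e_ i) _ = fun x => 'D_(e_ i) f (x + v)).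
  by apply: (IH ('D_(e_ i) f)); exact: Df.
by apply/funext => x; rewrite derive_translate.
Qed.

Lemma smooth2_cst (c : R) : smooth2 (fun=> c).
Proof. by apply/smooth2P => n; exact: Cn_cst. Qed.

Lemma smooth2_add f g : smooth2 f -> smooth2 g -> smooth2 (fun x => f x + g x).
Proof. by move=> /smooth2P sf /smooth2P sg; apply/smooth2P => n; exact: Cn_add. Qed.

Lemma smooth2_mul f g : smooth2 f -> smooth2 g -> smooth2 (fun x => f x * g x).
Proof. by move=> /smooth2P sf /smooth2P sg; apply/smooth2P => n; exact: Cn_mul. Qed.

Lemma smooth2_translate f v : smooth2 f -> smooth2 (fun x => f (x + v)).
Proof. by move=> /smooth2P sf; apply/smooth2P => n; exact: Cn_translate. Qed.

Lemma smooth2_scale (c : R) f : smooth2 f -> smooth2 (fun x => c * f x).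
Proof. by move=> sf; apply: smooth2_mul => //; exact: smooth2_cst. Qed.

Lemma smooth2_sub f g : smooth2 f -> smooth2 g -> smooth2 (fun x => f x - g x).
Proof.
move=> sf sg; have := smooth2_add sf (smooth2_scale (-1) sg).
by under eq_fun do rewrite mulN1r.
Qed.

Lemma smooth2_prod (I : Type) (s : seq I) (F : I -> R * R -> R) :
  (forall j, smooth2 (F j)) -> smooth2 (fun x => \prod_(j <- s) F j x).
Proof.
move=> sF; elim: s => [|j s IH].
  by under eq_fun do rewrite big_nil; exact: smooth2_cst.
by under eq_fun do rewrite big_cons; exact: smooth2_mul.
Qed.

Lemma derive_mul2 f g i x : smooth2 f -> smooth2 g ->
  'D_(e_ i) (fun x => f x * g x) x = f x * 'D_(e_ i) g x + g x * 'D_(e_ i) f x.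
Proof. by move=> sf sg; rewrite deriveM//; exact: smooth2_derivable. Qed.

Lemma derive_sub2 f g i x : smooth2 f -> smooth2 g ->
  'D_(e_ i) (fun x => f x - g x) x = 'D_(e_ i) f x - 'D_(e_ i) g x.
Proof. by move=> sf sg; rewrite deriveB//; exact: smooth2_derivable. Qed.

Definition aff (a1 a2 b : R) x : R := a1 * x.1 + a2 * x.2 + b.

Lemma aff_continuous a1 a2 b : continuous (aff a1 a2 b).
Proof.
move=> x; apply: cvgD; last exact: cvg_cst.
by apply: cvgD; apply: cvgM; try exact: cvg_cst; [exact: cvg_fst|exact: cvg_snd].
Qed.

Lemma aff_quotient (f : R -> R) a1 a2 b x v (h : R) :
  h^-1 *: (f (aff a1 a2 b (h *: v + x)) - f (aff a1 a2 b x)) =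
  h^-1 *: (f (h *: aff a1 a2 0 v + aff a1 a2 b x) - f (aff a1 a2 b x)).
Proof.
congr (_ *: (f _ - _)); rewrite /aff /=.
by rewrite /GRing.scale/=; ring.
Qed.

Lemma derive_dirE (f : R -> R) y c : derivable f y 1 -> 'D_c f y = c * derive1 f y.
Proof.
move=> df; rewrite deriveE; last exact/derivable1_diffP.
by rewrite deriv1E.
Qed.

Lemma smooth1_continuous (f : R -> R) : smooth1 f -> continuous f.
Proof.
by move=> sf x; have /derivable1_diffP/differentiable_continuous := sf 0%N x.
Qed.

Lemma smooth1_derive1 (f : R -> R) : smooth1 f -> smooth1 (derive1 f).
Proof. by move=> sf n x; have := sf n.+1 x; rewrite derive1Sn. Qed.

(** Cut-off functions are built from functions of one variable through this. *)
Lemma smooth2_aff (f : R -> R) a1 a2 b : smooth1 f -> smooth2 (f \o aff a1 a2 b).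
Proof.
move=> sf; apply/smooth2P => n; elim: n f sf => [|n IH] f sf.
  split=> // x; apply: (cvg_comp _ f); first exact: aff_continuous.
  exact: smooth1_continuous.
have cf : continuous (f \o aff a1 a2 b).
  move=> x; apply: (cvg_comp _ f); first exact: aff_continuous.
  exact: smooth1_continuous.
split=> //; split=> [i x|i].
  rewrite /derivable /=; under eq_fun do rewrite aff_quotient.
  apply: diff_derivable; apply/derivable1_diffP; exact: (sf 0%N).
rewrite (_ : 'D_(e_ i) _ =
    fun x => aff a1 a2 0 (e_ i) * (derive1 f \o aff a1 a2 b) x).
  apply: Cn_mul; first exact: Cn_cst.
  exact/IH/smooth1_derive1.
apply/funext => x; rewrite /= -derive_dirE; last exact: (sf 0%N).
by rewrite /derive /=; under eq_fun do rewrite aff_quotient.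
Qed.

End SmoothCalculus.

(** * Test functions *)

Section TestFunctions.
Context {R : realType}.
Implicit Types (f g phi psi : R * R -> R) (i : 'I_2) (x v : R * R).
Implicit Types (U Om K : set (R * R)).

Lemma plane_compact_closed K : compact K -> closed K.
Proof. by apply: compact_closed; exact: norm_hausdorff. Qed.

(** Supports of sums, products and translates are easier to bound than to
    compute, hence an arbitrary compact set in place of the closed support. *)
Lemma test_functionP Om phi : test_function Om phi <->
  smooth2 phi /\ exists K, [/\ compact K, K `<=` Om & forall x, ~ K x -> phi x = 0].
Proof.
split=> [[sphi cK KOm]|[sphi [K [cK KOm phi0]]]].
  split=> //; exists (closure [set x | phi x != 0]); split=> // x nx.
  by apply: contrapT => /eqP px; apply: nx; exact: subset_closure.
have sK : closure [set x | phi x != 0] `<=` K.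
  rewrite (closure_id K).1; last exact: plane_compact_closed.
  apply: closure_subset => x /= /eqP px; apply: contrapT => nx; exact/px/phi0.
split=> //; last exact: subset_trans KOm.
by apply: subclosed_compact sK => //; exact: closed_closure.
Qed.

Lemma test_function_smooth Om phi : test_function Om phi -> smooth2 phi.
Proof. by case. Qed.

Lemma test_function_out Om phi x : test_function Om phi -> ~ Om x -> phi x = 0.
Proof.
move=> /test_functionP[_ [K [_ KOm phi0]]] nx; apply: phi0 => /KOm; exact: nx.
Qed.

Lemma test_functionS U Om phi : U `<=` Om -> test_function U phi -> test_function Om phi.
Proof. by move=> UOm [s c sU]; split=> //; exact: subset_trans UOm. Qed.

Lemma derive_locally0 K phi i x : closed K -> (forall y, ~ K y -> phi y = 0) ->
  ~ K x -> 'D_(e_ i) phi x = 0.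
Proof.
move=> cK phi0 nKx.
have oK : nbhs x (~` K) by apply: open_nbhs_nbhs; split=> //; exact: closed_openC.
rewrite (@near_eq_derive _ _ _ phi (fun=> 0)) ?derive_cst//.
by apply: filterS oK => y /phi0.
Qed.

Lemma test_function_D Om phi i : test_function Om phi -> test_function Om ('D_(e_ i) phi).
Proof.
move=> /test_functionP[sphi [K [cK KOm phi0]]]; apply/test_functionP.
split; first exact: smooth2_D.
by exists K; split=> // x; apply: derive_locally0 => //; exact: plane_compact_closed.
Qed.

Lemma test_function_mul Om f phi : smooth2 f -> test_function Om phi ->
  test_function Om (fun x => f x * phi x).
Proof.
move=> sf /test_functionP[sphi [K [cK KOm phi0]]]; apply/test_functionP.
split; first exact: smooth2_mul.
by exists K; split=> // x /phi0 ->; rewrite mulr0.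
Qed.

Lemma test_function0 Om : test_function Om (fun=> 0).
Proof.
apply/test_functionP; split; first exact: smooth2_cst.
by exists set0; split=> //; exact: compact0.
Qed.

Lemma test_function_add Om phi psi : test_function Om phi -> test_function Om psi ->
  test_function Om (fun x => phi x + psi x).
Proof.
move=> /test_functionP[sphi [K [cK KOm phi0]]].
move=> /test_functionP[spsi [L [cL LOm psi0]]]; apply/test_functionP.
split; first exact: smooth2_add.
exists (K `|` L); split=> //; first exact: compactU.
  by rewrite subUset.
by move=> x nKL; rewrite phi0 ?psi0 ?addr0// => H; apply: nKL; [right|left].
Qed.

Lemma test_function_scale Om (c : R) phi : test_function Om phi ->
  test_function Om (fun x => c * phi x).
Proof. by apply: test_function_mul; exact: smooth2_cst. Qed.

Lemma test_function_translate Om U phi v : test_function U phi ->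
  (forall x, U x -> Om (x - v)) -> test_function Om (fun x => phi (x + v)).
Proof.
move=> /test_functionP[sphi [K [cK KOm phi0]]] UOm; apply/test_functionP.
split; first exact: smooth2_translate.
exists ((fun x => x - v) @` K); split.
- apply: continuous_compact => //; apply: continuous_subspaceT => x.
  by apply: cvgB; [exact: cvg_id|exact: cvg_cst].
- by move=> _ [x /KOm/UOm Ox <-].
- move=> x nK; apply: phi0 => Kx; apply: nK; exists (x + v) => //.
  by rewrite addrK.
Qed.

Lemma continuous_bounded_on K f : compact K -> continuous f ->
  exists2 M, 0 <= M & forall x, K x -> `|f x| <= M.
Proof.
move=> cK cf.
have /compact_bounded[M [Mr HM]] : compact (f @` K).
  by apply: continuous_compact => //; exact: continuous_subspaceT.
exists (`|M| + 1); first by rewrite addr_ge0.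
move=> x Kx; apply: (HM (`|M| + 1)); last by exists x.
by rewrite (le_lt_trans (ler_norm M))// ltrDl.
Qed.

Lemma test_function_bounded Om phi : test_function Om phi ->
  exists2 M, 0 <= M & forall x, `|phi x| <= M.
Proof.
move=> /test_functionP[sphi [K [cK KOm phi0]]].
have [M M0 HM] := continuous_bounded_on cK (smooth2_continuous sphi).
exists M => // x; have [/HM//|/phi0 ->] := pselect (K x).
by rewrite normr0.
Qed.

Local Notation plane := (measurableTypeR R * measurableTypeR R)%type.
Local Notation mu := (@leb2 R).

Lemma compact_finite_measure K : compact K -> (mu K < +oo)%E.
Proof.
move=> /[dup] cK /compact_bounded[M [Mr HM]].
set r := `|M| + 1.
have Kbox : K `<=` cbox (0, 0) r.
  move=> x Kx; have : `|x| <= r.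
    by apply: (HM r) => //; rewrite /r (le_lt_trans (ler_norm M))// ltrDl.
  rewrite prod_normE ge_max => /andP[x1 x2].
  by split; rewrite /= in_itv/= sub0r add0r -ler_norml.
apply: (@le_lt_trans _ _ (mu (cbox (0, 0) r))).
  apply: le_measure => //; rewrite inE; first exact: compact_measurable2.
  exact: measurable_cbox.
pose I : set (measurableTypeR R) := `[0 - r, 0 + r]%classic.
have -> : mu (cbox (0, 0) r) = (lebesgue_measure I * lebesgue_measure I)%E.
  by apply: product_measure1E; exact: measurable_itv.
by rewrite /I !lebesgue_measure_itv/= !lte_fin; case: ifP => _; rewrite -?EFinD ?mule0 ?mul0e ?ltry// -EFinM ltry.
Qed.

Lemma sqint_compact_supp (f : R * R -> R) K M : measurable_fun setT (f : plane -> R) ->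
  compact K -> (forall x, ~ K x -> f x = 0) -> (forall x, `|f x| <= M) ->
  sqint mu f.
Proof.
move=> mf cK f0 fM; have mK := compact_measurable2 cK.
have M0 : 0 <= M by apply: le_trans (fM (0, 0)).
have h : sqint mu (fun x => \1_K x).
  split; first exact: measurable_indic.
  rewrite (_ : (fun x => _) = (fun x => (\1_K x)%:E)); last first.
    by apply/funext => x; rewrite indicE; case: (_ \in _); rewrite ?expr1n ?expr0n.
  apply/integrableP; split; first by apply/measurable_EFinP; exact: measurable_indic.
  under eq_integral do rewrite gee0_abs ?lee_fin//.
  by rewrite integral_indic// setIT; exact: compact_finite_measure.
apply: (sqint_le mf _ (sqintZ M h)) => x.
rewrite normrM (ger0_norm M0) indicE; have [Kx|nKx] := pselect (K x).
  by rewrite mem_set// normr1 mulr1.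
by rewrite f0// normr0 mulr_ge0.
Qed.

Lemma sqint_test Om phi : test_function Om phi -> sqint mu phi.
Proof.
move=> /[dup] tphi /test_function_bounded[M _ HM].
move: tphi => /test_functionP[sphi [K [cK _ phi0]]].
apply: (sqint_compact_supp (K := K) (M := M)) => //.
by apply: continuous_measurable2; exact: smooth2_continuous.
Qed.

Lemma line_is_derive f v (x : R * R) (t : R) :
  (forall y, derivable f y v) ->
  is_derive t (1 : R) (fun t : R => f (x + t *: v)) ('D_v f (x + t *: v)).
Proof.
move=> df.
have E (h : R) : h^-1 *: (f (x + (h *: (1 : R) + t) *: v) - f (x + t *: v)) =
    h^-1 *: (f (h *: v + (x + t *: v)) - f (x + t *: v)).
  by rewrite scaler1 scalerDl addrCA.
apply: DeriveDef.
  by rewrite /derivable; under eq_fun do rewrite /= E; exact: df.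
by rewrite /derive; under eq_fun do rewrite /= E.
Qed.

Lemma line_MVT f v x (t : R) : 0 <= t -> (forall y, derivable f y v) ->
  exists2 c, 0 <= c <= t & f (x + t *: v) - f x = t * 'D_v f (x + c *: v).
Proof.
move=> t0 df; have H s := @line_is_derive f v x s df.
have [|c] := @MVT_segment R (fun t : R => f (x + t *: v))
  (fun s => 'D_v f (x + s *: v)) 0 t t0.
- by apply: derivable_within_continuous => s _; exact: (@ex_derive _ _ _ _ _ _ _ (H s)).
by rewrite in_itv/= scale0r addr0 subr0 mulrC => ct ->; exists c.
Qed.

End TestFunctions.

(** * First order remainders in mean square *)

Section Remainder.
Context {R : realType}.
Implicit Types (f g v chi : R * R -> R) (k : 'I_2) (x : R * R) (S : set (R * R)).
Local Notation plane := (measurableTypeR R * measurableTypeR R)%type.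
Local Notation mu := (@leb2 R).
Local Notation sqint := (sqint mu).
Local Notation nrm := (nrm mu).

Lemma measurable_shift f (w : R * R) : measurable_fun setT (f : plane -> R) ->
  measurable_fun setT (fun x : plane => f ((x : R * R) + w)).
Proof. by move=> mf; exact: (measurableT_comp mf (measurable_shift2 w)). Qed.

Lemma sqint_shift f (w : R * R) : sqint f -> sqint (fun x => f ((x : R * R) + w)).
Proof.
move=> [mf sf]; split; first exact: measurable_shift.
exact: (integrable_shift w sf).
Qed.

Lemma ip_shift f g (w : R * R) : sqint f -> sqint g ->
  ip mu (fun x => f ((x : R * R) + w)) (fun x => g ((x : R * R) + w)) = ip mu f g.
Proof.
move=> sf sg; exact: (Rintegral_shift w (sqint_integrable_mul sf sg)).
Qed.

Lemma nrm_shift f (w : R * R) : sqint f -> nrm (fun x => f ((x : R * R) + w)) = nrm f.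
Proof. by move=> sf; rewrite /nrm ip_shift. Qed.

Lemma sqint_weight chi M S g : measurable_fun setT (chi : plane -> R) ->
  (forall x, `|chi x| <= M) -> compact S -> (forall x, ~ S x -> chi x = 0) ->
  continuous g -> sqint (fun x => chi x * g x).
Proof.
move=> mchi chiM cS chi0 cg; have [C C0 HC] := continuous_bounded_on cS cg.
have M0 : 0 <= M by apply: le_trans (chiM (0, 0)).
apply: (sqint_compact_supp (K := S) (M := M * C)) => //.
- by apply: measurable_funM => //; exact: continuous_measurable2.
- by move=> x /chi0 ->; rewrite mul0r.
- move=> x; have [Sx|/chi0 ->] := pselect (S x).
    by rewrite normrM ler_pM// HC.
  by rewrite mul0r normr0 mulr_ge0.
Qed.

Lemma second_order_bound v k S (h : R) : smooth2 v -> compact S -> 0 <= h ->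
  exists2 C, 0 <= C & forall x s t, S x -> 0 <= s -> 0 <= t -> s + t <= h ->
    `|v (x + (s + t) *: e_ k) - v (x + s *: e_ k) - t * 'D_(e_ k) v (x + s *: e_ k)|
      <= C * t ^+ 2.
Proof.
move=> sv cS h0.
pose K := (fun z : (R * R) * R => z.1 + z.2 *: e_ k) @` (S `*` `[0, h]).
have cK : compact K.
  apply: continuous_compact; last by apply: compact_setX => //; exact: segment_compact.
  apply: continuous_subspaceT => z; apply: cvgD; first exact: cvg_fst.
  by apply: cvgZr_tmp; exact: cvg_snd.
have [C C0 HC] := continuous_bounded_on cK
  (smooth2_continuous (smooth2_D k (smooth2_D k sv))).
exists C => // x s t Sx s0 t0 sth.
have [|c /andP[c0 ct]] := line_MVT (x + s *: e_ k) t0 (f := v) (v := e_ k).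
  by move=> y; exact: smooth2_derivable.
rewrite -addrA -scalerDl => ->.
have [|c' /andP[c'0 c'c] E] := line_MVT (x + s *: e_ k) c0 (f := 'D_(e_ k) v) (v := e_ k).
  by move=> y; apply: smooth2_derivable; exact: smooth2_D.
rewrite -mulrBr E !normrM (ger0_norm t0) (ger0_norm c0) mulrA expr2 mulrC.
apply: ler_pM => //; first exact: mulr_ge0.
  apply: HC; exists (x, s + c') => /=; last by rewrite scalerDl addrA.
  by split=> //=; rewrite in_itv/=; apply/andP; split; lra.
by rewrite ler_wpM2l.
Qed.

Lemma ler_archi (a b D : R) : (forall N : nat, a <= b + D / N.+1%:R) -> a <= b.
Proof.
move=> H; apply/ler_addgt0Pr => e e0.
have [D0|D0] := leP D 0.
  by apply: (le_trans (H 0%N)); rewrite lerD2l divr1; lra.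
have := archi_boundP (ltW (divr_gt0 D0 e0)); set N := Num.Def.archi_bound _ => HN.
apply: (le_trans (H N)); rewrite lerD2l ler_pdivrMr// mulrC -ler_pdivrMr//.
by rewrite ltW// (lt_trans HN)// ltr_nat.
Qed.

(** Splitting the segment from [x] to [x + h e_k] into [N] pieces, the remainder is
    the sum of [N] remainders of second order, which is O(1/N), and of the mean
    of the differences of the derivative at the nodes, each bounded by [B]. *)
Lemma remainder_smooth v chi k M S (h B : R) : smooth2 v ->
  measurable_fun setT (chi : plane -> R) ->
  (forall x, `|chi x| <= M) -> compact S -> (forall x, ~ S x -> chi x = 0) ->
  0 <= h ->
  (forall t, 0 <= t <= h ->
    nrm (fun x => chi x * ('D_(e_ k) v ((x : R * R) + t *: e_ k) - 'D_(e_ k) v x)) <= B) ->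
  nrm (fun x => chi x *
    (v ((x : R * R) + h *: e_ k) - v x - h * 'D_(e_ k) v x)) <= h * B.
Proof.
move=> sv mchi chiM cS chi0 h0 HB.
have [C C0 HC] := second_order_bound k sv cS h0.
have cv : continuous v by exact: smooth2_continuous.
have cdv : continuous ('D_(e_ k) v) by apply/smooth2_continuous/smooth2_D.
have csh (f : R * R -> R) (w : R * R) : continuous f -> continuous (fun x => f (x + w)).
  move=> cf x; apply: (cvg_comp _ f); last exact: cf.
  by apply: cvgD; [exact: cvg_id|exact: cvg_cst].
have schi g : continuous g -> sqint (fun x => chi x * g x).
  exact: (sqint_weight mchi chiM cS chi0).
have s1 : sqint chi.
  have -> : chi = (fun x => chi x * 1) by apply/funext => x; rewrite mulr1.
  by apply: schi => x; exact: cvg_cst.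
apply: (@ler_archi _ _ (C * h ^+ 2 * nrm chi)) => N.
set t := h / N.+1%:R.
have t0 : 0 <= t by rewrite divr_ge0.
have Nt : N.+1%:R * t = h by rewrite mulrC divfK.
have jt (j : 'I_N.+1) : j%:R * t + t <= h.
  by rewrite -Nt (_ : _ + t = j.+1%:R * t) ?ler_wpM2r ?ler_nat// -natr1; ring.
pose F1 (j : 'I_N.+1) x := chi x * (v (x + (j%:R * t + t) *: e_ k) -
  v (x + (j%:R * t) *: e_ k) - t * 'D_(e_ k) v (x + (j%:R * t) *: e_ k)).
pose F2 (j : 'I_N.+1) x := t * (chi x * ('D_(e_ k) v (x + (j%:R * t) *: e_ k) - 'D_(e_ k) v x)).
have sF1 j : sqint (F1 j).
  apply: schi => x; apply: cvgB; first by apply: cvgB; exact: (csh _ _ cv x).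
  by apply: cvgM; [exact: cvg_cst|exact: (csh _ _ cdv x)].
have sF2 j : sqint (F2 j).
  by apply: sqintZ; apply: schi => x; apply: cvgB; [exact: (csh _ _ cdv x)|exact: cdv].
have nF1 j : nrm (F1 j) <= C * t ^+ 2 * nrm chi.
  have E : nrm (fun x => C * t ^+ 2 * chi x) = C * t ^+ 2 * nrm chi.
    by rewrite nrmZ// ger0_norm// mulr_ge0// sqr_ge0.
  rewrite -E; apply: ler_nrm => //; first exact: sqintZ.
  move=> x; rewrite /F1; have [Sx|/chi0 ->] := pselect (S x); last first.
    by rewrite mul0r mulr0.
  rewrite normrM [leRHS]normrM mulrC; apply: ler_wpM2r => //.
  rewrite [leRHS]ger0_norm; last by rewrite mulr_ge0// sqr_ge0.
  by apply: HC => //; rewrite mulr_ge0.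
have nF2 j : nrm (F2 j) <= t * B.
  rewrite nrmZ; last by apply: schi => x; apply: cvgB; [exact: (csh _ _ cdv x)|exact: cdv].
  rewrite ger0_norm// ler_wpM2l//; apply: HB.
  have := jt j; have : 0 <= j%:R * t by rewrite mulr_ge0.
  by move=> *; apply/andP; split; lra.
have -> : (fun x => chi x * (v ((x : R * R) + h *: e_ k) - v x - h * 'D_(e_ k) v x)) =
   (fun x => (\sum_j F1 j x) + (\sum_j F2 j x)).
  apply/funext => x; rewrite /F1 /F2 -!mulr_sumr mulrCA -mulrDr; congr (_ * _).
  rewrite mulr_sumr -big_split/=.
  pose V (n : nat) := v (x + (n%:R * t) *: e_ k).
  have -> : v (x + h *: e_ k) - v x = \sum_(j < N.+1) (V j.+1 - V j).
    rewrite -(big_mkord xpredT (fun j => V j.+1 - V j)) telescope_sumr//.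
    by rewrite /V mul0r scale0r addr0 Nt.
  have -> : h * 'D_(e_ k) v x = \sum_(j < N.+1) t * 'D_(e_ k) v x.
    by rewrite sumr_const card_ord -[RHS]mulr_natl mulrA Nt.
  rewrite -sumrB; apply: eq_bigr => j _.
  by rewrite /V -natr1 mulrDl mul1r; ring.
have [sS1 nS1] := nrm_sum (index_enum 'I_N.+1) sF1.
have [sS2 nS2] := nrm_sum (index_enum 'I_N.+1) sF2.
apply: (le_trans (nrmD sS1 sS2)).
apply: (le_trans (lerD nS1 nS2)).
apply: (le_trans (lerD (ler_sum _ (fun j _ => nF1 j)) (ler_sum _ (fun j _ => nF2 j)))).
rewrite !sumr_const !card_ord -[X in X + _]mulr_natl -[X in _ + X]mulr_natl.
rewrite [X in _ + X]mulrA Nt addrC lerD2l.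
have -> : N.+1%:R * (C * t ^+ 2 * nrm chi) = C * h ^+ 2 * nrm chi / N.+1%:R.
  have N0 : N.+1%:R != 0 :> R by rewrite pnatr_eq0.
  by rewrite /t; move: N.+1%:R N0 => m m0; field.
by [].
Qed.

(** [chi] is supported in [S], and the segments from [S] stay in [U]: there [f] and
    its derivative [g] are limits of the smooth [vn] and their derivatives, and
    the bound of [remainder_smooth] does not depend on [n]. *)
Lemma remainder_sobolev U f g (vn : nat -> R * R -> R) chi k M S (h B : R) :
  sqint f -> sqint g -> (forall n, smooth2 (vn n)) ->
  (forall n, sqint (fun x => vn n x * \1_U x)) ->
  (forall n, sqint (fun x => 'D_(e_ k) (vn n) x * \1_U x)) ->
  nrm (fun x => vn n x * \1_U x - f x) @[n --> \oo] --> (0 : R) ->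
  nrm (fun x => 'D_(e_ k) (vn n) x * \1_U x - g x) @[n --> \oo] --> (0 : R) ->
  measurable_fun setT (chi : plane -> R) ->
  (forall x, `|chi x| <= M) -> compact S -> (forall x, ~ S x -> chi x = 0) ->
  0 <= h -> (forall x t, S x -> 0 <= t <= h -> U (x + t *: e_ k)) ->
  (forall t, 0 <= t <= h ->
    nrm (fun x => chi x * (g ((x : R * R) + t *: e_ k) - g x)) <= B) ->
  nrm (fun x => chi x *
    (f ((x : R * R) + h *: e_ k) - f x - h * g x)) <= h * B.
Proof.
move=> sf sg svn sP sQ cP cQ mchi chiM cS chi0 h0 SU HB.
have M0 : 0 <= M by apply: le_trans (chiM (0, 0)).
have schi w : sqint w -> sqint (fun x => chi x * w x).
  exact: sqint_bounded_mul.
have nchi w : sqint w -> nrm (fun x => chi x * w x) <= M * nrm w.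
  move=> sw; rewrite -[M]ger0_norm// -nrmZ//.
  apply: ler_nrm; [exact: schi|exact: sqintZ|move=> x].
  by rewrite !normrM (ger0_norm M0) ler_wpM2r.
pose e1 n := nrm (fun x => vn n x * \1_U x - f x).
pose e2 n := nrm (fun x => 'D_(e_ k) (vn n) x * \1_U x - g x).
suff H n : nrm (fun x => chi x * (f ((x : R * R) + h *: e_ k) - f x - h * g x)) <=
    h * B + (3 * h * M * e2 n + 2 * M * e1 n).
  have c : h * B + (3 * h * M * e2 n + 2 * M * e1 n) @[n --> \oo] --> h * B.
    rewrite -[X in _ --> X]addr0; apply: cvgD; first exact: cvg_cst.
    rewrite -[X in _ --> X]addr0; apply: cvgD.
      by rewrite -[X in _ --> X](mulr0 (3 * h * M)); apply: cvgMl_tmp.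
    by rewrite -[X in _ --> X](mulr0 (2 * M)); apply: cvgMl_tmp.
  rewrite -(cvg_lim _ c)//; apply: limr_ge; first by apply/cvg_ex; exists (h * B).
  exact: nearW.
pose p := vn n; pose P x := p x * \1_U x; pose Q x := 'D_(e_ k) p x * \1_U x.
have sPf : sqint (fun x => P x - f x) := sqintB (sP n) sf.
have sQg : sqint (fun x => Q x - g x) := sqintB (sQ n) sg.
have in_U x t (F : R * R -> R) : S x -> 0 <= t <= h ->
    F (x + t *: e_ k) = F (x + t *: e_ k) * \1_U (x + t *: e_ k).
  by move=> Sx th; rewrite indicE mem_set ?mulr1//; exact: SU.
have in_U0 x (F : R * R -> R) : S x -> F x = F x * \1_U x.
  move=> Sx; have := in_U x 0 F Sx; rewrite scale0r addr0; apply.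
  by rewrite lexx.
have H1 t : 0 <= t <= h ->
    nrm (fun x => chi x * ('D_(e_ k) p ((x : R * R) + t *: e_ k) - 'D_(e_ k) p x)) <=
    B + 2 * M * e2 n.
  move=> th.
  have -> : (fun x => chi x * ('D_(e_ k) p ((x : R * R) + t *: e_ k) - 'D_(e_ k) p x)) =
      (fun x => chi x * (g ((x : R * R) + t *: e_ k) - g x) +
      (chi x * (Q ((x : R * R) + t *: e_ k) - g ((x : R * R) + t *: e_ k)) -
       chi x * (Q x - g x))).
    apply/funext => x; have [Sx|/chi0 ->] := pselect (S x); last by rewrite !mul0r subr0 addr0.
    rewrite (in_U x t ('D_(e_ k) p) Sx th) (in_U0 x ('D_(e_ k) p) Sx) /Q; ring.
  have ss := sqint_shift (t *: e_ k) sQg.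
  apply: (le_trans (nrmD _ _)); first by apply: schi; apply: sqintB => //; exact: sqint_shift.
    by apply: sqintB; apply: schi.
  apply: lerD; first exact: HB.
  apply: (le_trans (nrmB (schi _ ss) (schi _ sQg))).
  have := lerD (nchi _ ss) (nchi _ sQg).
  by rewrite (nrm_shift _ sQg) -/(e2 n); lra.
have H2 := remainder_smooth (svn n) mchi chiM cS chi0 h0 H1.
have sPh := sqint_shift (h *: e_ k) sPf.
have hh : 0 <= h <= h by rewrite h0 lexx.
have sR : sqint (fun x => P ((x : R * R) + h *: e_ k) - P x - h * Q x).
  by apply: sqintB; [apply: sqintB; [exact: sqint_shift (sP n)|exact: sP]|apply: sqintZ; exact: sQ].
have E : (fun x => chi x * (p ((x : R * R) + h *: e_ k) - p x - h * 'D_(e_ k) p x)) =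
    (fun x => chi x * (P ((x : R * R) + h *: e_ k) - P x - h * Q x)).
  apply/funext => x; have [Sx|/chi0 ->] := pselect (S x); last by rewrite !mul0r.
  by rewrite (in_U x h _ Sx hh) (in_U0 x p Sx) (in_U0 x ('D_(e_ k) p) Sx).
rewrite E in H2.
have -> : (fun x => chi x * (f ((x : R * R) + h *: e_ k) - f x - h * g x)) =
    (fun x => chi x * (P ((x : R * R) + h *: e_ k) - P x - h * Q x) +
    ((chi x * (P x - f x) -
      chi x * (P ((x : R * R) + h *: e_ k) - f ((x : R * R) + h *: e_ k))) +
     h * (chi x * (Q x - g x)))).
  by apply/funext => x; ring.
apply: (le_trans (nrmD _ _)); [exact: schi| |].
  apply: sqintD; last by apply: sqintZ; exact: schi.
  by apply: sqintB; apply: schi.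
have B1 : nrm (fun x => chi x * (P x - f x) -
      chi x * (P ((x : R * R) + h *: e_ k) - f ((x : R * R) + h *: e_ k))) <= 2 * M * e1 n.
  apply: (le_trans (nrmB (schi _ sPf) (schi _ sPh))).
  have := lerD (nchi _ sPf) (nchi _ sPh).
  by rewrite (nrm_shift _ sPf) -/(e1 n); lra.
have B2 : nrm (fun x => h * (chi x * (Q x - g x))) <= h * M * e2 n.
  rewrite nrmZ; last exact: schi.
  by rewrite ger0_norm// -mulrA ler_wpM2l// nchi.
have B3 := nrmD (sqintB (schi _ sPf) (schi _ sPh)) (sqintZ h (schi _ sQg)).
apply: (le_trans (lerD H2 (le_trans B3 (lerD B1 B2)))); lra.
Qed.

End Remainder.

(** * Cut-off functions *)

Section Cutoff.
Import finmap.
Context {R : realType}.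
Implicit Types (f g phi : R * R -> R) (x : R * R) (U Om K W : set (R * R)).
Local Notation plane := (measurableTypeR R * measurableTypeR R)%type.
Local Notation mu := (@leb2 R).

Definition smooth_step (sigma : R -> R) :=
  [/\ smooth1 sigma, forall s, 0 <= sigma s <= 1,
      forall s, s <= 0 -> sigma s = 0 &
      exists2 a, 0 < a & forall s, a <= s -> sigma s = 1].

(** A product of one step at each side of the box. *)
Lemma box_bump sigma (p : R * R) (r : R) : smooth_step sigma -> 0 < r ->
  exists b : R * R -> R, [/\ smooth2 b, forall x, 0 <= b x <= 1,
    forall x, ~ cbox p r x -> b x = 0 & forall x, cbox p (r / 2) x -> b x = 1].
Proof.
move=> [ssig sig01 sig0 [a a0 siga]] r0.
have c0 : 0 < 2 * a / r by rewrite divr_gt0// mulr_gt0.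
set c := 2 * a / r in c0.
have cr : c * (r / 2) = a by rewrite /c; field; rewrite gt_eqF.
pose b x := (sigma (aff c 0 (c * (r - p.1)) x) * sigma (aff (- c) 0 (c * (r + p.1)) x)) *
  (sigma (aff 0 c (c * (r - p.2)) x) * sigma (aff 0 (- c) (c * (r + p.2)) x)).
have E1 x : aff c 0 (c * (r - p.1)) x = c * (x.1 - (p.1 - r)) by rewrite /aff; ring.
have E2 x : aff (- c) 0 (c * (r + p.1)) x = c * (p.1 + r - x.1) by rewrite /aff; ring.
have E3 x : aff 0 c (c * (r - p.2)) x = c * (x.2 - (p.2 - r)) by rewrite /aff; ring.
have E4 x : aff 0 (- c) (c * (r + p.2)) x = c * (p.2 + r - x.2) by rewrite /aff; ring.
have m01 (s t : R) : 0 <= s <= 1 -> 0 <= t <= 1 -> 0 <= s * t <= 1.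
  by move=> /andP[? ?] /andP[? ?]; rewrite mulr_ge0//= mulr_ile1.
exists b; split.
- by apply: smooth2_mul; apply: smooth2_mul; exact: smooth2_aff.
- by move=> x; rewrite /b !m01.
- move=> x nx; rewrite /b E1 E2 E3 E4.
  have z (s : R) : s <= 0 -> sigma (c * s) = 0 by move=> s0; apply: sig0; rewrite pmulr_rle0.
  have [h1|h1] := leP (x.1 - (p.1 - r)) 0; first by rewrite (z _ h1) !mul0r.
  have [h2|h2] := leP (p.1 + r - x.1) 0; first by rewrite (z _ h2) mulr0 !mul0r.
  have [h3|h3] := leP (x.2 - (p.2 - r)) 0; first by rewrite (z _ h3) mul0r mulr0.
  have [h4|h4] := leP (p.2 + r - x.2) 0; first by rewrite (z _ h4) !mulr0.
  by exfalso; apply: nx; split; rewrite /= in_itv/=; apply/andP; split; lra.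
- move=> x [/=]; rewrite !in_itv/= => /andP[h1 h2] /andP[h3 h4].
  have o (s : R) : r / 2 <= s -> sigma (c * s) = 1.
    by move=> rs; apply: siga; rewrite -cr ler_wpM2l// ltW.
  by rewrite /b E1 E2 E3 E4 !o ?mulr1//; lra.
Qed.

(** One minus the product of [1 - b] over the bumps [b] of a finite cover. *)
Lemma cutoff sigma K U : smooth_step sigma -> compact K -> open U -> K `<=` U ->
  exists phi, [/\ test_function U phi, forall x, 0 <= phi x <= 1 &
    forall x, K x -> phi x = 1].
Proof.
move=> ssig cK oU KU.
have /choice[r rP] : forall x, exists r, K x -> 0 < r /\ cbox x r `<=` U.
  move=> x; have [Kx|nKx] := pselect (K x); last by exists 0.
  by have [r r0 rU] := open_cbox oU (KU _ Kx); exists r.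
have /choice[b bP] : forall x, exists b : R * R -> R, K x ->
   [/\ smooth2 b, forall y, 0 <= b y <= 1,
    forall y, ~ cbox x (r x) y -> b y = 0 & forall y, cbox x (r x / 2) y -> b y = 1].
  move=> x; have [Kx|nKx] := pselect (K x); last by exists (fun=> 0).
  by have [b] := box_bump x ssig (rP _ Kx).1; exists b.
have cvK : cover_compact K.
  pose P : ptopologicalType := HB.pack (R * R)%type
    (Pointed.on (R * R)%type) (Topological.on (R * R)%type).
  by rewrite -[@cover_compact _](@compact_cover P).
have := cvK _ K (fun x => obox x (r x / 2)).
case=> [x _|x Kx|D DK KD]; first exact: obox_open.
  exists x => //; have := (rP _ Kx).1 => rx.
  by split; rewrite /= in_itv/=; apply/andP; split; lra.
have DK' x : x \in D -> K x by move=> xD; apply: set_mem; exact: DK.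
pose s : seq (R * R) := enum_fset D.
pose B x := if x \in D then b x else fun=> 0.
have B01 x y : 0 <= B x y <= 1.
  by rewrite /B; case: ifPn => [/DK'/bP[]//|_]; rewrite lexx ler01.
have p01 y : 0 <= \prod_(x <- s) (1 - B x y) <= 1.
  elim: s => [|x s IH]; first by rewrite big_nil ler01 lexx.
  rewrite big_cons; have /andP[h1 h2] := B01 x y; have /andP[h3 h4] := IH.
  by rewrite mulr_ge0 ?subr_ge0//= mulr_ile1// ?subr_ge0// gerBl.
pose phi y := 1 - \prod_(x <- s) (1 - B x y).
exists phi; split.
- apply/test_functionP; split.
    apply: smooth2_sub; first exact: smooth2_cst.
    apply: smooth2_prod => x; apply: smooth2_sub; first exact: smooth2_cst.
    by rewrite /B; case: ifPn => [/DK'/bP[]//|_]; exact: smooth2_cst.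
  exists (\bigcup_(x in [set` D]) cbox x (r x)); split.
  + by rewrite bigcup_fset; apply: bigsetU_compact => x _; exact: cbox_compact.
  + by move=> y [x /= /DK' Kx]; exact: (rP _ Kx).2.
  + move=> y ny; rewrite /phi big1_seq ?subrr// => x /andP[_ xs].
    have xD : x \in D by [].
    rewrite /B xD; have [_ _ -> //] := bP _ (DK' _ xD); first by rewrite subr0.
    by move=> yx; apply: ny; exists x.
- by move=> y; have /andP[h1 h2] := p01 y; rewrite /phi subr_ge0 h2/= gerBl.
- move=> y /KD[x /= xD xy]; rewrite /phi.
  rewrite (big_rem x)//= /B xD; have [_ _ _ ->] := bP _ (DK' _ xD).
    by rewrite subrr mul0r subr0.
  exact: obox_sub_cbox.
Qed.

Lemma loc_int_test Om f phi : locally_integrable2 Om f -> test_function Om phi ->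
  mu.-integrable setT (EFin \o (fun x => f x * phi x)).
Proof.
move=> lf /[dup] tphi /test_functionP[sphi [K [cK KOm phi0]]].
have [M M0 HM] := test_function_bounded tphi.
have mK := compact_measurable2 cK.
have fK := lf K cK KOm.
have : mu.-integrable K (EFin \o (fun x => f x * phi x)).
  rewrite (_ : EFin \o _ = (EFin \o f) \* (EFin \o phi))%E; last by apply/funext.
  apply: integrableMl => //.
    by apply: measurable_funTS; exact: (continuous_measurable2 (smooth2_continuous sphi)).
  exists M; split; first exact: num_real.
  by move=> y My x _; rewrite /= (le_trans (HM x))// ltW.
move/(integrable_mkcond _ mK); congr integrable; apply/funext => x.
rewrite patchE; case: ifPn => //; rewrite notin_setE => /phi0 p0.
by rewrite /= p0 mulr0.
Qed.

Lemma Rintegral_test Om f phi : test_function Om phi ->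
  \int[mu]_(x in Om) (f x * phi x) = \int[mu]_x (f x * phi x).
Proof.
move=> tphi; rewrite Rintegral_mkcond; apply: eq_Rintegral => x _.
rewrite patchE; case: ifPn => //; rewrite notin_setE.
by move=> /(test_function_out tphi) ->; rewrite mulr0.
Qed.

End Cutoff.

(** * The fundamental lemma of the calculus of variations *)

Section FundamentalLemma.
Context {R : realType}.
Implicit Types (sigma : R -> R) (f g phi : R * R -> R) (x : R * R) (U Om K W : set (R * R)).
Local Notation plane := (measurableTypeR R * measurableTypeR R)%type.
Local Notation mu := (@leb2 R).

(** Cut-off functions of an exhausting sequence of compact sets. *)
Lemma open_indic_limit sigma U : smooth_step sigma -> open U ->
  exists phi : nat -> R * R -> R, [/\ forall n, test_function U (phi n),
    forall n x, 0 <= phi n x <= 1 &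
    forall x, phi n x @[n --> \oo] --> (\1_U x : R)].
Proof.
move=> ssig oU; have [B [BU UE]] := open_bigcup_boxes oU.
pose K n := \big[setU/set0]_(i < n) cbox (B i).1 (B i).2.
have KU n : K n `<=` U.
  by rewrite /K -(bigcup_mkord n (fun i => cbox (B i).1 (B i).2)) => x [i _]; exact: BU.
have cK n : compact (K n).
  by apply: bigsetU_compact => i _; exact: cbox_compact.
have /choice[phi phiP] n := cutoff ssig (cK n) oU (KU n).
exists phi; split=> [n|n x|x]; try by have [] := phiP n.
rewrite indicE; have [Ux|nUx] := pselect (U x).
  rewrite mem_set//.
  have : U x by []. rewrite {1}UE => -[i _ xi].
  apply: cvg_near_cst; near=> n.
  have [_ _ -> //] := phiP n.
  rewrite /K -(bigcup_mkord n (fun i => cbox (B i).1 (B i).2)); exists i; last exact: obox_sub_cbox.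
  by near: n; exact: nbhs_infty_gt.
rewrite memNset//; apply: cvg_near_cst; apply: nearW => n.
by have [tn _ _] := phiP n; apply: test_function_out tn _.
Unshelve. all: by end_near. Qed.

Lemma vanish_on_open sigma Om U K f : smooth_step sigma ->
  locally_integrable2 Om f -> open U -> U `<=` K -> compact K -> K `<=` Om ->
  (forall phi, test_function Om phi -> \int[mu]_x (f x * phi x) = 0) ->
  (\int[mu]_(x in U) (f x)%:E = 0)%E.
Proof.
move=> ssig lf oU UK cK KOm f0.
have [phi [tphi phi01 cphi]] := open_indic_limit ssig oU.
have mU := open_measurable2 oU; have mK := compact_measurable2 cK.
have fK := lf K cK KOm.
have UOm : U `<=` Om by exact: subset_trans KOm.
have ifphi n := loc_int_test lf (test_functionS UOm (tphi n)).
have fU : mu.-integrable setT ((EFin \o f) \_ U).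
  by apply/(integrable_mkcond _ mU); apply: integrableS fK.
have [||||| _ _ +] := @dominated_convergence _ _ _ mu setT measurableT
  (fun n x => (f x * phi n x)%:E) ((EFin \o f) \_ U) (abse \o ((EFin \o f) \_ K)).
- by move=> n; exact: measurable_int (ifphi n).
- exact: measurable_int fU.
- apply: aeW => x _; rewrite patchE.
  have := cphi x; rewrite indicE; case: ifPn => xU c.
    rewrite /= -{2}[f x]mulr1; apply: cvg_EFin; first exact: nearW.
    by apply: cvgMl_tmp.
  rewrite (_ : point = 0%:E)//.
  rewrite -[X in X%:E](mulr0 (f x)); apply: cvg_EFin; first exact: nearW.
  by apply: cvgMl_tmp.
- by apply: integrable_abse; apply/(integrable_mkcond _ mK).
- apply: aeW => x n _ /=; rewrite patchE; case: ifPn => xK.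
    rewrite /= lee_fin normrM ler_piMr//; have /andP[p0 p1] := phi01 n x.
    by rewrite ger0_norm.
  rewrite (_ : phi n x = 0); first by rewrite mulr0 normr0 abse_ge0.
  by move: xK; rewrite notin_setE => nK; apply: test_function_out (tphi n) _ => /UK.
rewrite -integral_mkcond => c.
have z n : (\int[mu]_x (f x * phi n x)%:E = 0)%E.
  rewrite -[LHS]fineK; last exact: integrable_fin_num (ifphi n).
  by congr EFin; apply: f0; exact: test_functionS (tphi n).
have := cvg_lim (@ereal_hausdorff R) c.
by move=> <-; rewrite (_ : (fun n => _) = cst 0%E) ?lim_cst//; apply/funext.
Qed.

(** The integral of [f] vanishes on the open subsets of each of countably many
    boxes by dominated convergence, hence on their measurable subsets by the
    pi-lambda theorem. *)
Lemma vanish_ae sigma Om f : smooth_step sigma -> open Om ->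
  locally_integrable2 Om f ->
  (forall phi, test_function Om phi -> \int[mu]_x (f x * phi x) = 0) ->
  {ae mu, forall x, Om x -> f x = 0}.
Proof.
move=> ssig oOm lf f0; have [B [BOm OmE]] := open_bigcup_boxes oOm.
suff H n : {ae mu, forall x, obox (B n).1 (B n).2 x -> f x = 0}.
  have := ae_foralln H; apply: filterS => x Hx; rewrite OmE => -[n _]; exact: Hx.
set W := obox (B n).1 (B n).2; set K := cbox (B n).1 (B n).2.
have oW : open W by exact: obox_open.
have mW := open_measurable2 oW.
have cK : compact K by exact: cbox_compact.
have WK : W `<=` K by exact: obox_sub_cbox.
pose F := (EFin \o f) \_ W.
have iF : mu.-integrable setT F.
  apply/(integrable_mkcond _ mW).
  apply: integrableS (lf K cK (BOm n)) => //; exact: measurable_cbox.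
have iFA (A : set plane) : measurable A -> mu.-integrable A F.
  by move=> mA; exact: integrableS iF.
have F0 (A : set plane) : measurable A -> (\int[mu]_(x in A) F x = 0)%E.
  have oA U : open U -> (\int[mu]_(x in U) F x = 0)%E.
    move=> oU; rewrite /F -integral_mkcondr.
    apply: (vanish_on_open (sigma := sigma) (Om := Om) (K := K)) => //.
    - exact: openI.
    - by move=> x [_ /WK].
    - exact: BOm.
  move=> mA; have : <<s [set U | open (U : set (R * R))] >> A.
    by rewrite -plane_measurable_open.
  move: A {mA}; apply: (@dynkin_induction _ plane [set U | open (U : set (R * R))]
    (fun A => \int[mu]_(x in A) F x = 0)%E) => //.
  - exact: plane_measurable_open.
  - by move=> U V; exact: openI.
  - by apply: oA; exact: openT.
  - move=> S mS S0; have := oA _ openT; rewrite -(setUv S) integral_setU//.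
    + by rewrite S0 add0e.
    + exact: measurableC.
    + by rewrite setUv; exact: measurable_int iF.
    + by rewrite disj_set2E setICr.
  - move=> S mS tS S0; rewrite integral_bigcup//; last first.
      by apply: iFA; exact: bigcupT_measurable.
    by rewrite eseries0// => i _ _; exact: S0.
have : ae_eq mu setT F (cst 0%E).
  apply: integral_ae_eq => // E _ mE.
  by rewrite F0// integral0.
apply: filterS => x /(_ Logic.I) Fx Wx; move: Fx.
by rewrite /F patchE mem_set// => -[].
Qed.

End FundamentalLemma.

(** * The derivative of the density *)

Section Density.
Context {R : realType}.

(** Difference quotients from the right of [x] towards [y] decrease to the
    directional derivative. *)
Lemma convex_tangent (f : R -> R) x y :
  (forall t a b : R, 0 <= t <= 1 -> f (t * a + (1 - t) * b) <= t * f a + (1 - t) * f b) ->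
  derivable f x 1 -> (y - x) * derive1 f x <= f y - f x.
Proof.
move=> cf df; rewrite -derive_dirE//.
have dfv : derivable f x (y - x).
  by apply: diff_derivable; exact/derivable1_diffP.
have c := cvg_dnbhs_at_right dfv.
rewrite /derive -(cvg_lim _ c)//; apply: limr_le; first by apply/cvg_ex; eexists; exact: c.
near=> t.
have t0 : 0 < t by near: t; exact: nbhs_right_gt.
have t1 : t < 1 by near: t; exact: nbhs_right_lt.
rewrite /= /GRing.scale/= ler_pdivrMl//.
have := cf t y x; rewrite (_ : t * y + (1 - t) * x = t * (y - x) + x); last by ring.
by rewrite (ltW t0) (ltW t1) => /(_ isT); lra.
Unshelve. all: by end_near. Qed.

Lemma convex_derive1_homo (f : R -> R) :
  (forall t a b : R, 0 <= t <= 1 -> f (t * a + (1 - t) * b) <= t * f a + (1 - t) * f b) ->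
  (forall x, derivable f x 1) -> {homo derive1 f : x y / x <= y}.
Proof.
move=> cf df x y; rewrite le_eqVlt => /predU1P[->//|xy].
have := convex_tangent y cf (df x); have := convex_tangent x cf (df y).
by have : 0 < y - x by [lra]; nra.
Qed.

Lemma smooth1_scale (c : R) (f : R -> R) : smooth1 f -> smooth1 (fun s => c * f s).
Proof.
move=> sf.
have E n : derive1n n (fun s => c * f s) = fun s => c * derive1n n f s.
  elim: n => [//|n IH]; rewrite derive1nS IH; apply/funext => s.
  by rewrite derive1nS !derive1E deriveMl//; exact: sf.
by move=> n x; rewrite E; apply: derivableM => //; exact: sf.
Qed.

Context (gamma s0 kappa : R) (rho1 rho : R -> R).
Context (hrho : rho_spec gamma s0 kappa rho1 rho).
Local Notation a := (derive1 rho).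

Let drho x : derivable rho x 1. Proof. by have sm := rho_smooth hrho; exact: (sm 0%N x). Qed.

Lemma drho_neg s : s < 0 -> a s = 0.
Proof.
move=> sneg; rewrite derive1E (@near_eq_derive _ _ _ _ (fun=> 0)) ?derive_cst//.
near=> t; apply: (rho_neg hrho); apply: ltW; near: t; exact: lt_nbhsl.
Unshelve. all: by end_near. Qed.

Lemma drho_pos s : s0 < s -> a s = gamma.
Proof.
move=> spos; rewrite derive1E (@near_eq_derive _ _ _ _ (fun t => gamma * t + kappa)).
  have dl : derivable (fun t : R => gamma * t) s 1.
    by apply: (@derivableM _ _ (cst gamma) id).
  rewrite (@deriveD _ _ _ (fun t : R => gamma * t) (cst kappa))//.
  by rewrite derive_cst addr0 (@deriveMl _ _ id)// derive_id mulr1.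
near=> t; apply: (rho_pos hrho); apply: ltW; near: t; exact: lt_nbhsr.
Unshelve. all: by end_near. Qed.

Lemma drho_homo : {homo a : x y / x <= y}.
Proof.
apply: convex_derive1_homo => // t x y /andP[t0 t1].
have := rho_convex hrho (Itv01 t0 t1) (x := x) (y := y).
by rewrite !convRE/= ; apply; rewrite inE.
Qed.

Lemma drho_ge0 s : 0 <= a s.
Proof.
rewrite -(@drho_neg (Num.min s 0 - 1)); first by apply: drho_homo; rewrite lerBlDr ge_min lerDl ler01.
by rewrite ltrBlDr gt_min add0r ltr01 orbT.
Qed.

Lemma drho_le s : a s <= gamma.
Proof.
rewrite -(@drho_pos (Num.max s s0 + 1)).
  by apply: drho_homo; rewrite (le_trans (y := Num.max s s0)) ?le_max ?lexx// lerDl.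
by rewrite (le_lt_trans (y := Num.max s s0)) ?le_max ?lexx ?orbT// ltrDl.
Qed.

(** The second derivative is bounded on the compact interval outside which the
    first one is locally constant; clamping reduces to that interval. *)
Lemma drho_lipschitz : exists2 L, 0 < L & forall s t, `|a s - a t| <= L * `|s - t|.
Proof.
have ssm := smooth1_derive1 (rho_smooth hrho).
have cdd : continuous (derive1 a) by apply/smooth1_continuous/smooth1_derive1.
have s0ge := rho_s0 hrho.
have ab : -1 <= s0 + 1 by lra.
have [M1 _ HM1] := EVT_max ab (continuous_subspaceT cdd).
have [M2 _ HM2] := EVT_min ab (continuous_subspaceT cdd).
pose L := `|derive1 a M1| + `|derive1 a M2| + 1.
have HL s : s \in `[-1, s0 + 1] -> `|derive1 a s| <= L.
  move=> sI; have := HM1 s sI; have := HM2 s sI.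
  have := ler_norm (derive1 a M1); have := ler_norm (- derive1 a M2).
  have := normr_ge0 (derive1 a M1); have := normr_ge0 (derive1 a M2).
  rewrite normrN ler_norml /L.
  move: (derive1 a s) (derive1 a M1) (derive1 a M2) => x y z.
  by move: `|y| `|z| => y' z' *; apply/andP; split; lra.
have L0 : 0 < L by rewrite ltr_pwDr// addr_ge0.
exists L => //.
suff H s t : s <= t -> `|a s - a t| <= L * `|s - t|.
  by move=> s t; have [/H//|/ltW/H] := leP s t; rewrite distrC (distrC t).
move=> st.
pose cl (s : R) := Num.max (-1) (Num.min s (s0 + 1)).
have clE s' : a (cl s') = a s'.
  rewrite /cl; case: (leP s' (s0 + 1)) => h1; case: (leP (-1) _) => h2 //.
  - by rewrite !drho_neg//; lra.
  - by rewrite !drho_pos//; lra.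
  - by exfalso; lra.
have cI s' : cl s' \in `[-1, s0 + 1].
  by rewrite in_itv/= /cl le_max lexx/= ge_max ab ge_min lexx orbT.
have cm : cl s <= cl t.
  rewrite /cl ge_max !le_max lexx/=; apply/orP; right.
  by rewrite le_min !ge_min st lexx !orbT.
have cd : cl t - cl s <= t - s.
  rewrite lerBlDr {1}/cl ge_max; apply/andP; split.
    by have : -1 <= cl s by [rewrite /cl le_max lexx]; lra.
  have h1 : Num.min s (s0 + 1) <= cl s by rewrite /cl le_max lexx orbT.
  suff : Num.min t (s0 + 1) <= t - s + Num.min s (s0 + 1) by lra.
  by case: (leP s (s0 + 1)) => h; rewrite ge_min; apply/orP; [left|right]; lra.
rewrite -(clE s) -(clE t) distrC (distrC s).
have [c] := @MVT_segment R a (derive1 a) (cl s) (cl t) cm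
  (fun x _ => DeriveDef (ssm 0%N x) (esym (derive1E a x)))
  (continuous_subspaceT (smooth1_continuous ssm)).
rewrite in_itv/= => /andP[c1 c2] ->; rewrite normrM ler_pM//.
  apply: HL; have := cI s; have := cI t; rewrite !in_itv/= => /andP[_ h1] /andP[h2 _].
  by apply/andP; split; lra.
by rewrite !ger0_norm ?subr_ge0.
Qed.

(** The derivative of the density is itself a smooth transition from [0] to
    [gamma]; normalised, it supplies the cut-off functions. *)
Lemma drho_step : smooth_step (fun s => gamma^-1 * a s).
Proof.
have g0 := rho_gamma hrho.
split.
- by apply: smooth1_scale; apply: smooth1_derive1; exact: (rho_smooth hrho).
- move=> s; apply/andP; split; first by rewrite mulr_ge0 ?drho_ge0// invr_ge0 ltW.
  by rewrite ler_pdivrMl// mulr1 drho_le.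
- move=> s; rewrite le_eqVlt => /predU1P[->|/drho_neg ->]; last by rewrite mulr0.
  suff -> : a 0 = 0 by rewrite mulr0.
  apply/eqP; rewrite eq_le drho_ge0 andbT; apply/ler_addgt0Pr => e e0; rewrite add0r.
  have [L L0 HL] := drho_lipschitz.
  have eL : 0 < e / L by rewrite divr_gt0.
  have := HL 0 (- (e / L)); rewrite (drho_neg (s := - (e / L))) ?oppr_lt0//.
  by rewrite subr0 opprK add0r (ger0_norm (drho_ge0 0)) gtr0_norm// mulrC divfK// gt_eqF.
- exists (s0 + 1) => [|s]; first by have := rho_s0 hrho; lra.
  by move=> hs; rewrite drho_pos ?mulVf ?gt_eqF//; lra.
Qed.

Lemma drho_mono s t : 0 <= (a s - a t) * (s - t).
Proof.
have [st|/ltW st] := leP s t; have := drho_homo st; nra.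
Qed.

Lemma drho_sqr_le L : (forall s t, `|a s - a t| <= L * `|s - t|) ->
  forall s t, (a s - a t) ^+ 2 <= L * ((a s - a t) * (s - t)).
Proof.
move=> HL s t; rewrite -(ger0_norm (drho_mono s t)) normrM mulrCA.
by rewrite -real_normK ?num_real// expr2 ler_wpM2l.
Qed.

(** [a] is constant on each side of [[0, s0]]: a pair with different values has an
    end within distance [s0] of [0], or has this interval between its ends. So
    [s] is large only if [t - s] is. *)
Lemma drho_arg_le s t : `|a t - a s| * `|s| <= `|a t - a s| * s0 + (a t - a s) * (t - s).
Proof.
have s0ge := rho_s0 hrho.
rewrite -(ger0_norm (drho_mono t s)) normrM -mulrDr.
have [->|/negP ne] := eqVneq (a t) (a s); first by rewrite subrr normr0 !mul0r.
apply: ler_wpM2l => //.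
have [sneg|spos] := ltP s 0.
  have [tneg|tpos] := ltP t 0; first by case: ne; rewrite !drho_neg.
  have := ler_norm (t - s); rewrite (ltr0_norm sneg); lra.
rewrite (ger0_norm spos); have [ss0|ss0] := leP s s0.
  by apply: (le_trans ss0); rewrite lerDl.
have [ts0|ts0] := leP t s0; last by case: ne; rewrite !drho_pos.
have := ler_norm (s - t); rewrite distrC; lra.
Qed.

End Density.

(** * The pointwise energy inequality *)
Section Matrix2.
Context {R : realType}.
Implicit Types A : 'M[R]_2.

Lemma ord2 (j : 'I_2) : j = 0 \/ j = 1.
Proof. by case: j => -[|[|//]] jj; [left|right]; apply: val_inj. Qed.

Lemma sum2 (f : 'I_2 -> R) : \sum_i f i = f 0 + f 1.
Proof. by rewrite big_ord_recr big_ord1/=; congr (f _ + f _); apply: val_inj. Qed.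

Lemma det2 A : \det A = A 0 0 * A 1 1 - A 0 1 * A 1 0.
Proof.
rewrite (expand_det_row _ 0) sum2 /cofactor !det_mx11 !mxE/=.
rewrite expr0 expr1 mul1r mulN1r mulrN.
by congr (_ * A _ _ - _ * A _ _); apply: val_inj.
Qed.

Lemma cofE A : (cof A 0 0 = A 1 1) * (cof A 0 1 = - A 1 0) *
  (cof A 1 0 = - A 0 1) * (cof A 1 1 = A 0 0).
Proof.
rewrite /cof; repeat split; rewrite !mxE /cofactor !det_mx11 !mxE/=
   ?expr0 ?expr1 ?exprS ?mul1r ?mulN1r ?mulr1 ?opprK ?mul1r ?expr0; try congr (- _); congr (A _ _); exact: val_inj.
Qed.

Lemma cofB A A' i j : cof (A' - A) i j = cof A' i j - cof A i j.
Proof.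
have [->|->] := ord2 i; have [->|->] := ord2 j; rewrite !cofE !mxE; ring.
Qed.

(** The field of the Euler-Lagrange equation at gradient [A], [a] standing for the
    derivative of the density at [\det A]. *)
Definition stress (a : R) A i j : R := A i j + a * cof A i j.

(** The determinant is quadratic, so that the increment of [a cof A] paired with
    that of [A] is [(a' - a) (det A' - det A) + (a + a') det (A' - A)], and
    [|det B| <= |B|^2 / 2]. *)
Lemma stress_monotone gamma a a' A A' :
  0 <= a <= gamma -> 0 <= a' <= gamma ->
  (1 - gamma) * (\sum_i \sum_j (A' i j - A i j) ^+ 2) + (a' - a) * (\det A' - \det A)
    <= \sum_i \sum_j (stress a' A' i j - stress a A i j) * (A' i j - A i j).
Proof.
move=> /andP[a0 ag] /andP[a'0 a'g]; rewrite !sum2 !det2 /stress !cofE.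
set p := A' 0 0 - A 0 0; set q := A' 0 1 - A 0 1.
set r := A' 1 0 - A 1 0; set s := A' 1 1 - A 1 1.
set t := (X in _ <= X); set dd := (X in (a' - a) * X).
have -> : t = (p ^+ 2 + q ^+ 2 + (r ^+ 2 + s ^+ 2)) + (a' - a) * dd +
    (a + a') * (p * s - q * r) by rewrite /t /dd /p /q /r /s; ring.
have h : 0 <= (a + a') * (2 * (p * s - q * r) + (p ^+ 2 + q ^+ 2 + (r ^+ 2 + s ^+ 2))).
  apply: mulr_ge0; first lra.
  by have := sqr_ge0 (p + s); have := sqr_ge0 (q - r); nra.
have h' : 0 <= (2 * gamma - (a + a')) * (p ^+ 2 + q ^+ 2 + (r ^+ 2 + s ^+ 2)).
  by apply: mulr_ge0; [lra|rewrite !addr_ge0 ?sqr_ge0].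
by move: h h'; lra.
Qed.

(** Cramer's rule [A^T cof A = det A], paired with the tensor product of the
    [k]-th column of [A] and [n]. This is where a product of two gradients, only
    integrable, becomes a function of the determinant alone. *)
Lemma cof_gradient A k (n : 'I_2 -> R) :
  \sum_i \sum_j cof A i j * (A i k * n j) = \det A * n k.
Proof.
by have [->|->] := ord2 k; rewrite !sum2 det2 !cofE; ring.
Qed.

Lemma ler_sum2 (f g : 'I_2 -> 'I_2 -> R) : (forall i j, `|f i j| <= g i j) ->
  - (\sum_i \sum_j f i j) <= \sum_i \sum_j g i j.
Proof.
move=> fg; rewrite -sumrN; apply: ler_sum => i _; rewrite -sumrN; apply: ler_sum => j _.
by apply: le_trans (fg i j); rewrite ler_normr lexx orbT.
Qed.

(** Here [A] and [A'] are the gradients of [u] at two points at distance [h], [w]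
    the difference of the values of [u], and [n] the gradient of the cut-off
    [eta]. On the right come the integrand of the tested equation, two sums of
    products that are small in mean square, and a term of order [h ^ 2].

    The dangerous term is [(a' - a) cof A], which pairs with [2 eta w n]. Writing
    [w] as [h] times the [k]-th column of [A] plus a remainder, Cramer's rule
    turns it into [2 eta h (a' - a) det A n_k], and the hypothesis on
    [(a' - a) det A] lets the nonnegative [p = (a' - a) (det A' - det A)], which
    monotonicity provides with the factor [eta ^ 2], absorb it. *)
Lemma energy_pointwise gamma s0 L h a a' A A' eta k (n w : 'I_2 -> R) :
  0 < L -> 0 <= h -> 0 <= a <= gamma -> 0 <= a' <= gamma ->
  0 <= (a' - a) * (\det A' - \det A) ->
  (a' - a) ^+ 2 <= L * ((a' - a) * (\det A' - \det A)) ->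
  `|a' - a| * `|\det A| <= `|a' - a| * s0 + (a' - a) * (\det A' - \det A) ->
  gamma < 1 ->
  (1 - gamma) * (\sum_i \sum_j (eta * (A' i j - A i j)) ^+ 2) <=
  \sum_i \sum_j (stress a' A' i j - stress a A i j) *
     (eta ^+ 2 * (A' i j - A i j) + 2 * eta * n j * w i)
  + \sum_i \sum_j 2 * ((`|eta * (A' i j - A i j)| + `|eta * cof (A' - A) i j|) * `|n j * w i|)
  + \sum_i \sum_j 2 * (`|n j * cof A i j| * `|eta * (w i - h * A i k)|)
  + 4 * h ^+ 2 * (L * (s0 * n k) ^+ 2 + n k ^+ 2 * `|\det A' - \det A|).
Proof.
move=> L0 h0 a0g a'0g; set p := (a' - a) * (\det A' - \det A) => p0 da2 dad g1.
have mono := stress_monotone A A' a0g a'0g; rewrite -/p in mono.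
have e2 : 0 <= eta ^+ 2 by exact: sqr_ge0.
have /andP[a0 ag] := a0g; have /andP[a'0 a'g] := a'0g.
have da1 : `|a' - a| <= 1 by rewrite ler_norml; apply/andP; split; lra.
(* the increment of [a cof A] is [a' cof (A' - A) + (a' - a) cof A] *)
have E1 : \sum_i \sum_j (stress a' A' i j - stress a A i j) *
     (eta ^+ 2 * (A' i j - A i j) + 2 * eta * n j * w i) =
  eta ^+ 2 * (\sum_i \sum_j (stress a' A' i j - stress a A i j) * (A' i j - A i j)) +
  \sum_i \sum_j 2 * ((eta * (A' i j - A i j) + a' * (eta * cof (A' - A) i j)) * (n j * w i)) +
  \sum_i \sum_j 2 * (a' - a) * ((n j * cof A i j) * (eta * (w i - h * A i k))) +
  2 * (a' - a) * eta * h * (\det A * n k).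
  rewrite -cof_gradient /stress !sum2 !cofB; ring.
have E2 : \sum_i \sum_j (eta * (A' i j - A i j)) ^+ 2 =
    eta ^+ 2 * \sum_i \sum_j (A' i j - A i j) ^+ 2 by rewrite !sum2; ring.
have B1 : - (\sum_i \sum_j 2 * ((eta * (A' i j - A i j) + a' * (eta * cof (A' - A) i j)) * (n j * w i)))
   <= \sum_i \sum_j 2 * ((`|eta * (A' i j - A i j)| + `|eta * cof (A' - A) i j|) * `|n j * w i|).
  apply: ler_sum2 => i j; rewrite normrM (ger0_norm (ler0n _ 2)) ler_wpM2l//.
  rewrite normrM ler_wpM2r//; apply: (le_trans (ler_normD _ _)); rewrite lerD2l.
  by rewrite normrM ger0_norm// ler_piMl//; lra.
have B2 : - (\sum_i \sum_j 2 * (a' - a) * ((n j * cof A i j) * (eta * (w i - h * A i k))))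
   <= \sum_i \sum_j 2 * (`|n j * cof A i j| * `|eta * (w i - h * A i k)|).
  apply: ler_sum2 => i j; rewrite normrM normrM (ger0_norm (ler0n _ 2)) -mulrA ler_wpM2l//.
  by rewrite normrM ler_piMl// mulr_ge0.
have B3 : - (2 * (a' - a) * eta * h * (\det A * n k)) <=
    eta ^+ 2 * p + 4 * h ^+ 2 * (L * (s0 * n k) ^+ 2 + n k ^+ 2 * `|\det A' - \det A|).
  have hp : p <= `|\det A' - \det A|.
    by rewrite -(ger0_norm p0) normrM ler_piMl.
  apply: (@le_trans _ _ (2 * (`|eta| * `|n k|) * h * (`|a' - a| * `|\det A|))).
    have -> : 2 * (`|eta| * `|n k|) * h * (`|a' - a| * `|\det A|) =
      `|2 * (a' - a) * eta * h * (\det A * n k)|.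
      by rewrite !normrM (ger0_norm h0) (ger0_norm (ler0n _ 2)); ring.
    by rewrite ler_normr lexx orbT.
  apply: (@le_trans _ _ (2 * (`|eta| * `|n k|) * h * (`|a' - a| * s0 + p))).
    by rewrite ler_wpM2l// !mulr_ge0.
  rewrite -(real_normK (num_real eta)) exprMn -(real_normK (num_real (n k))).
  move: da2; rewrite -(real_normK (num_real (a' - a))).
  move: (normr_ge0 eta) (normr_ge0 (n k)) (normr_ge0 (a' - a)).
  move: `|eta| `|n k| `|a' - a| => e N da e0 N0 d0 da2.
  (* each of the two products takes a quarter of [eta ^ 2 p] by Young's inequality *)
  have c1 : 2 * (e * N) * h * (da * s0) <= e ^+ 2 * p / 4 + 4 * h ^+ 2 * (L * (s0 ^+ 2 * N ^+ 2)).
    rewrite -(ler_pM2l L0).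
    have := sqr_ge0 (e * da / 2 - 2 * L * h * s0 * N).
    have : e ^+ 2 * da ^+ 2 <= e ^+ 2 * (L * p) by rewrite ler_wpM2l// sqr_ge0.
    nra.
  have c2 : 2 * (e * N) * h * p <= e ^+ 2 * p / 4 + 4 * h ^+ 2 * (N ^+ 2 * p).
    have := mulr_ge0 p0 (sqr_ge0 (e / 2 - 2 * N * h)); nra.
  have c3 : N ^+ 2 * p <= N ^+ 2 * `|\det A' - \det A| by rewrite ler_wpM2l// sqr_ge0.
  have c4 : 4 * h ^+ 2 * (N ^+ 2 * p) <= 4 * h ^+ 2 * (N ^+ 2 * `|\det A' - \det A|).
    by rewrite ler_wpM2l// mulr_ge0// sqr_ge0.
  have c5 : 0 <= e ^+ 2 * p by rewrite mulr_ge0// sqr_ge0.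
  lra.
rewrite E1 E2.
have := ler_wpM2l e2 mono; move: B1 B2 B3; lra.
Qed.

End Matrix2.

(** * The energy estimate for difference quotients *)

Section MoreL2.
Context d (T : measurableType d) (R : realType).
Context (mu : {measure set T -> \bar R}).
Implicit Types (f g : T -> R).

(** Integrability and value together, so that integrating the terms of the
    pointwise inequality is one derivation following its syntax. *)
Definition has_integral f (r : R) :=
  mu.-integrable setT (EFin \o f) /\ \int[mu]_x f x = r.

Lemma has_integral_ip f g : sqint mu f -> sqint mu g ->
  has_integral (fun x => f x * g x) (ip mu f g).
Proof. by move=> sf sg; split=> //; exact: sqint_integrable_mul. Qed.

Lemma has_integralD f g r s : has_integral f r -> has_integral g s ->
  has_integral (fun x => f x + g x) (r + s).
Proof.
move=> [iF <-] [iG <-]; split; last by rewrite RintegralD.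
rewrite (_ : EFin \o _ = (EFin \o f) \+ (EFin \o g))%E; first exact: integrableD.
by apply/funext => x; rewrite /= EFinD.
Qed.

Lemma has_integralZ c f r : has_integral f r -> has_integral (fun x => c * f x) (c * r).
Proof.
move=> [iF <-]; split; last by rewrite RintegralZl.
by rewrite (_ : EFin \o _ = (fun x => c%:E * (EFin \o f) x)%E)//; exact: integrableZl.
Qed.

Lemma has_integral_sum2 (h : 'I_2 -> 'I_2 -> T -> R) (r : 'I_2 -> 'I_2 -> R) :
  (forall i j, has_integral (h i j) (r i j)) ->
  has_integral (fun x => \sum_i \sum_j h i j x) (\sum_i \sum_j r i j).
Proof.
move=> H; rewrite (_ : (fun x => _) =
    (fun x => (h 0 0 x + h 0 1 x) + (h 1 0 x + h 1 1 x))); last first.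
  by apply/funext => x; rewrite !sum2.
rewrite !sum2; apply: (has_integralD (f := fun x => _ + _) (g := fun x => _ + _));
  exact: has_integralD.
Qed.

Lemma has_integral_le f g r s : has_integral f r -> has_integral g s ->
  (forall x, f x <= g x) -> r <= s.
Proof. by move=> [iF <-] [iG <-] fg; exact: le_Rintegral. Qed.

Lemma sqint_norm f : sqint mu f -> sqint mu (fun x => `|f x|).
Proof.
move=> sf; apply: (sqint_le _ _ sf); last by move=> x; rewrite normr_id.
by apply: measurableT_comp => //; case: sf.
Qed.

Lemma nrm_norm f : nrm mu (fun x => `|f x|) = nrm mu f.
Proof.
rewrite /nrm; congr Num.sqrt; apply: eq_Rintegral => x _.
by rewrite -!expr2 real_normK// num_real.
Qed.

Lemma nrm_bounded_mul c f g : measurable_fun setT f ->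
  (forall x, `|f x| <= c) -> sqint mu g -> nrm mu (fun x => f x * g x) <= `|c| * nrm mu g.
Proof.
move=> mf fc sg; rewrite -nrmZ//; apply: ler_nrm.
- exact: sqint_bounded_mul sg.
- exact: sqintZ.
by move=> x; rewrite !normrM ler_wpM2r// (le_trans (fc x))// ler_norm.
Qed.

Lemma ip_cvg f (g : nat -> T -> R) h (e : nat -> R) : sqint mu f ->
  (forall n, sqint mu (g n)) -> sqint mu h ->
  (forall n, nrm mu (fun x => g n x - h x) <= e n) -> e n @[n --> \oo] --> (0 : R) ->
  ip mu f (g n) @[n --> \oo] --> ip mu f h.
Proof.
move=> sf sg sh ge ce.
have c : ip mu f (g n) - ip mu f h @[n --> \oo] --> (0 : R).
  apply/norm_cvg0P; apply: (@squeeze_cvgr _ _ _ _ (cst 0) (fun n => nrm mu f * e n)).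
  - apply: nearW => n; rewrite normr_ge0/= (ipC mu f (g n)) (ipC mu f h) -ipBl// ipC.
    apply: (le_trans (cauchy_schwarz sf (sqintB (sg n) sh))).
    by rewrite ler_wpM2l// nrm_ge0.
  - exact: cvg_cst.
  - by rewrite -(mulr0 (nrm mu f)); apply: cvgMl_tmp.
have E : (fun n => ip mu f (g n)) = (fun n => (ip mu f (g n) - ip mu f h) + ip mu f h).
  by apply/funext => n; rewrite subrK.
by rewrite E -[X in _ --> X]add0r; apply: cvgD c _; exact: cvg_cst.
Qed.

Lemma ip_norm_le f g b c : sqint mu f -> sqint mu g -> nrm mu f <= b -> nrm mu g <= c ->
  ip mu (fun x => `|f x|) (fun x => `|g x|) <= b * c.
Proof.
move=> sf sg fb gc; apply: (le_trans (ler_norm _)).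
apply: (le_trans (cauchy_schwarz (sqint_norm sf) (sqint_norm sg))).
by rewrite !nrm_norm ler_pM// nrm_ge0.
Qed.

End MoreL2.

Lemma cvg_sum2 (R : realType) (f : 'I_2 -> 'I_2 -> nat -> R) (l : 'I_2 -> 'I_2 -> R) :
  (forall i j, f i j n @[n --> \oo] --> l i j) ->
  \sum_i \sum_j f i j n @[n --> \oo] --> \sum_i \sum_j l i j.
Proof.
by move=> H; rewrite !sum2; under eq_fun do rewrite !sum2; apply: cvgD; apply: cvgD.
Qed.

Section CofactorEntries.
Context {R : realType}.

Lemma cof_entry (i j : 'I_2) : exists (b : bool) (i' j' : 'I_2),
  forall A : 'M[R]_2, cof A i j = (-1) ^+ b * A i' j'.
Proof.
have [->|->] := ord2 i; have [->|->] := ord2 j.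
- by exists false, 1, 1 => A; rewrite cofE mul1r.
- by exists true, 1, 0 => A; rewrite cofE mulN1r.
- by exists true, 0, 1 => A; rewrite cofE mulN1r.
- by exists false, 0, 0 => A; rewrite cofE mul1r.
Qed.

End CofactorEntries.

Section EnergyEstimate.
Context {R : realType}.
Local Notation plane := (measurableTypeR R * measurableTypeR R)%type.
Local Notation mu := (@leb2 R).
Local Notation sqint := (sqint mu).
Local Notation nrm := (nrm mu).
Local Notation ip := (ip mu).

Context (Om : set (R * R)) (gamma s0 kappa : R) (rho1 rho : R -> R).
Context (gamma1 : gamma < 1).
Context (hrho : rho_spec gamma s0 kappa rho1 rho).
Local Notation a := (derive1 rho).

Context (U : 'I_2 -> R * R -> R) (F : R * R -> 'M[R]_2) (V : 'I_2 -> nat -> R * R -> R).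
Context (sU : forall i, sqint (U i)).
Context (sF : forall i j, sqint (fun x => F x i j)).
Context (smoothV : forall i n, smooth2 (V i n)).
Context (sP : forall i n, sqint (fun x => V i n x * \1_Om x)).
Context (sQ : forall i j n, sqint (fun x => 'D_(e_ j) (V i n) x * \1_Om x)).
Context (cP : forall i, nrm (fun x => V i n x * \1_Om x - U i x) @[n --> \oo] --> (0 : R)).
Context (cQ : forall i j,
  nrm (fun x => 'D_(e_ j) (V i n) x * \1_Om x - F x i j) @[n --> \oo] --> (0 : R)).

Let T i j x := stress (a (\det (F x))) (F x) i j.

Context (weak : forall phi : 'I_2 -> R * R -> R, (forall i, test_function Om (phi i)) ->
  \sum_i \sum_j ip (T i j) ('D_(e_ j) (phi i)) = 0).

Context (eta : R * R -> R) (S : set (R * R)) (M h0 : R) (k : 'I_2).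
Context (seta : smooth2 eta).
Context (cS : compact S).
Context (eta0 : forall x, ~ S x -> eta x = 0).
Context (etaM : forall x, `|eta x| <= M).
Context (detaM : forall j x, `|'D_(e_ j) eta x| <= M).
Context (SOm : forall x t, S x -> 0 <= t <= h0 -> Om (x + t *: e_ k)).

Local Notation n_ := (fun j => 'D_(e_ j) eta).

Let measa : measurable_fun setT (a : measurableTypeR R -> R).
Proof.
by apply: continuous_measurable_fun; apply/smooth1_continuous/smooth1_derive1/(rho_smooth hrho).
Qed.

Let measdet : measurable_fun setT (fun x : plane => \det (F x)).
Proof.
under eq_fun do rewrite det2.
by apply: measurable_funB; apply: measurable_funM; exact: (sF _ _).1.
Qed.

Let scof i j : sqint (fun x => cof (F x) i j).
Proof.
have [b [i' [j' E]]] := cof_entry (R := R) i j.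
by under eq_fun do rewrite E; exact: sqintZ.
Qed.

Let a_bound x : 0 <= a (\det (F x)) <= gamma.
Proof. by rewrite (drho_ge0 hrho) (drho_le hrho). Qed.

Lemma stress_sqint i j : sqint (fun x => stress (a (\det (F x))) (F x) i j).
Proof.
apply: sqintD => //; apply: (sqint_bounded_mul (c := gamma)) => //.
- exact: measurableT_comp measdet.
- by move=> x; have /andP[? ?] := a_bound x; rewrite ger0_norm.
Qed.

Let sT i j : sqint (T i j) := stress_sqint i j.

Let deta0 j x : ~ S x -> 'D_(e_ j) eta x = 0.
Proof. by apply: derive_locally0 => //; exact: plane_compact_closed. Qed.

Let M0 : 0 <= M. Proof. by apply: le_trans (etaM (0, 0)). Qed.

Let meta : measurable_fun setT (eta : plane -> R).
Proof. by apply: continuous_measurable2; exact: smooth2_continuous. Qed.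

Let mdeta j : measurable_fun setT ('D_(e_ j) eta : plane -> R).
Proof. by apply: continuous_measurable2; exact/smooth2_continuous/smooth2_D. Qed.

Let m2 : measurable_fun setT (fun x : plane => eta x ^+ 2).
Proof. exact: measurable_funX. Qed.

Let b2 x : `|eta x ^+ 2| <= M ^+ 2.
Proof. by rewrite normrX lerXn2r ?nnegrE. Qed.

Let m3 j : measurable_fun setT (fun x : plane => 2 * eta x * 'D_(e_ j) eta x).
Proof. by apply: measurable_funM => //; exact: measurable_funM. Qed.

Let b3 j x : `|2 * eta x * 'D_(e_ j) eta x| <= 2 * M ^+ 2.
Proof. by rewrite !normrM (ger0_norm (ler0n _ 2)) -mulrA ler_wpM2l// ler_pM. Qed.

(** The equation tested with the difference of step [- h] of
    [eta ^ 2 (u (x + h e_k) - u x)]; that difference moves to the stress by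
    translation invariance. The test functions use the smooth approximations
    [V i n] of [u], and the identity passes to the limit since the stress is
    square integrable. *)
Lemma tested_equation h : 0 <= h <= h0 ->
  \sum_i \sum_j ip (fun x => T i j ((x : R * R) + h *: e_ k) - T i j x)
    (fun x => eta x ^+ 2 * (F ((x : R * R) + h *: e_ k) i j - F x i j) +
      2 * eta x * 'D_(e_ j) eta x * (U i ((x : R * R) + h *: e_ k) - U i x)) = 0.
Proof.
move=> hh0; have /andP[h_ge0 hle] := hh0; set v := h *: e_ k.
pose psi i n (x : R * R) := (eta x * eta x) * (V i n (x + v) - V i n x).
pose Y i j (x : R * R) := eta x ^+ 2 * (F (x + v) i j - F x i j) +
  2 * eta x * 'D_(e_ j) eta x * (U i (x + v) - U i x).
pose G i j (x : R * R) := T i j (x + v) - T i j x.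
have sG i j : sqint (G i j) by apply: sqintB => //; exact: sqint_shift (sT i j).
have smV i n : smooth2 (fun x => V i n (x + v) - V i n x).
  exact: (smooth2_sub (smooth2_translate v (smoothV i n)) (smoothV i n)).
have tpsi i n : test_function S (psi i n).
  apply/test_functionP; split.
    exact: (smooth2_mul (smooth2_mul seta seta) (smV i n)).
  by exists S; split=> // x /eta0; rewrite /psi => ->; rewrite !mul0r.
have SOm0 x : S x -> Om x.
  move=> Sx; have := SOm Sx (t := 0); rewrite scale0r addr0; apply.
  by rewrite lexx (le_trans h_ge0).
have tpsiOm i n : test_function Om (psi i n) by apply: test_functionS (tpsi i n).
have tphi i n : test_function Om (fun x => psi i n (x - v) - psi i n x).
  have t1 : test_function Om (fun x => psi i n (x - v)).
    apply: test_function_translate (tpsi i n) _ => x Sx; rewrite opprK.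
    exact: SOm.
  have := test_function_add t1 (test_function_scale (-1) (tpsiOm i n)).
  by under [X in test_function _ X -> _]eq_fun do rewrite mulN1r.
have Dphi i j n x : 'D_(e_ j) (fun x => psi i n (x - v) - psi i n x) x =
    'D_(e_ j) (psi i n) (x - v) - 'D_(e_ j) (psi i n) x.
  have sp := test_function_smooth (tpsi i n).
  rewrite (@deriveB _ _ _ (fun x => psi i n (x - v)) (psi i n)); first by rewrite derive_translate.
    by apply: derivable_translate; exact: smooth2_derivable.
  exact: smooth2_derivable.
have sDpsi i j n : sqint ('D_(e_ j) (psi i n)).
  by apply: sqint_test; exact: test_function_D (tpsi i n).
have step1 n : \sum_i \sum_j ip (G i j) ('D_(e_ j) (psi i n)) = 0.
  have := weak (phi := fun i x => psi i n (x - v) - psi i n x) (tphi ^~ n).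
  move=> w; apply: etrans w; apply: eq_bigr => i _; apply: eq_bigr => j _.
  rewrite (_ : 'D_(e_ j) (fun x => psi i n (x - v) - psi i n x) =
     fun x => 'D_(e_ j) (psi i n) (x - v) - 'D_(e_ j) (psi i n) x); last first.
    by apply/funext => x; exact: Dphi.
  have s1 : sqint (fun x => 'D_(e_ j) (psi i n) ((x : R * R) - v)) by exact: (sqint_shift (- v) (sDpsi i j n)).
  have sTv : sqint (fun x => T i j ((x : R * R) + v)) by exact: (sqint_shift v (sT i j)).
  have E1 : ip (G i j) ('D_(e_ j) (psi i n)) =
      ip (fun x => T i j ((x : R * R) + v)) ('D_(e_ j) (psi i n)) -
      ip (T i j) ('D_(e_ j) (psi i n)) by exact: ipBl.
  have E2 : ip (T i j) (fun x => 'D_(e_ j) (psi i n) ((x : R * R) - v)) =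
      ip (fun x => T i j ((x : R * R) + v)) ('D_(e_ j) (psi i n)).
    rewrite -(ip_shift v (sT i j) s1).
    suff -> : (fun x => 'D_(e_ j) (psi i n) ((x : R * R) + v - v)) = 'D_(e_ j) (psi i n) by [].
    by apply/funext => x; rewrite addrK.
  have E3 := ipBl s1 (sDpsi i j n) (sT i j).
  by rewrite E1 [RHS]ipC E3 -E2 [X in X - _]ipC [X in _ - X]ipC.
have sY i j : sqint (Y i j).
  apply: sqintD.
    by apply: (sqint_bounded_mul m2 b2); apply: sqintB => //; exact: (sqint_shift v (sF i j)).
  by apply: (sqint_bounded_mul (m3 j) (b3 j)); apply: sqintB => //; exact: (sqint_shift v (sU i)).
pose e1 i n := nrm (fun x => V i n x * \1_Om x - U i x).
pose e2 i j n := nrm (fun x => 'D_(e_ j) (V i n) x * \1_Om x - F x i j).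
have bnd i j n : nrm (fun x => 'D_(e_ j) (psi i n) x - Y i j x) <=
    M ^+ 2 * (2 * e2 i j n) + 2 * M ^+ 2 * (2 * e1 i n).
  have sPU : sqint (fun x => V i n x * \1_Om x - U i x) := sqintB (sP i n) (sU i).
  have sQF : sqint (fun x => 'D_(e_ j) (V i n) x * \1_Om x - F x i j) :=
    sqintB (sQ i j n) (sF i j).
  have sPUv := sqint_shift v sPU; have sQFv := sqint_shift v sQF.
  have -> : (fun x => 'D_(e_ j) (psi i n) x - Y i j x) = (fun x =>
     eta x ^+ 2 * (('D_(e_ j) (V i n) ((x : R * R) + v) * \1_Om ((x : R * R) + v)
         - F ((x : R * R) + v) i j) - ('D_(e_ j) (V i n) x * \1_Om x - F x i j)) +
     2 * eta x * 'D_(e_ j) eta x * ((V i n ((x : R * R) + v) * \1_Om ((x : R * R) + v)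
         - U i ((x : R * R) + v)) - (V i n x * \1_Om x - U i x))).
    have sVv := smooth2_translate v (smoothV i n).
    apply/funext => x; rewrite /psi (derive_mul2 j x (smooth2_mul seta seta) (smV i n)).
    rewrite (derive_mul2 j x seta seta) (derive_sub2 j x sVv (smoothV i n)).
    rewrite derive_translate /Y; have [Sx|/eta0 ->] := pselect (S x); last by ring.
    rewrite !indicE !mem_set ?mulr1; [ring|exact: SOm0|exact: SOm].
  have s2 := sqintB sQFv sQF; have s3 := sqintB sPUv sPU.
  apply: (le_trans (nrmD (sqint_bounded_mul m2 b2 s2) (sqint_bounded_mul (m3 j) (b3 j) s3))).
  apply: lerD.
    apply: (le_trans (nrm_bounded_mul m2 b2 s2)); rewrite ger0_norm ?sqr_ge0// ler_wpM2l ?sqr_ge0//.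
    by apply: (le_trans (nrmB sQFv sQF)); rewrite (nrm_shift v sQF) /e2; lra.
  apply: (le_trans (nrm_bounded_mul (m3 j) (b3 j) s3)); rewrite ger0_norm ?mulr_ge0 ?sqr_ge0// ler_wpM2l ?mulr_ge0 ?sqr_ge0//.
  by apply: (le_trans (nrmB sPUv sPU)); rewrite (nrm_shift v sPU) /e1; lra.
have cY i j : ip (G i j) ('D_(e_ j) (psi i n)) @[n --> \oo] --> ip (G i j) (Y i j).
  apply: (@ip_cvg _ _ _ mu (G i j) (fun n => 'D_(e_ j) (psi i n)) (Y i j)
    (fun n => M ^+ 2 * (2 * e2 i j n) + 2 * M ^+ 2 * (2 * e1 i n))) => //.
  rewrite -[X in _ --> X]addr0; apply: cvgD.
    rewrite -[X in _ --> X](mulr0 (M ^+ 2)); apply: cvgMl_tmp.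
    by rewrite -[X in _ --> X](mulr0 2); apply: cvgMl_tmp; exact: cQ.
  rewrite -[X in _ --> X](mulr0 (2 * M ^+ 2)); apply: cvgMl_tmp.
  by rewrite -[X in _ --> X](mulr0 2); apply: cvgMl_tmp; exact: cP.
have : \sum_i \sum_j ip (G i j) ('D_(e_ j) (psi i n)) @[n --> \oo] -->
    \sum_i \sum_j ip (G i j) (Y i j).
  exact: cvg_sum2 cY.
under eq_fun do rewrite step1.
by move=> /(cvg_lim (@norm_hausdorff _ _)); rewrite lim_cst//.
Qed.

Let seta_mul f : sqint f -> sqint (fun x => eta x * f x).
Proof. exact: sqint_bounded_mul. Qed.

Let sdeta_mul j f : sqint f -> sqint (fun x => 'D_(e_ j) eta x * f x).
Proof. by apply: sqint_bounded_mul => // x; exact: detaM. Qed.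

Let sX t i j : sqint (fun x => eta x * (F ((x : R * R) + t *: e_ k) i j - F x i j)).
Proof. by apply: seta_mul; apply: sqintB => //; exact: (sqint_shift _ (sF i j)). Qed.

Let sw t i : sqint (fun x => U i ((x : R * R) + t *: e_ k) - U i x).
Proof. by apply: sqintB => //; exact: (sqint_shift _ (sU i)). Qed.

Let scofD t i j : sqint (fun x => eta x * cof (F ((x : R * R) + t *: e_ k) - F x) i j).
Proof.
have [b [i' [j' E]]] := cof_entry (R := R) i j.
rewrite (_ : (fun x => _) = fun x => (-1) ^+ b * (eta x * (F ((x : R * R) + t *: e_ k) i' j' - F x i' j'))).
  exact: (sqintZ _ (sX t i' j')).
by apply/funext => x; rewrite E !mxE; ring.
Qed.

Context (L N : R).
Context (L0 : 0 < L).
Context (HL : forall s t, `|a s - a t| <= L * `|s - t|).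
Context (FN : forall i j, nrm (fun x => F x i j) <= N).

Let N0 : 0 <= N. Proof. exact: le_trans (nrm_ge0 _ _) (FN 0 0). Qed.

Let remainder_eta t B i : 0 <= t <= h0 ->
  (forall s, 0 <= s <= t -> forall i j,
     nrm (fun x => eta x * (F ((x : R * R) + s *: e_ k) i j - F x i j)) <= B) ->
  nrm (fun x => eta x * (U i ((x : R * R) + t *: e_ k) - U i x - t * F x i k)) <= t * B.
Proof.
move=> /andP[t0 th] HB.
apply: (@remainder_sobolev R Om (U i) (fun x => F x i k) (V i) eta k M S t B) => //.
- by move=> x s Sx /andP[s0' st]; apply: SOm => //; rewrite s0' (le_trans st).
- by move=> s st; exact: HB.
Qed.

Let remainder_deta t i j : 0 <= t <= h0 ->
  nrm (fun x => 'D_(e_ j) eta x * (U i ((x : R * R) + t *: e_ k) - U i x)) <= 3 * t * (M * N).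
Proof.
move=> /andP[t0 th].
have sFs s : sqint (fun x => F ((x : R * R) + s *: e_ k) i k - F x i k).
  by apply: sqintB => //; exact: (sqint_shift _ (sF i k)).
have H : nrm (fun x => 'D_(e_ j) eta x *
    (U i ((x : R * R) + t *: e_ k) - U i x - t * F x i k)) <= t * (M * (N + N)).
  apply: (@remainder_sobolev R Om (U i) (fun x => F x i k) (V i) ('D_(e_ j) eta) k M S t) => //.
  - by move=> x; exact: deta0.
  - by move=> x s Sx /andP[s0' st]; apply: SOm => //; rewrite s0' (le_trans st).
  - move=> s st; apply: (le_trans (nrm_bounded_mul (mdeta j) (detaM j) (sFs s))).
    rewrite ger0_norm// ler_wpM2l//.
    apply: (le_trans (nrmB (sqint_shift _ (sF i k)) (sF i k))).
    by rewrite (nrm_shift _ (sF i k)) lerD.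
have E : (fun x => 'D_(e_ j) eta x * (U i ((x : R * R) + t *: e_ k) - U i x)) =
  (fun x => 'D_(e_ j) eta x * (U i ((x : R * R) + t *: e_ k) - U i x - t * F x i k) +
     t * ('D_(e_ j) eta x * F x i k)).
  by apply/funext => x; ring.
have sR : sqint (fun x => U i ((x : R * R) + t *: e_ k) - U i x - t * F x i k).
  by apply: sqintB => //; exact: (sqintZ t (sF i k)).
rewrite E; apply: (le_trans (nrmD (sdeta_mul j sR) (sqintZ t (sdeta_mul j (sF i k))))).
have := nrm_bounded_mul (mdeta j) (detaM j) (sF i k).
rewrite nrmZ; last exact: (sdeta_mul j (sF i k)).
rewrite !ger0_norm// => h1.
have : t * nrm (fun x => 'D_(e_ j) eta x * F x i k) <= t * (M * N).
  by rewrite ler_wpM2l// (le_trans h1)// ler_wpM2l.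
by move: H; lra.
Qed.

(** By the Cauchy-Schwarz inequality the norms of the entries of [F] bound the
    integral of this majorant of the determinant. *)
Let detmaj x := `|F x 0 0| * `|F x 1 1| + `|F x 0 1| * `|F x 1 0|.

Let detmaj_le x : `|\det (F x)| <= detmaj x.
Proof. by rewrite det2 /detmaj -!normrM; exact: ler_normB. Qed.

Let detmaj_integral : exists2 z, has_integral mu detmaj z & z <= 2 * N ^+ 2.
Proof.
exists (ip (fun x => `|F x 0 0|) (fun x => `|F x 1 1|) +
        ip (fun x => `|F x 0 1|) (fun x => `|F x 1 0|)).
  by apply: has_integralD; apply: has_integral_ip; apply: sqint_norm.
have h1 := ip_norm_le (sF 0 0) (sF 1 1) (FN 0 0) (FN 1 1).
have h2 := ip_norm_le (sF 0 1) (sF 1 0) (FN 0 1) (FN 1 0).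
by rewrite expr2; move: h1 h2; lra.
Qed.

(** [B] bounds the differences of the gradient for all steps up to [t], and so
    does [t * B] the first order remainder of [u]. As [eta] stands at the point
    where the differences start, the same weighted norm occurs on both sides. *)
Lemma energy_step t B : 0 <= t <= h0 ->
  (forall s, 0 <= s <= t -> forall i j,
     nrm (fun x => eta x * (F ((x : R * R) + s *: e_ k) i j - F x i j)) <= B) ->
  (1 - gamma) * (\sum_i \sum_j
     nrm (fun x => eta x * (F ((x : R * R) + t *: e_ k) i j - F x i j)) ^+ 2) <=
  56 * (M * N) * (t * B) +
    4 * t ^+ 2 * (L * s0 ^+ 2 * nrm ('D_(e_ k) eta) ^+ 2 + 4 * (M ^+ 2 * N ^+ 2)).
Proof.
move=> tt HB; have /andP[t0 th] := tt; set v := t *: e_ k.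
have tt' : 0 <= t <= t by rewrite t0 lexx.
have B0 : 0 <= B := le_trans (nrm_ge0 _ _) (HB t tt' 0 0).
pose X i j x := eta x * (F ((x : R * R) + v) i j - F x i j).
pose XC i j x := eta x * cof (F ((x : R * R) + v) - F x) i j.
pose w i x := U i ((x : R * R) + v) - U i x.
pose W i j x := 'D_(e_ j) eta x * w i x.
pose C i j x := 'D_(e_ j) eta x * cof (F x) i j.
pose Q i x := eta x * (w i x - t * F x i k).
have nX i j : nrm (X i j) <= B by exact: HB.
have nXC i j : nrm (XC i j) <= B.
  have [b [i' [j' E]]] := cof_entry (R := R) i j.
  rewrite (_ : XC i j = fun x => (-1) ^+ b * X i' j' x).
    by rewrite (nrmZ _ (sX t i' j')) normr_sign mul1r; exact: nX.
  by apply/funext => x; rewrite /XC E !mxE /X; ring.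
have sW i j : sqint (W i j) by apply: sdeta_mul; exact: sw.
have nW i j : nrm (W i j) <= 3 * t * (M * N) by exact: remainder_deta.
have sC i j : sqint (C i j) by exact: sdeta_mul.
have nC i j : nrm (C i j) <= M * N.
  apply: (le_trans (nrm_bounded_mul (mdeta j) (detaM j) (scof i j))).
  rewrite ger0_norm// ler_wpM2l//; have [b [i' [j' E]]] := cof_entry (R := R) i j.
  rewrite (_ : (fun x => _) = fun x => (-1) ^+ b * F x i' j'); last exact/funext.
  by rewrite (nrmZ _ (sF i' j')) normr_sign mul1r.
have sQ' i : sqint (Q i).
  by apply: seta_mul; apply: sqintB; [exact: sw|exact: (sqintZ t (sF i k))].
have nQ i : nrm (Q i) <= t * B by exact: remainder_eta.
have stest : sqint ('D_(e_ k) eta).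
  apply: (@sqint_test _ S); apply: test_function_D; apply/test_functionP.
  by split=> //; exists S; split.
pose G i j x := T i j ((x : R * R) + v) - T i j x.
have sG i j : sqint (G i j) by apply: sqintB => //; exact: (sqint_shift v (sT i j)).
pose Y i j x := eta x ^+ 2 * (F ((x : R * R) + v) i j - F x i j) +
  2 * eta x * 'D_(e_ j) eta x * w i x.
have sY i j : sqint (Y i j).
  apply: sqintD.
    by apply: (sqint_bounded_mul m2 b2); apply: sqintB => //; exact: (sqint_shift v (sF i j)).
  by apply: (sqint_bounded_mul (m3 j) (b3 j)); exact: sw.
have [z hz zN] := detmaj_integral.
have hzv : has_integral mu (fun x => detmaj ((x : R * R) + v)) z.
  case: hz => iz <-; split; last exact: (Rintegral_shift v iz).
  exact: (integrable_shift v iz).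
have I1 := has_integral_sum2 (fun i j => has_integral_ip (sG i j) (sY i j)).
rewrite (tested_equation tt) in I1.
have I2 := has_integral_sum2 (fun i j => has_integralZ 2 (has_integral_ip
  (sqintD (sqint_norm (sX t i j)) (sqint_norm (scofD t i j))) (sqint_norm (sW i j)))).
have I3 := has_integral_sum2 (fun i j => has_integralZ 2 (has_integral_ip
  (sqint_norm (sC i j)) (sqint_norm (sQ' i)))).
have I4 := has_integralZ (4 * t ^+ 2) (has_integralD
  (has_integralZ (L * s0 ^+ 2) (has_integral_ip stest stest))
  (has_integralZ (M ^+ 2) (has_integralD hzv hz))).
have I0 := has_integralZ (1 - gamma) (has_integral_sum2 (fun i j =>
  has_integral_ip (sX t i j) (sX t i j))).
have pw x : (1 - gamma) * (\sum_i \sum_j X i j x * X i j x) <=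
    \sum_i \sum_j G i j x * Y i j x +
    \sum_i \sum_j 2 * ((`|X i j x| + `|XC i j x|) * `|W i j x|) +
    \sum_i \sum_j 2 * (`|C i j x| * `|Q i x|) +
    4 * t ^+ 2 * (L * s0 ^+ 2 * ('D_(e_ k) eta x * 'D_(e_ k) eta x) +
      M ^+ 2 * (detmaj ((x : R * R) + v) + detmaj x)).
  have := energy_pointwise (eta x) k (fun j => 'D_(e_ j) eta x) (fun i => w i x) L0 t0
    (a_bound x) (a_bound ((x : R * R) + v)) (drho_mono hrho _ _) (drho_sqr_le hrho HL _ _)
    (drho_arg_le hrho _ _) gamma1.
  have -> : \sum_i \sum_j X i j x * X i j x =
      \sum_i \sum_j (eta x * (F ((x : R * R) + v) i j - F x i j)) ^+ 2.
    by apply: eq_bigr => i _; apply: eq_bigr => j _; rewrite expr2.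
  move=> /le_trans; apply; rewrite lerD2l; apply: ler_wpM2l.
    by rewrite mulr_ge0// sqr_ge0.
  apply: lerD; first by rewrite exprMn -mulrA expr2.
  apply: ler_pM; rewrite ?sqr_ge0//.
    by rewrite -(real_normK (num_real _)) lerXn2r ?nnegrE.
  by apply: (le_trans (ler_normB _ _)); apply: lerD.
have := has_integral_le I0 (has_integralD (has_integralD (has_integralD I1 I2) I3) I4) pw.
have X2 : \sum_i \sum_j nrm (X i j) ^+ 2 = \sum_i \sum_j ip (X i j) (X i j).
  by apply: eq_bigr => i _; apply: eq_bigr => j _; rewrite nrm_sqr.
rewrite X2 => /le_trans; apply.
rewrite add0r nrm_sqr; apply: lerD; last first.
  rewrite ler_wpM2l ?mulr_ge0 ?sqr_ge0// lerD2l mulrCA ler_wpM2l ?sqr_ge0//.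
  by move: zN; lra.
have b1 i j : 2 * ip (fun x => `|X i j x| + `|XC i j x|) (fun x => `|W i j x|) <=
    2 * ((B + B) * (3 * t * (M * N))).
  rewrite ler_wpM2l//.
  rewrite (ipDl (sqint_norm (sX t i j)) (sqint_norm (scofD t i j)) (sqint_norm (sW i j))).
  rewrite mulrDl; apply: lerD.
    exact: (ip_norm_le (sX t i j) (sW i j) (nX i j) (nW i j)).
  exact: (ip_norm_le (scofD t i j) (sW i j) (nXC i j) (nW i j)).
have b3' i j : 2 * ip (fun x => `|C i j x|) (fun x => `|Q i x|) <= 2 * ((M * N) * (t * B)).
  by rewrite ler_wpM2l//; exact: (ip_norm_le (sC i j) (sQ' i) (nC i j) (nQ i)).
apply: (@le_trans _ _ (\sum_(i < 2) \sum_(j < 2) 2 * ((B + B) * (3 * t * (M * N))) +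
    \sum_(i < 2) \sum_(j < 2) 2 * ((M * N) * (t * B)))).
  by apply: lerD; apply: ler_sum => i _; apply: ler_sum => j _; [exact: b1|exact: b3'].
(* each of the four pairs [(i, j)] contributes [(12 + 2) M N t B] *)
rewrite !sum2; lra.
Qed.

(** With [B] the supremum over the steps up to [h], which is finite because the
    gradient is square integrable, [energy_step] reads
    [(1 - gamma) B^2 <= K1 h B + K2 h^2]. *)
Lemma difference_bound : exists2 C, 0 <= C & forall h, 0 <= h <= h0 -> forall i j,
  nrm (fun x => eta x * (F ((x : R * R) + h *: e_ k) i j - F x i j)) <= C * h.
Proof.
set K1 := 56 * (M * N).
set K2 := 4 * (L * s0 ^+ 2 * nrm ('D_(e_ k) eta) ^+ 2 + 4 * (M ^+ 2 * N ^+ 2)).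
have K1_ge0 : 0 <= K1 by rewrite !mulr_ge0.
have K2_ge0 : 0 <= K2.
  have h1 : 0 <= L * s0 ^+ 2 * nrm ('D_(e_ k) eta) ^+ 2.
    by rewrite mulr_ge0 ?sqr_ge0// mulr_ge0 ?sqr_ge0// ltW.
  have h2 : 0 <= M ^+ 2 * N ^+ 2 by rewrite mulr_ge0 ?sqr_ge0.
  by rewrite /K2; lra.
have g1 : 0 < 1 - gamma by rewrite subr_gt0.
pose C := 1 + (K1 + K2) / (1 - gamma).
have C0 : 0 <= (K1 + K2) / (1 - gamma) by apply: divr_ge0; [exact: addr_ge0|exact: ltW].
exists C; first by rewrite addr_ge0.
move=> h /andP[hge0 hle].
pose X s i j := nrm (fun x => eta x * (F ((x : R * R) + s *: e_ k) i j - F x i j)).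
pose E := [set y | exists s i j, 0 <= s <= h /\ y = X s i j].
have Eub y : E y -> y <= M * (N + N).
  move=> [s [i [j [_ ->]]]].
  apply: (le_trans (nrm_bounded_mul meta etaM (sqintB (sqint_shift _ (sF i j)) (sF i j)))).
  rewrite ger0_norm// ler_wpM2l//.
  apply: (le_trans (nrmB (sqint_shift _ (sF i j)) (sF i j))).
  by rewrite (nrm_shift _ (sF i j)) lerD.
have E0 : E !=set0.
  by exists (X 0 0 0), 0, 0, 0; rewrite lexx hge0.
have hsE : has_sup E by split=> //; exists (M * (N + N)) => y; exact: Eub.
set B := sup E.
have XB s i j : 0 <= s <= h -> X s i j <= B.
  move=> sh; apply: ub_le_sup; first by case: hsE.
  by exists s, i, j.
have B0 : 0 <= B.
  by apply: (le_trans (nrm_ge0 mu _)) (XB 0 0 0 _); rewrite lexx hge0.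
have step y : E y -> (1 - gamma) * y ^+ 2 <= K1 * (h * B) + K2 * h ^+ 2.
  move=> [s [i [j [/andP[s0' sh] ->]]]].
  have ss : 0 <= s <= h0 by rewrite s0' (le_trans sh).
  have := @energy_step s B ss _.
  have HB s' : 0 <= s' <= s -> forall i j, X s' i j <= B.
    by move=> /andP[s'0 s's] i' j'; apply: XB; rewrite s'0 (le_trans s's).
  move=> /(_ HB) H.
  have : (1 - gamma) * X s i j ^+ 2 <= (1 - gamma) * (\sum_i \sum_j X s i j ^+ 2).
    rewrite ler_pM2l// (bigD1 i)//= (bigD1 j)//= -addrA lerDl addr_ge0//.
      by apply: sumr_ge0 => j' _; exact: sqr_ge0.
    by apply: sumr_ge0 => i' _; apply: sumr_ge0 => j' _; exact: sqr_ge0.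
  move=> /le_trans; apply; apply: (le_trans H); apply: lerD.
    by rewrite ler_wpM2l// ler_wpM2r.
  have -> : 4 * s ^+ 2 * (L * s0 ^+ 2 * nrm ('D_(e_ k) eta) ^+ 2 + 4 * (M ^+ 2 * N ^+ 2))
    = K2 * s ^+ 2 by rewrite /K2; ring.
  by rewrite ler_wpM2l// lerXn2r ?nnegrE.
have Bstep : (1 - gamma) * B ^+ 2 <= K1 * (h * B) + K2 * h ^+ 2.
  have D0 : 0 <= (K1 * (h * B) + K2 * h ^+ 2) / (1 - gamma).
    apply: divr_ge0; last exact: ltW.
    by apply: addr_ge0; [rewrite !mulr_ge0|rewrite mulr_ge0// sqr_ge0].
  have : B <= Num.sqrt ((K1 * (h * B) + K2 * h ^+ 2) / (1 - gamma)).
    apply: ge_sup => // y Ey; apply: (le_trans (ler_norm y)).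
    rewrite -sqrtr_sqr; apply: ler_wsqrtr.
    by rewrite ler_pdivlMr// mulrC; exact: step.
  rewrite -ler_sqr ?nnegrE ?sqrtr_ge0// sqr_sqrtr// ler_pdivlMr// mulrC//.
move=> i j; apply: (@le_trans _ _ B); first by apply: XB; rewrite hge0 lexx.
have [Bh|hB] := leP B h.
  by rewrite (le_trans Bh)// ler_peMl// lerDl.
have : (1 - gamma) * B <= (K1 + K2) * h.
  rewrite -(ler_pM2r (le_lt_trans hge0 hB)).
  have : K2 * h ^+ 2 <= K2 * (h * B) by rewrite ler_wpM2l// expr2 ler_wpM2l// ltW.
  by move: Bstep; rewrite expr2; lra.
rewrite mulrC -ler_pdivlMr// => /le_trans; apply.
have -> : C * h = h + (K1 + K2) * h / (1 - gamma) by rewrite /C mulrDl mul1r mulrAC.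
by rewrite lerDr.
Qed.

End EnergyEstimate.

(** * From difference quotients to weak derivatives *)

Section WeakDerivativeBound.
Context {R : realType}.
Local Notation plane := (measurableTypeR R * measurableTypeR R)%type.
Local Notation mu := (@leb2 R).
Local Notation sqint := (sqint mu).
Local Notation nrm := (nrm mu).
Local Notation ip := (ip mu).
Implicit Types (Om U S K : set (R * R)) (k : 'I_2) (x : R * R) (phi : R * R -> R).

(** A cut-off function equal to [1] on [S] has bounded derivatives, so that it is
    positive, hence [x + t e_k] is in [Om], for small [t]. *)
Lemma compact_margin (sigma : R -> R) Om S : smooth_step sigma -> compact S -> open Om -> S `<=` Om ->
  exists2 h, 0 < h & forall k x t, S x -> 0 <= t <= h -> Om (x + t *: e_ k).
Proof.
move=> ssig cS oOm SOm; have [phi [tphi _ phi1]] := cutoff ssig cS oOm SOm.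
have sphi := test_function_smooth tphi.
have [M0 M0_ge HM0] := test_function_bounded (test_function_D 0 tphi).
have [M1 M1_ge HM1] := test_function_bounded (test_function_D 1 tphi).
have HM k x : `|'D_(e_ k) phi x| <= M0 + M1.
  have [->|->] := ord2 k.
  - by rewrite (le_trans (HM0 x))// lerDl.
  - by rewrite (le_trans (HM1 x))// lerDr.
have M2 : 0 < M0 + M1 + 1 by rewrite ltr_pwDr// addr_ge0.
exists ((M0 + M1 + 1)^-1 / 2); first by rewrite divr_gt0// invr_gt0.
move=> k x t Sx /andP[t0 th]; apply: contrapT => /(test_function_out tphi) p0.
have [|c _] := line_MVT x t0 (f := phi) (v := e_ k).
  by move=> y; exact: smooth2_derivable.
rewrite p0 phi1// sub0r => E.
have h1 : `|t * 'D_(e_ k) phi (x + c *: e_ k)| <= (M0 + M1 + 1)^-1 / 2 * (M0 + M1 + 1).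
  rewrite normrM ger0_norm//; apply: ler_pM => //.
  by rewrite (le_trans (HM _ _))// lerDl.
move: h1; rewrite -E normrN1 mulrAC mulVf ?gt_eqF//; lra.
Qed.

Lemma test_difference_bounds U phi k : test_function U phi ->
  exists2 C, 0 <= C & forall t, 0 <= t <= 1 ->
    nrm (fun x => phi ((x : R * R) + t *: e_ k) - phi x) <= C * t /\
    nrm (fun x => phi ((x : R * R) + t *: e_ k) - phi x - t * 'D_(e_ k) phi x) <= C * t ^+ 2.
Proof.
move=> tphi; have /test_functionP[sphi [K [cK _ phi0]]] := tphi.
have [M M0 HM] := test_function_bounded (test_function_D k tphi).
pose K1 := (fun z : (R * R) * R => z.1 - z.2 *: e_ k) @` (K `*` `[0, 1]).
have cK1 : compact K1.
  apply: continuous_compact; last by apply: compact_setX => //; exact: segment_compact.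
  apply: continuous_subspaceT => z; apply: cvgB; first exact: cvg_fst.
  by apply: cvgZr_tmp; exact: cvg_snd.
have K1P x t : 0 <= t <= 1 -> K (x + t *: e_ k) -> K1 x.
  move=> t01 Kx; exists (x + t *: e_ k, t); last by rewrite /= addrK.
  by split=> //=; rewrite in_itv.
have K1P0 x : K x -> K1 x.
  by move=> Kx; apply: (K1P x 0); rewrite ?lexx ?ler01// scale0r addr0.
have [C2 C20 HC2] := second_order_bound k sphi cK1 (ler01 : (0 : R) <= 1).
have mK1 := compact_measurable2 cK1.
have s1 : sqint (\1_K1 : R * R -> R).
  apply: (sqint_compact_supp (K := K1) (M := 1)) => //.
    by move=> x nx; rewrite indicE memNset.
  by move=> x; rewrite indicE; case: (_ \in _); rewrite ?normr1 ?normr0.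
have stest := sqint_test tphi.
have sD := sqint_test (test_function_D k tphi).
have maj f c : 0 <= c -> sqint f -> (forall x, ~ K1 x -> f x = 0) ->
    (forall x, K1 x -> `|f x| <= c) -> nrm f <= c * nrm (\1_K1 : R * R -> R).
  move=> c0 sf f0 fc; rewrite -[c]ger0_norm// -nrmZ//.
  apply: ler_nrm => //; first exact: sqintZ.
  move=> x; rewrite normrM (ger0_norm c0) indicE; have [Kx|nKx] := pselect (K1 x).
    by rewrite mem_set// normr1 mulr1; exact: fc.
  by rewrite memNset// f0// normr0 mulr0.
have out x t : 0 <= t <= 1 -> ~ K1 x -> phi (x + t *: e_ k) = 0.
  by move=> t01 nx; apply: phi0 => Kx; apply: nx; exact: K1P Kx.
have out0 x : ~ K1 x -> phi x = 0 by move=> nx; apply: phi0 => /K1P0.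
exists ((M + C2) * nrm (\1_K1 : R * R -> R)); first by rewrite mulr_ge0 ?addr_ge0// nrm_ge0.
move=> t t01; have /andP[t0 t1] := t01.
have n0 := nrm_ge0 mu (\1_K1 : R * R -> R).
have sv := sqint_shift (t *: e_ k) stest.
split.
  apply: (le_trans (maj _ (M * t) _ _ _ _)).
  - by rewrite mulr_ge0.
  - exact: sqintB.
  - by move=> x nx; rewrite out// out0// subrr.
  - move=> x _; have [|c _ ->] := line_MVT x t0 (f := phi) (v := e_ k).
      by move=> y; exact: smooth2_derivable.
    by rewrite normrM ger0_norm// mulrC ler_wpM2r.
  - by rewrite [leRHS]mulrAC ler_wpM2r// ler_wpM2r// lerDl.
apply: (le_trans (maj _ (C2 * t ^+ 2) _ _ _ _)).
- by rewrite mulr_ge0// sqr_ge0.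
- by apply: sqintB; [exact: sqintB|exact: sqintZ].
- move=> x nx; rewrite out// out0// (@derive_locally0 _ K)//.
  + by rewrite mulr0 !subr0.
  + exact: plane_compact_closed.
  + by move=> /K1P0.
- move=> x Kx; have := HC2 x 0 t Kx; rewrite add0r scale0r addr0; apply => //.
- by rewrite [leRHS]mulrAC ler_wpM2r// ler_wpM2r ?sqr_ge0// lerDr.
Qed.

(** Up to an error of order [t], [t] times the left-hand side is the pairing of
    [phi] with a difference of [F], where [eta] is [1]. *)
Lemma gradient_pairing_bound U F eta k C h0 phi : 0 < h0 -> sqint F ->
  sqint eta -> (forall x, U x -> eta x = 1) ->
  (forall t, sqint (fun x => eta x * (F ((x : R * R) + t *: e_ k) - F x))) ->
  (forall t, 0 <= t <= h0 ->
     nrm (fun x => eta x * (F ((x : R * R) + t *: e_ k) - F x)) <= C * t) ->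
  test_function U phi -> `|ip F ('D_(e_ k) phi)| <= C * nrm phi.
Proof.
move=> h0_gt sF seta eta1 sX HX tphi.
have [C1 C10 HC1] := test_difference_bounds k tphi.
have [C2 C20 HC2] := test_difference_bounds k (test_function_D k tphi).
have sphi := sqint_test tphi.
have sD := sqint_test (test_function_D k tphi).
apply/ler_addgt0Pr => e e0.
pose K := nrm F * (C1 + C2).
have K0 : 0 <= K by rewrite mulr_ge0 ?nrm_ge0// addr_ge0.
pose t := Num.min (Num.min h0 1) (e / (K + 1)).
have t0 : 0 < t by rewrite /t !lt_min h0_gt ltr01 divr_gt0// ltr_pwDr.
have th : t <= h0 by rewrite /t !ge_min lexx.
have t1 : t <= 1 by rewrite /t !ge_min lexx orbT.
have te : t * K <= e.
  have : t <= e / (K + 1) by rewrite /t ge_min lexx orbT.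
  rewrite ler_pdivlMr ?ltr_pwDr//; apply: le_trans.
  by rewrite ler_pM2l// lerDl.
have tt1 : 0 <= t <= 1 by rewrite ltW.
have tth : 0 <= t <= h0 by rewrite (ltW t0).
set v := t *: e_ k.
have sFv := sqint_shift v sF; have sphiv := sqint_shift v sphi; have sDv := sqint_shift v sD.
pose r (x : R * R) := phi (x + v) - phi x - t * 'D_(e_ k) phi x.
have sr : sqint r by apply: sqintB; [exact: sqintB|exact: sqintZ].
have A1 : ip (fun x => F ((x : R * R) + v) - F x) phi =
   ip (fun x => eta x * (F ((x : R * R) + v) - F x)) phi.
  apply: eq_Rintegral => x _; have [Ux|nUx] := pselect (U x).
    by rewrite eta1// mul1r.
  by rewrite (test_function_out tphi nUx) !mulr0.
have A2 : ip (fun x => F ((x : R * R) + v) - F x) phi =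
    - (t * ip (fun x => F ((x : R * R) + v)) ('D_(e_ k) phi) + ip (fun x => F ((x : R * R) + v)) r).
  have B1 : ip (fun x => F ((x : R * R) + v)) (fun x => phi ((x : R * R) + v)) = ip F phi.
    exact: ip_shift.
  rewrite ipBl// -B1.
  have -> : (fun x => phi ((x : R * R) + v)) = (fun x => (phi x + t * 'D_(e_ k) phi x) + r x).
    by apply/funext => x; rewrite /r; ring.
  rewrite (ipC mu _ (fun x => _ + r x)) ipDl//; last by apply: sqintD => //; exact: sqintZ.
  rewrite ipDl//; last exact: sqintZ.
  by rewrite ipZl// (ipC mu phi) (ipC mu ('D_(e_ k) phi)) (ipC mu r); ring.
have A3 : ip (fun x => F ((x : R * R) + v)) ('D_(e_ k) phi) = ip F ('D_(e_ k) phi) -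
   ip (fun x => F ((x : R * R) + v)) (fun x => 'D_(e_ k) phi ((x : R * R) + v) - 'D_(e_ k) phi x).
  rewrite (ipC mu _ (fun x => _ - _)) ipBl// (ipC mu (fun x => 'D_(e_ k) phi (_ + v))).
  have -> : ip (fun x => F ((x : R * R) + v)) (fun x => 'D_(e_ k) phi ((x : R * R) + v)) =
    ip F ('D_(e_ k) phi) by exact: ip_shift.
  by rewrite (ipC mu ('D_(e_ k) phi)); ring.
have [_ r2] := HC1 _ tt1; have [d1 _] := HC2 _ tt1.
have nFv : nrm (fun x => F ((x : R * R) + v)) = nrm F by exact: nrm_shift.
have B1 : `|ip (fun x => F ((x : R * R) + v)) r| <= nrm F * (C1 * t ^+ 2).
  apply: (le_trans (cauchy_schwarz sFv sr)); rewrite nFv.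
  by rewrite ler_wpM2l// nrm_ge0.
have B2 : `|ip (fun x => F ((x : R * R) + v))
    (fun x => 'D_(e_ k) phi ((x : R * R) + v) - 'D_(e_ k) phi x)| <= nrm F * (C2 * t).
  apply: (le_trans (cauchy_schwarz sFv (sqintB sDv sD))); rewrite nFv.
  by rewrite ler_wpM2l// nrm_ge0.
have B3 : `|ip (fun x => F ((x : R * R) + v) - F x) phi| <= (C * t) * nrm phi.
  rewrite A1; apply: (le_trans (cauchy_schwarz (sX t) sphi)).
  by rewrite ler_wpM2r ?nrm_ge0// HX.
move: A2 B1 B2 B3; rewrite A3.
move: (ip (fun x => F ((x : R * R) + v) - F x) phi) => z.
move: (ip _ r) => y; move: (ip F ('D_(e_ k) phi)) => w; move: (ip _ _) => u.
move=> A2 B1 B2 B3.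
have E : t * w = t * u - y - z by rewrite A2; ring.
have : t * `|w| <= t * (nrm F * (C2 * t)) + nrm F * (C1 * t ^+ 2) + C * t * nrm phi.
  rewrite -(gtr0_norm t0) -normrM E (gtr0_norm t0).
  apply: (le_trans (ler_normB _ _)); apply: lerD => //.
  apply: (le_trans (ler_normB _ _)); apply: lerD => //.
  by rewrite normrM (gtr0_norm t0) ler_pM2l.
have -> : t * (nrm F * (C2 * t)) + nrm F * (C1 * t ^+ 2) + C * t * nrm phi =
  t * (t * K + C * nrm phi) by rewrite /K; ring.
by rewrite ler_pM2l// => h; apply: (le_trans h); rewrite addrC lerD2l.
Qed.

End WeakDerivativeBound.

(** * Weak derivatives *)

Section WeakDerivatives.
Context {R : realType}.
Local Notation plane := (measurableTypeR R * measurableTypeR R)%type.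
Local Notation mu := (@leb2 R).
Local Notation sqint := (sqint mu).
Local Notation nrm := (nrm mu).
Local Notation ip := (ip mu).
Implicit Types (sigma : R -> R) (Om U S K : set (R * R)) (x : R * R) (f g phi : R * R -> R).

Lemma loc_int_measurable Om f : open Om -> locally_integrable2 Om f ->
  measurable_fun (Om : set plane) f.
Proof.
move=> /open_bigcup_boxes[B [BOm E]] lf; rewrite [X in measurable_fun X]E.
apply/measurable_fun_bigcup.
  by move=> n; exact: measurable_obox.
move=> n; apply: (measurable_funS (measurable_cbox (B n).1 (B n).2)).
  exact: obox_sub_cbox.
apply/measurable_EFinP.
exact: (measurable_int mu (lf _ (@cbox_compact _ _ _) (BOm n))).
Qed.

Lemma loc_intS U Om f : U `<=` Om -> locally_integrable2 Om f -> locally_integrable2 U f.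
Proof. by move=> UOm lf K cK KU; apply: lf => //; exact: subset_trans UOm. Qed.

Lemma loc_intB Om f g : locally_integrable2 Om f -> locally_integrable2 Om g ->
  locally_integrable2 Om (fun x => f x - g x).
Proof.
move=> lf lg K cK KOm.
rewrite (_ : EFin \o _ = (EFin \o f) \- (EFin \o g))%E; last first.
  by apply/funext => x; rewrite /= EFinB.
apply: integrableB; [exact: compact_measurable2|exact: lf|exact: lg].
Qed.

Lemma sqint_loc_int U g : sqint g -> locally_integrable2 U g.
Proof.
move=> sg K cK _; have mK := compact_measurable2 cK.
have s1 : sqint (\1_K : R * R -> R).
  apply: (sqint_compact_supp (K := K) (M := 1)) => //.
    by move=> x nx; rewrite indicE memNset.
  by move=> x; rewrite indicE; case: (_ \in _); rewrite ?normr1 ?normr0.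
have := sqint_integrable_mul sg s1.
move=> /(integrableS measurableT mK (@subsetT _ _)).
apply: eq_integrable => // x /set_mem Kx.
by rewrite /= indicE mem_set// mulr1.
Qed.

Lemma sqint_L2 U g : measurable (U : set plane) -> sqint g -> L2 U g.
Proof.
move=> mU [mg ig]; split; first exact: measurable_funTS.
exact: integrableS ig.
Qed.

Lemma L2_sub U Om g : measurable (U : set plane) -> measurable (Om : set plane) ->
  U `<=` Om -> L2 Om g -> L2 U g.
Proof.
move=> mU mOm UOm [mg ig]; split; first exact: measurable_funS mg.
exact: integrableS ig.
Qed.

Lemma mul_indicE Om f : (fun x => f x * \1_Om x) = f \_ Om.
Proof.
apply/funext => x; rewrite patchE indicE; case: (x \in Om); first by rewrite mulr1.
by rewrite mulr0.
Qed.

Lemma L2_sqint Om g : measurable (Om : set plane) -> L2 Om g ->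
  sqint (fun x => g x * \1_Om x).
Proof.
move=> mOm [mg ig]; split; first by rewrite mul_indicE; apply/(measurable_restrictT g mOm).
move: ig => /(integrable_mkcond _ mOm); apply: eq_integrable => // x _.
rewrite patchE /= indicE; case: (x \in Om); first by rewrite mulr1.
by rewrite mulr0n mulr0 expr0n.
Qed.

Lemma test_function_partials U s phi : test_function U phi ->
  test_function U (partials s phi).
Proof. by move=> tphi; elim: s => //= i s; exact: test_function_D. Qed.

Lemma weak_derivS U Om s f g : U `<=` Om -> weak_deriv Om s f g -> weak_deriv U s f g.
Proof.
move=> UOm [lf lg fg]; split; [exact: loc_intS lf|exact: loc_intS lg|].
move=> phi tphi; have tOm := test_functionS UOm tphi.
have tsU := test_function_partials s tphi; have tsOm := test_function_partials s tOm.
have := fg _ tOm; rewrite (Rintegral_test f tsOm) (Rintegral_test g tOm).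
by rewrite (Rintegral_test f tsU) (Rintegral_test g tphi).
Qed.

Lemma weak_deriv_id U f : locally_integrable2 U f -> weak_deriv U [::] f f.
Proof. by move=> lf; split=> // phi tphi; rewrite expr0 mul1r. Qed.

Lemma weak_deriv_unique sigma Om s f g1 g2 : smooth_step sigma -> open Om ->
  weak_deriv Om s f g1 -> weak_deriv Om s f g2 ->
  {ae mu, forall x, Om x -> g1 x = g2 x}.
Proof.
move=> ssig oOm [_ l1 H1] [_ l2 H2].
have : {ae mu, forall x, Om x -> g1 x - g2 x = 0}.
  apply: (vanish_ae ssig oOm (loc_intB l1 l2)) => phi tphi.
  have i1 := loc_int_test l1 tphi; have i2 := loc_int_test l2 tphi.
  have := H1 phi tphi; rewrite (H2 phi tphi) (Rintegral_test g1 tphi) (Rintegral_test g2 tphi).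
  move=> /(mulfI (negbT (signr_eq0 _ _))) E.
  transitivity (\int[mu]_x (g1 x * phi x - g2 x * phi x)).
    by apply: eq_Rintegral => x _; rewrite mulrBl.
  by rewrite (RintegralB measurableT i1 i2) E subrr.
move=> [Z [mZ Z0 HZ]]; exists Z; split=> // x /= nx; apply: HZ => /= H; apply: nx => Ox.
by apply/eqP; rewrite -subr_eq0; apply/eqP/H.
Qed.

(** The distance of [v n] to the square integrable [g] is finite only from some
    index on, hence the eventual form of the second conclusion. *)
Lemma approx_L2 Om (v : nat -> R * R -> R) f g : open Om ->
  (forall n, continuous (v n)) -> measurable_fun (Om : set plane) f -> L2 Om g ->
  {ae mu, forall x, Om x -> f x = g x} ->
  (\int[mu]_(x in Om) ((v n x - f x) ^+ 2)%:E)%E @[n --> \oo] --> 0%E ->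
  nrm (fun x => v n x * \1_Om x - g x * \1_Om x) @[n --> \oo] --> (0 : R) /\
  \forall n \near \oo, sqint (fun x => v n x * \1_Om x).
Proof.
move=> oOm cv mf Lg fg cvg0; have mOm := open_measurable2 oOm.
have sg := L2_sqint mOm Lg; have [mg _] := Lg.
have mv n : measurable_fun (Om : set plane) (v n).
  by apply: measurable_funTS; exact: continuous_measurable2.
have m1 n : measurable_fun setT (fun x : plane => v n x * \1_Om x).
  by rewrite mul_indicE; apply/(measurable_restrictT (v n) mOm); exact: mv.
have m2 n : measurable_fun setT (fun x : plane => v n x * \1_Om x - g x * \1_Om x).
  by apply: measurable_funB => //; case: sg.
have E n : (\int[mu]_(x in Om) ((v n x - f x) ^+ 2)%:E =
    \int[mu]_x ((v n x * \1_Om x - g x * \1_Om x) ^+ 2)%:E)%E.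
  transitivity (\int[mu]_(x in Om) ((v n x - g x) ^+ 2)%:E)%E.
    apply: ae_eq_integral => //.
    - by apply/measurable_EFinP; apply: measurable_funX; exact: measurable_funB.
    - by apply/measurable_EFinP; apply: measurable_funX; exact: measurable_funB.
    - case: fg => Z [mZ Z0 HZ]; exists Z; split=> // x /= nx; apply: HZ => /= H.
      by apply: nx => Ox; rewrite H.
  rewrite integral_mkcond; apply: eq_integral => x _.
  rewrite patchE indicE; case: (x \in Om); first by rewrite !mulr1.
  by rewrite !mulr0 subrr expr0n.
have c : (\int[mu]_x ((v n x * \1_Om x - g x * \1_Om x) ^+ 2)%:E)%E @[n --> \oo] --> 0%E.
  by under eq_fun do rewrite -E.
split; first exact: cvg_nrm0.
have /fine_cvgP[fin _] := c.
near=> n.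
have sd : sqint (fun x => v n x * \1_Om x - g x * \1_Om x).
  split=> //; apply/integrableP; split.
    by apply/measurable_EFinP; exact: measurable_funX.
  under eq_integral do rewrite gee0_abs ?lee_fin ?sqr_ge0//.
  by rewrite ltey_eq; apply/orP; left; near: n.
have := sqintD sd sg.
by under [X in sqint X -> _]eq_fun do rewrite subrK.
Unshelve. all: by end_near. Qed.

Lemma measurable_stress (a : R -> R) (Om : set plane) (G : R * R -> 'M[R]_2) i j :
  measurable Om -> measurable_fun setT (a : measurableTypeR R -> R) ->
  (forall i j, measurable_fun Om (fun x => G x i j)) ->
  measurable_fun Om (fun x => stress (a (\det (G x))) (G x) i j).
Proof.
move=> mOm ma mG; apply: measurable_funD => //; apply: measurable_funM.
  apply: measurableT_comp => //; under eq_fun do rewrite det2.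
  by apply: measurable_funB; exact: measurable_funM.
have [b [i' [j' E]]] := cof_entry (R := R) i j.
by under eq_fun do rewrite E; apply: measurable_funM.
Qed.

End WeakDerivatives.

(** * Stationary points *)

Section Assembly.
Context {R : realType}.
Local Notation plane := (measurableTypeR R * measurableTypeR R)%type.
Local Notation mu := (@leb2 R).
Local Notation sqint := (sqint mu).
Local Notation nrm := (nrm mu).
Local Notation ip := (ip mu).
Implicit Types (sigma : R -> R) (Om U S K : set (R * R)) (x : R * R) (f g phi : R * R -> R).

(** The trace comes with approximations of [f] and of its gradient by functions
    smooth on the whole plane; the weak derivatives that they converge to agree
    with the square integrable ones by uniqueness. The sequence is shifted past
    its terms of infinite norm. *)
Lemma sobolev_approximation sigma Om f h : smooth_step sigma -> open Om ->
  sobolev 1 Om f -> has_trace Om f h ->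
  exists (z : (R * R -> R) * ('I_2 -> R * R -> R) * (nat -> R * R -> R)),
  [/\ weak_deriv Om [::] f z.1.1 /\ L2 Om z.1.1, forall j, weak_deriv Om [:: j] f (z.1.2 j) /\ L2 Om (z.1.2 j),
      forall n, smooth2 (z.2 n),
      (forall n, sqint (fun x => z.2 n x * \1_Om x)) /\
        nrm (fun x => z.2 n x * \1_Om x - z.1.1 x * \1_Om x) @[n --> \oo] --> (0 : R) &
      forall j, (forall n, sqint (fun x => 'D_(e_ j) (z.2 n) x * \1_Om x)) /\
        nrm (fun x => 'D_(e_ j) (z.2 n) x * \1_Om x - z.1.2 j x * \1_Om x) @[n --> \oo] --> (0 : R)].
Proof.
move=> ssig oOm sf [_ [g [v [wg sv cv cdv _]]]].
have [f0 [wf0 Lf0]] := sf [::] isT.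
have /choice[G GP] : forall j : 'I_2, exists g, weak_deriv Om [:: j] f g /\ L2 Om g.
  by move=> j; exact: sf.
have lf : locally_integrable2 Om f by case: wf0.
have [c0 n0] := approx_L2 oOm (fun n => smooth2_continuous (sv n))
  (loc_int_measurable oOm lf) Lf0
  (weak_deriv_unique ssig oOm (weak_deriv_id lf) wf0) cv.
have H j := approx_L2 oOm (fun n => smooth2_continuous (smooth2_D j (sv n)))
  (loc_int_measurable oOm (let: And3 _ l _ := wg j in l)) (GP j).2
  (weak_deriv_unique ssig oOm (wg j) (GP j).1) (cdv j).
have [N _ HN] := filterI n0 (filterI (H 0).2 (H 1).2).
have HN' n : [/\ sqint (fun x => v (n + N)%N x * \1_Om x),
    sqint (fun x => 'D_(e_ 0) (v (n + N)%N) x * \1_Om x) &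
    sqint (fun x => 'D_(e_ 1) (v (n + N)%N) x * \1_Om x)].
  by have [? [? ?]] := HN (n + N)%N (leq_addl _ _); split.
exists (f0, G, fun n => v (n + N)%N); split=> //=.
- split; first by move=> n; case: (HN' n).
  by rewrite (cvg_shiftn N (fun n => nrm (fun x => v n x * \1_Om x - f0 x * \1_Om x))).
- move=> j; split.
    by move=> n; have [->|->] := ord2 j; case: (HN' n).
  rewrite (cvg_shiftn N (fun n => nrm (fun x => 'D_(e_ j) (v n) x * \1_Om x - G j x * \1_Om x))).
  exact: (H j).1.
Qed.

(** The weak gradient occurring in the equation may be exchanged for the square
    integrable one, extended by zero: both integrands agree almost everywhere on
    [Om] and the test functions vanish outside. *)
Lemma stationary_weak sigma (gamma s0 kappa : R) (rho1 rho : R -> R) Om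
    (u : R * R -> 'cV[R]_2) (G : 'I_2 -> 'I_2 -> R * R -> R) (F : R * R -> 'M[R]_2) :
  smooth_step sigma -> rho_spec gamma s0 kappa rho1 rho -> open Om ->
  stationary Om rho u ->
  (forall i j, weak_deriv Om [:: j] (component u i) (G i j)) ->
  (forall i j x, F x i j = G i j x * \1_Om x) ->
  (forall i j, sqint (fun x => F x i j)) ->
  (forall i j, sqint (fun x => stress (derive1 rho (\det (F x))) (F x) i j)) ->
  forall phi : 'I_2 -> R * R -> R, (forall i, test_function Om (phi i)) ->
  \sum_i \sum_j ip (fun x => stress (derive1 rho (\det (F x))) (F x) i j)
     ('D_(e_ j) (phi i)) = 0.
Proof.
move=> ssig hrho oOm [Du wDu EL] wG FE sF sT phi tphi.
have mOm := open_measurable2 oOm.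
have ma : measurable_fun setT (derive1 rho : measurableTypeR R -> R).
  by apply: continuous_measurable_fun; apply/smooth1_continuous/smooth1_derive1/(rho_smooth hrho).
pose Phi (x : R * R) : 'cV[R]_2 := \col_i phi i x.
have PhiE i : component Phi i = phi i by apply/funext => x; rewrite /component mxE.
have tPhi i : test_function Om (component Phi i) by rewrite PhiE.
have sD i j : sqint ('D_(e_ j) (phi i)) by apply: sqint_test; exact: test_function_D (tphi i).
have [_ <-] := has_integral_sum2 (fun i j => has_integral_ip (sT i j) (sD i j)).
rewrite -[RHS](EL Phi tPhi) [RHS]Rintegral_mkcond.
have mDu i j : measurable_fun (Om : set plane) (fun x => Du x i j).
  by apply: loc_int_measurable => //; case: (wDu i j).
have mD i j : measurable_fun (Om : set plane) ('D_(e_ j) (phi i)).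
  exact: (measurable_funTS (sD i j).1).
have frobE x : frob (Du x + derive1 rho (\det (Du x)) *: cof (Du x)) (gradient Phi x) =
   \sum_i \sum_j stress (derive1 rho (\det (Du x))) (Du x) i j * 'D_(e_ j) (phi i) x.
  apply: eq_bigr => i _; apply: eq_bigr => j _; congr (_ * _).
    by rewrite [LHS]mxE [X in _ + X]mxE.
  by rewrite [LHS]mxE PhiE.
congr fine; apply: ae_eq_integral => //.
- apply/measurable_EFinP; under eq_fun do rewrite !sum2.
  have mm i j : measurable_fun setT (fun x : plane =>
      stress (derive1 rho (\det (F x))) (F x) i j * 'D_(e_ j) (phi i) x).
    by apply: measurable_funM; [exact: (sT i j).1|exact: (sD i j).1].
  by apply: measurable_funD; apply: measurable_funD; exact: mm.
- apply/measurable_EFinP; apply/(measurable_restrictT _ mOm).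
  under eq_fun do rewrite frobE !sum2.
  by apply: measurable_funD; apply: measurable_funD; apply: measurable_funM => //;
    exact: measurable_stress.
have ae i j := weak_deriv_unique ssig oOm (wDu i j) (wG i j).
apply: (negligibleS _ (negligibleU (negligibleU (ae 0 0) (ae 0 1))
  (negligibleU (ae 1 0) (ae 1 1)))) => x /= ne.
apply: contrapT => /not_orP[/not_orP[/contrapT h00 /contrapT h01] /not_orP[/contrapT h10 /contrapT h11]].
apply: ne => _.
rewrite patchE; case: ifPn => [/set_mem Ox|]; last first.
  rewrite notin_setE => nOx; rewrite (_ : point = 0)//; congr EFin.
  rewrite big1// => i _; rewrite big1// => j _.
  by rewrite (test_function_out (test_function_D j (tphi i)) nOx) mulr0.
have -> : F x = Du x.
  apply/matrixP => i j; rewrite FE indicE mem_set// mulr1.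
  by have [->|->] := ord2 i; have [->|->] := ord2 j; rewrite ?h00 ?h01 ?h10 ?h11.
by rewrite frobE.
Qed.

End Assembly.

(** * Second derivatives *)

Section SecondDerivatives.
Context {R : realType}.
Local Notation mu := (@leb2 R).
Local Notation sqint := (sqint mu).
Local Notation nrm := (nrm mu).
Local Notation ip := (ip mu).
Implicit Types (Om U : set (R * R)) (F f phi : R * R -> R).

Lemma riesz_weak_derivative U F (k : 'I_2) (C : R) : sqint F ->
  (forall phi, test_function U phi -> `|ip F ('D_(e_ k) phi)| <= C * nrm phi) ->
  exists2 g, sqint g & forall phi, test_function U phi -> ip F ('D_(e_ k) phi) = - ip g phi.
Proof.
move=> sF HC.
have sD phi : test_function U phi -> sqint ('D_(e_ k) phi).
  by move=> tphi; apply: sqint_test; exact: test_function_D tphi.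
have [||f g c tf tg|f g c tf tg|f tf|g sg Hg] := @riesz_subspace _ _ _ mu (test_function U)
    (fun phi => - ip F ('D_(e_ k) phi)) C.
- by move=> f; exact: sqint_test.
- exact: test_function0.
- by apply: test_function_add => //; exact: test_function_scale.
- have [sf sg] := (test_function_smooth tf, test_function_smooth tg).
  have -> : 'D_(e_ k) (fun x => f x + c * g x) = fun x => 'D_(e_ k) f x + c * 'D_(e_ k) g x.
    apply/funext => x.
    have dg : derivable g x (e_ k) by exact: smooth2_derivable.
    rewrite (@deriveD _ _ _ f (fun x => c * g x)).
    + by rewrite (@deriveMl _ _ g).
    + exact: smooth2_derivable.
    + by apply: smooth2_derivable; exact: smooth2_scale.
  rewrite (ipC mu F) (ipDl (sD _ tf) (sqintZ c (sD _ tg)) sF) (ipZl c (sD _ tg) sF).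
  by rewrite [ip _ F]ipC [ip _ F]ipC opprD mulrN.
- by rewrite normrN; exact: HC.
- by exists g => // phi tphi; rewrite -Hg// opprK.
Qed.

Lemma sobolev2_of_gradient Om U f f0 (G : 'I_2 -> R * R -> R) :
  open U -> open Om -> U `<=` Om ->
  weak_deriv Om [::] f f0 -> L2 Om f0 ->
  (forall j, weak_deriv Om [:: j] f (G j) /\ L2 Om (G j)) ->
  (forall j k, exists2 g, sqint g & forall phi, test_function U phi ->
     ip (fun x => G j x * \1_Om x) ('D_(e_ k) phi) = - ip g phi) ->
  sobolev 2 U f.
Proof.
move=> oU oOm UOm wf0 Lf0 GP H s.
have [mU mOm] := (open_measurable2 oU, open_measurable2 oOm).
case: s => [_|j [_|k [_|//]]].
- exists f0; split; first exact: weak_derivS wf0.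
  exact: L2_sub Lf0.
- have [wG LG] := GP j; exists (G j); split; first exact: weak_derivS wG.
  exact: L2_sub LG.
have [wG LG] := GP j; have [g sg gP] := H j k.
have [lf _ wGU] := weak_derivS UOm wG.
exists g; split; last exact: sqint_L2.
split=> //; first exact: sqint_loc_int.
move=> phi tphi; have tD := test_function_D k tphi.
have := wGU _ tD => /= ->.
rewrite (Rintegral_test g tphi) (Rintegral_test (G j) tD) /=.
have -> : \int[mu]_x (G j x * 'D_(e_ k) phi x) =
    ip (fun x => G j x * \1_Om x) ('D_(e_ k) phi).
  apply: eq_Rintegral => x _; rewrite indicE.
  have [Ox|nOx] := pselect (Om x); first by rewrite mem_set// mulr1.
  rewrite (test_function_out tD); first by rewrite !mulr0.
  by move=> /UOm.
by rewrite gP// expr1 sqrrN expr1n mul1r mulN1r opprK.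
Qed.

End SecondDerivatives.

Theorem theorem2p8 (R : realType) (Om : set (R * R))
    (gamma s0 kappa : R) (rho1 rho : R -> R) (u0 u : R * R -> 'cV[R]_2) :
  open Om -> bounded_set Om -> lipschitz_boundary Om ->
  gamma < 1 -> rho_spec gamma s0 kappa rho1 rho ->
  admissible Om u0 u -> stationary Om rho u ->
  W22_loc Om u.
Proof.
move=> oOm _ _ g1 hrho adm EL U oU cU UOm.
have ssig := drho_step hrho.
have mOm := open_measurable2 oOm.
have /choice[z zP] := fun i => sobolev_approximation ssig oOm (adm i).1 (adm i).2.
pose V i n := (z i).2 n; pose G i j := (z i).1.2 j.
pose Ut i x := (z i).1.1 x * \1_Om x.
pose F x : 'M[R]_2 := \matrix_(i, j) (G i j x * \1_Om x).
have FE i j x : F x i j = G i j x * \1_Om x by rewrite mxE.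
have FE' i j : (fun x => F x i j) = (fun x => G i j x * \1_Om x).
  by apply/funext => x; rewrite FE.
have sU i : sqint leb2 (Ut i) by have [[_ LU] _ _ _ _] := zP i; exact: L2_sqint.
have sF i j : sqint leb2 (fun x => F x i j).
  by rewrite FE'; have [_ /(_ j)[_ LG] _ _ _] := zP i; exact: L2_sqint.
have smV i n : smooth2 (V i n) by have [_ _ + _ _] := zP i; exact.
have sP i n : sqint leb2 (fun x => V i n x * \1_Om x).
  by have [_ _ _ [+ _] _] := zP i; exact.
have cP i : nrm leb2 (fun x => V i n x * \1_Om x - Ut i x) @[n --> \oo] --> (0 : R).
  by have [_ _ _ [_ +] _] := zP i.
have sQ i j n : sqint leb2 (fun x => 'D_(e_ j) (V i n) x * \1_Om x).
  by have [_ _ _ _ /(_ j)[+ _]] := zP i; exact.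
have cQ i j : nrm leb2 (fun x => 'D_(e_ j) (V i n) x * \1_Om x - F x i j) @[n --> \oo] --> (0 : R).
  have [_ _ _ _ /(_ j)[_ +]] := zP i.
  by under [X in _ -> X @ _ --> _]eq_fun do under [X in nrm _ X]eq_fun do rewrite FE.
have wG i j : weak_deriv Om [:: j] (component u i) (G i j).
  by have [_ /(_ j)[]] := zP i.
have sT := stress_sqint hrho sF.
have weak := stationary_weak ssig hrho oOm EL wG FE sF sT.
have [eta [teta _ eta1]] := cutoff ssig cU oOm UOm.
have /test_functionP[seta [S [cS SOm eta0]]] := teta.
have [M [etaM detaM]] : exists M, (forall x, `|eta x| <= M) /\
    (forall j x, `|'D_(e_ j) eta x| <= M).
  have [A A0 HA] := test_function_bounded teta.
  have [B B0 HB] := test_function_bounded (test_function_D 0 teta).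
  have [C C0 HC] := test_function_bounded (test_function_D 1 teta).
  exists (A + B + C); split=> [x|j x]; first by have := HA x; lra.
  by have [->|->] := ord2 j; [have := HB x|have := HC x]; lra.
have [h0 h0_gt margin] := compact_margin ssig cS oOm SOm.
have [L L0 HL] := drho_lipschitz hrho.
have [N FN] : exists N, forall i j, nrm leb2 (fun x => F x i j) <= N.
  exists (\sum_i \sum_j nrm leb2 (fun x => F x i j)) => i j.
  rewrite (bigD1 i)//= (bigD1 j)//= -addrA lerDl addr_ge0//.
    by apply: sumr_ge0 => j' _; exact: nrm_ge0.
  by apply: sumr_ge0 => i' _; apply: sumr_ge0 => j' _; exact: nrm_ge0.
move=> i; have [[wU LU] GP _ _ _] := zP i.
apply: (sobolev2_of_gradient oU oOm _ wU LU GP) => [|j k].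
  by apply: subset_trans UOm; exact: subset_closure.
rewrite -/(G i j) -FE'.
have [C _ HC] := difference_bound g1 hrho sU sF smV sP sQ cP cQ weak seta cS eta0
  etaM detaM (margin k) L0 HL FN.
apply: (riesz_weak_derivative (C := C)) => // phi tphi.
apply: (gradient_pairing_bound (U := U) (eta := eta) h0_gt) => //.
- exact: sqint_test teta.
- by move=> x Ux; apply: eta1; exact: subset_closure.
- move=> t; apply: (sqint_bounded_mul (c := M)) => //.
    exact: (continuous_measurable2 (smooth2_continuous seta)).
  by apply: sqintB => //; exact: (sqint_shift _ (sF i j)).
- by move=> t th; exact: HC.
Qed.
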